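(* Assume that for each $i=1,2,3,4$: (a) there exist $L_i>0$ and a positive function $\kappa_i$ on $E_i$ of at most polynomial growth such that $|a_i(x)-a_i(y)|\le L_i|x-y|$, $|c_i(x,z)-c_i(y,z)|\le \kappa_i(z)|x-y|$ and $|c_i(x,z)|\le\kappa_i(z)(1+|x|)$ for all $x,y\in\mathbb{R}^{d_i}$, $z\in E_i$; (b) $a_i\in C^4_{\uparrow}(\mathbb{R}^{d_i})$; (c) there exist $\bar r_i>0$ and $K_i>0$ such that $f_i(z)\mathbf{1}_{\{|z|\le \bar r_i\}}\le K_i|z|^{1-d_i}$, and $\int|z|^Lf_i(z)dz<\infty$ for all $L\ge1$; (d) for some $c_{i,0}>0$, $\inf_x|c_i(x,z)|\ge c_{i,0}|z|$ for all $z$ near the origin. Assume that, for each model $m$, the prior density $\pi_m$ is continuous and bounded on $\bar\Theta_m$ with $\pi_m(\bar\theta_m)>0$, and that $\mathbf H_m(\theta_m)=\mathbf H_m(\bar\theta_m)$ implies $\theta_m=\bar\theta_m$. Then for every misspecified model $m\in\mathcal M^c$, $$\mathbf P\bigl(\mathbf{QBIC}_n(m^* )<\mathbf{QBIC}_n(m)\bigr)\longrightarrow1\qquad(n\to\infty).$$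
   Context: True model. $(\Omega,\mathcal F,(\mathcal F_t)_{t\ge0},\mathbf P)$ is a filtered probability space. $p_1,p_2,k_1\le p_1,k_2\le p_2,r_1,\dots,r_4$ are positive integers, $p=p_1+p_2$, $(d_1,d_2,d_3,d_4)=(k_1,p_1,p_2,k_2)$, $E_i=\mathbb{R}^{d_i}\setminus\{0\}$. For $i=1,2,3,4$, $W_i$ is an $r_i$-dimensional standard $(\mathcal F_t)$-Wiener process and $\mu_i(dt,dz)$ is a Poisson random measure on $\mathbb{R}_+\times E_i$ with compensator $f_i(z)\,dz\,dt$, $f_i=\lambda_{i,0}F_i$, $\lambda_{i,0}>0$, $F_i$ a probability density. For every $t\ge0$, the $\sigma$-algebras $\mathcal F_t$, $\sigma(W_{i,u}-W_{i,t};u\ge t)$ $(i=1,\dots,4)$ and $\sigma(\mu_i(A\cap((t,\infty)\times E_i));A\subset\mathbb{R}_+\times E_i\text{ Borel})$ $(i=1,\dots,4)$ are independent. The latent càdlàg $(\mathcal F_t)$-adapted processes $Y_1=\xi$, $Y_2=\delta$, $Y_3=\varepsilon$, $Y_4=\zeta$ ($Y_i$ is $\mathbb{R}^{d_i}$-valued) solve $$dY_{i,t}=a_i(Y_{i,t-})dt+\mathbf S_{i,0}dW_{i,t}+\int_{E_i}c_i(Y_{i,t-},z)\mu_i(dt,dz),\quad Y_{i,0}=x_{i,0},$$ with Borel functions $a_i:\mathbb{R}^{d_i}\to\mathbb{R}^{d_i}$, $c_i:\mathbb{R}^{d_i}\times E_i\to\mathbb{R}^{d_i}$, constant matrices $\mathbf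 S_{i,0}\in\mathbb{R}^{d_i\times r_i}$ and non-random $x_{i,0}$. The observed process is $X_t=(X_{1,t}^\top,X_{2,t}^\top)^\top\in\mathbb{R}^p$, $X_{1,t}=\mathbf\Lambda_{1,0}\xi_t+\delta_t$, $X_{2,t}=\mathbf\Lambda_{2,0}\eta_t+\varepsilon_t$, $\eta_t=\mathbf B_0\eta_t+\mathbf\Gamma_0\xi_t+\zeta_t$, where $\mathbf\Lambda_{1,0}\in\mathbb{R}^{p_1\times k_1}$, $\mathbf\Lambda_{2,0}\in\mathbb{R}^{p_2\times k_2}$ have full column rank, $\mathbf\Gamma_0\in\mathbb{R}^{k_2\times k_1}$, $\mathbf B_0\in\mathbb{R}^{k_2\times k_2}$ has zero diagonal and $\mathbf\Psi_0=\mathbb I_{k_2}-\mathbf B_0$ is non-singular. With $\mathbf\Sigma_{\xi\xi,0}=\mathbf S_{1,0}\mathbf S_{1,0}^\top$, $\mathbf\Sigma_{\delta\delta,0}=\mathbf S_{2,0}\mathbf S_{2,0}^\top$, $\mathbf\Sigma_{\varepsilon\varepsilon,0}=\mathbf S_{3,0}\mathbf S_{3,0}^\top$, $\mathbf\Sigma_{\zeta\zeta,0}=\mathbf S_{4,0}\mathbf S_{4,0}^\top$, let $\mathbf\Sigma_0$ be the symmetric $p\times p$ matrix with blocks $\mathbf\Sigma_0^{11}=\mathbf\Lambda_{1,0}\mathbf\Sigma_{\xi\xi,0}\mathbf\Lambda_{1,0}^\top+\mathbf\Sigma_{\delta\delta,0}$, $\mathbf\Sigma_0^{12}=\mathbf\Lambda_{1,0}\mathbf\Sigma_{\xi\xi,0}\mathbf\Gamma_0^\top\mathbf\Psi_0^{-1\top}\mathbf\Lambda_{2,0}^\top$,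 $\mathbf\Sigma_0^{22}=\mathbf\Lambda_{2,0}\mathbf\Psi_0^{-1}(\mathbf\Gamma_0\mathbf\Sigma_{\xi\xi,0}\mathbf\Gamma_0^\top+\mathbf\Sigma_{\zeta\zeta,0})\mathbf\Psi_0^{-1\top}\mathbf\Lambda_{2,0}^\top+\mathbf\Sigma_{\varepsilon\varepsilon,0}$, assumed positive definite. The data are $X_{t_i^n}$, $t_i^n=ih_n$, $i=0,\dots,n$, with $T=nh_n$ fixed; $\Delta_i^nX=X_{t_i^n}-X_{t_{i-1}^n}$. Parametric models $m\in\{1,\dots,M\}$. $\Theta_m\subset\mathbb{R}^{q_m}$ is a bounded open convex set; $\theta_m\in\Theta_m$ consists of the unknown entries of the loading and volatility matrices. Model $m$ is the same system with $\mathbf\Lambda_{1,0},\mathbf\Lambda_{2,0},\mathbf\Gamma_0,\mathbf B_0,\mathbf S_{i,0}$ replaced by matrices $\mathbf\Lambda_{1,m}^\theta,\mathbf\Lambda_{2,m}^\theta,\mathbf\Gamma_m^\theta,\mathbf B_m^\theta,\mathbf S_{i,m}^\theta$ depending on $\theta_m$ ($\mathbf\Lambda_{1,m}^\theta,\mathbf\Lambda_{2,m}^\theta$ of full column rank, $\mathbf B_m^\theta$ with zero diagonal, $\mathbf\Psi_m^\theta=\mathbb I-\mathbf B_m^\theta$ non-singular). With $\mathbf\Sigma_{\xi\xi,m}^\theta=\mathbf S_{1,m}^\theta\mathbf S_{1,m}^{\theta\top}$, $\mathbf\Sigma_{\delta\delta,m}^\theta=\mathbf S_{2,m}^\theta\mathbf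 S_{2,m}^{\theta\top}$, $\mathbf\Sigma_{\varepsilon\varepsilon,m}^\theta=\mathbf S_{3,m}^\theta\mathbf S_{3,m}^{\theta\top}$, $\mathbf\Sigma_{\zeta\zeta,m}^\theta=\mathbf S_{4,m}^\theta\mathbf S_{4,m}^{\theta\top}$, $\mathbf\Sigma_m(\theta_m)$ is the symmetric $p\times p$ matrix with blocks $\mathbf\Sigma_m^{11}(\theta_m)=\mathbf\Lambda_{1,m}^\theta\mathbf\Sigma_{\xi\xi,m}^\theta\mathbf\Lambda_{1,m}^{\theta\top}+\mathbf\Sigma_{\delta\delta,m}^\theta$, $\mathbf\Sigma_m^{12}(\theta_m)=\mathbf\Lambda_{1,m}^\theta\mathbf\Sigma_{\xi\xi,m}^\theta\mathbf\Gamma_m^{\theta\top}\mathbf\Psi_m^{\theta-1\top}\mathbf\Lambda_{2,m}^{\theta\top}$, $\mathbf\Sigma_m^{22}(\theta_m)=\mathbf\Lambda_{2,m}^\theta\mathbf\Psi_m^{\theta-1}(\mathbf\Gamma_m^\theta\mathbf\Sigma_{\xi\xi,m}^\theta\mathbf\Gamma_m^{\theta\top}+\mathbf\Sigma_{\zeta\zeta,m}^\theta)\mathbf\Psi_m^{\theta-1\top}\mathbf\Lambda_{2,m}^{\theta\top}+\mathbf\Sigma_{\varepsilon\varepsilon,m}^\theta$; it is positive definite for all $\theta_m\in\bar\Theta_m$. With $D>0$ and $\rho\in[1/3,1/2)$, $$\mathbf H_{m,n}(\theta_m)=-\frac1{2h_n}\sum_{i=1}^n(\Delta_i^nX)^\top\mathbf\Sigma_m(\theta_m)^{-1}(\Delta_i^nX)\mathbf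 1_{\{|\Delta_i^nX|\le Dh_n^\rho\}}-\frac12\sum_{i=1}^n\log\det\mathbf\Sigma_m(\theta_m)\mathbf 1_{\{|\Delta_i^nX|\le Dh_n^\rho\}},$$ which is three times continuously differentiable in $\theta_m$ with derivatives up to order three extending continuously to $\partial\Theta_m$. The estimator $\hat\theta_{m,n}\in\bar\Theta_m$ satisfies $\mathbf H_{m,n}(\hat\theta_{m,n})=\sup_{\theta_m\in\bar\Theta_m}\mathbf H_{m,n}(\theta_m)$, and $$\mathbf{QBIC}_n(m)=-2\mathbf H_{m,n}(\hat\theta_{m,n})+q_m\log n.$$ Let $\mathcal M=\{m\in\{1,\dots,M\}:\exists\,\theta_{m,0}\in\Theta_m,\ \mathbf\Sigma_0=\mathbf\Sigma_m(\theta_{m,0})\}$ (correctly specified models) and $\mathcal M^c=\{1,\dots,M\}\setminus\mathcal M$ (misspecified models). The optimal model $m^*=\mathrm{argmin}_{m\in\mathcal M}\dim(\Theta_m)$ ($\dim(\Theta_m)=q_m$) is assumed to be unique. Put $\mathbf H_m(\theta_m)=-\frac12\mathrm{tr}\{\mathbf\Sigma_m(\theta_m)^{-1}\mathbf\Sigma_0\}-\frac12\log\det\mathbf\Sigma_m(\theta_m)$; the optimal parameter $\bar\theta_m\in\Theta_m$ satisfies $\mathbf H_m(\bar\theta_m)=\sup_{\theta_m\in\Theta_m}\mathbf H_m(\theta_m)$ (for $m\in\mathcal M$, $\bar\theta_m=\theta_{m,0}$). $\pi_m$ is the prior density of Model $m$ on $\Theta_m$. Notation: $|M|=\sqrt{\mathrm{tr}(MM^\top)}$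 for vectors and matrices; $C^k_\uparrow(\mathbb{R}^d)$ is the set of functions on $\mathbb{R}^d$ continuously differentiable up to order $k$ whose derivatives are of polynomial growth. *)

(* Defs.v *)
From HB Require Import structures.
From mathcomp Require Import all_boot all_order all_algebra.
From mathcomp Require Import all_classical all_reals all_analysis.
From mathcomp Require Import measurable_realfun.

Set Implicit Arguments.
Unset Strict Implicit.
Unset Printing Implicit Defensive.

Import Order.TTheory GRing.Theory Num.Theory.
Import numFieldNormedType.Exports.

Local Open Scope classical_set_scope.
Local Open Scope ring_scope.

Definition measure_mx_display : measure_display -> measure_display.
Proof. exact. Qed.

(* Matrices carry the sigma-algebra generated by their entries; on 'cV[R]_n it
   is the Borel sigma-algebra of R^n. *)
Section measurable_matrix.
Context {d} {T : measurableType d}.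
Variables m n : nat.

Definition mx_entry_system : set (set 'M[T]_(m, n)) :=
  [set A | exists i j, exists2 B : set T, measurable B &
           A = [set M : 'M[T]_(m, n) | B (M i j)]].

Let mx0 : <<s mx_entry_system >> set0.
Proof. exact: sigma_algebra0. Qed.

Let mxC A : <<s mx_entry_system >> A -> <<s mx_entry_system >> (~` A).
Proof. exact: sigma_algebraC. Qed.

Let mx_bigcup (F : _^nat) : (forall i, <<s mx_entry_system >> (F i)) ->
  <<s mx_entry_system >> (\bigcup_i F i).
Proof. exact: sigma_algebra_bigcup. Qed.

HB.instance Definition _ := @isMeasurable.Build (measure_mx_display d)
  'M[T]_(m, n) <<s mx_entry_system >> mx0 mxC mx_bigcup.

End measurable_matrix.

Section lebesgue_vec.
Context {R : realType}.

Definition consv n (xv : R * 'cV[R]_n) : 'cV[R]_n.+1 :=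
  col_mx (xv.1%:M : 'M[R]_1) xv.2.

(* n-fold product of the Lebesgue measure of R; lebesgue_vec_box gives its value
   on products of Borel sets. *)
Fixpoint lebesgue_vec n : set 'cV[R]_n -> \bar R :=
  match n with
  | 0%N => dirac (0 : 'cV[R]_0)
  | m.+1 => pushforward (lebesgue_measure \x @lebesgue_vec m)%E (@consv m)
  end.

Lemma measurable_entry m n i j :
  measurable_fun setT (fun M : 'M[R]_(m, n) => M i j).
Proof.
move=> _ B mB; rewrite setTI; apply: sub_sigma_algebra.
by exists i, j; exists B.
Qed.

Lemma measurable_mxP d (T : measurableType d) m n (f : T -> 'M[R]_(m, n)) :
  measurable_fun setT f <->
  forall i j, measurable_fun setT (fun x => f x i j).
Proof.
split=> [mf i j|mf].
  exact: (measurableT_comp (@measurable_entry m n i j) mf).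
apply: (@measurability _ _ _ _ _ _ (@mx_entry_system _ R m n)) => //.
move=> _ [_ [i [j [B mB ->]]] <-].
exact: mf.
Qed.

Lemma consv0 n (xv : R * 'cV[R]_n) : consv xv ord0 ord0 = xv.1.
Proof.
have := col_mxEu (xv.1%:M : 'M[R]_1) xv.2 ord0 ord0; rewrite [X in _ = X]mxE mulr1n => <-.
by rewrite /consv; congr (fun_of_matrix _ _ _); exact: val_inj.
Qed.

Lemma consvS n (xv : R * 'cV[R]_n) i : consv xv (lift ord0 i) ord0 = xv.2 i ord0.
Proof.
rewrite -(col_mxEd (xv.1%:M : 'M[R]_1) xv.2).
by rewrite /consv; congr (fun_of_matrix _ _ _); exact: val_inj.
Qed.

Lemma measurable_consv n : measurable_fun setT (@consv n).
Proof.
apply/measurable_mxP => i j; rewrite (ord1 j).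
case: (unliftP ord0 i) => [k|] ->.
  rewrite (_ : (fun _ => _) = (fun v : 'cV[R]_n => v k ord0) \o snd).
    exact: (measurableT_comp (@measurable_entry _ _ _ _) measurable_snd).
  by apply/funext => xv /=; rewrite consvS.
rewrite (_ : (fun _ => _) = fst); first exact: measurable_fst.
by apply/funext => xv; rewrite consv0.
Qed.

Definition unconsv n (v : 'cV[R]_n.+1) : R * 'cV[R]_n :=
  (v ord0 ord0, dsubmx (v : 'cV[R]_(1 + n))).

Lemma consvK n : cancel (@consv n) (@unconsv n).
Proof. by move=> [x v]; rewrite /unconsv consv0 /consv col_mxKd. Qed.

Lemma measurable_unconsv n : measurable_fun setT (@unconsv n).
Proof.
apply: measurable_fun_pair; first exact: measurable_entry.
apply/measurable_mxP => i j.
rewrite (_ : (fun _ => _) = fun v : 'cV[R]_n.+1 => v (rshift 1 i) j).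
  exact: measurable_entry.
by apply/funext => v; rewrite mxE.
Qed.

Section lebesgue_vecS.
Variables (n : nat) (mu : {sigma_finite_measure set 'cV[R]_n -> \bar R}).
Local Notation nu := (lebesgue_measure \x mu)%E.
Let push := pushforward nu (@consv n).

Let mpre A : measurable A -> measurable (@consv n @^-1` A).
Proof. by move=> mA; rewrite -[X in measurable X]setTI; exact: measurable_consv. Qed.

Let push0 : push set0 = 0%E.
Proof. by rewrite /push /pushforward preimage_set0 measure0. Qed.

Let push_ge0 A : (0 <= push A)%E.
Proof. by rewrite /push /pushforward measure_ge0. Qed.

Let push_sigma_additive : semi_sigma_additive push.
Proof.
move=> F mF tF mUF; rewrite /push /pushforward preimage_bigcup.
apply: measure_semi_sigma_additive.
- by move=> k; exact: mpre.
- apply/trivIsetP => /= i j _ _ ij; rewrite -preimage_setI.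
  by move/trivIsetP : tF => /(_ _ _ _ _ ij) ->//; rewrite preimage_set0.
- by rewrite -preimage_bigcup; exact: mpre.
Qed.

HB.instance Definition _ :=
  isMeasure.Build _ _ _ push push0 push_ge0 push_sigma_additive.

Let push_sigma_finite : sigma_finite setT push.
Proof.
have [F [TF Foo]] : exists F : (set (measurableTypeR R * 'cV[R]_n)%type)^nat,
    setT = \bigcup_k F k /\ forall k, measurable (F k) /\ (nu (F k) < +oo)%E.
  have /sigma_finiteP[F [TF ndF Foo]] := sigma_finiteT (@lebesgue_measure R).
  have /sigma_finiteP[G [TG ndG Goo]] := sigma_finiteT mu.
  exists (fun k => F k `*` G k); split.
    rewrite -setXTT TF TG predeqE => -[x y]; split.
      move=> [/= [i _ Fx] [k _ Gy]]; exists (maxn i k) => //; split.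
      - by move: x Fx; exact/subsetPset/ndF/leq_maxl.
      - by move: y Gy; exact/subsetPset/ndG/leq_maxr.
    by move=> [i _ []/= ? ?]; split; exists i.
  move=> k; have [? ?] := Foo k; have [? ?] := Goo k.
  split; first exact: measurableX.
  by rewrite product_measure1E// lte_mul_pinfty// ge0_fin_numE.
exists (fun k => @unconsv n @^-1` F k).
  by rewrite -preimage_bigcup -TF preimage_setT.
move=> k; have [mF Fk] := Foo k; split.
  by rewrite -[X in measurable X]setTI; exact: measurable_unconsv.
rewrite /push /pushforward (_ : _ @^-1` _ = F k) //.
by apply/seteqP; split => xv /=; rewrite consvK.
Qed.

HB.instance Definition _ :=
  Measure_isSigmaFinite.Build _ _ _ push push_sigma_finite.

Lemma lebesgue_vecS_ex :
  exists nu : {sigma_finite_measure set 'cV[R]_n.+1 -> \bar R},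
    nu = pushforward (lebesgue_measure \x mu)%E (@consv n) :> (set _ -> _).
Proof. by exists push. Qed.

End lebesgue_vecS.

Lemma lebesgue_vec_ex n :
  exists mu : {sigma_finite_measure set 'cV[R]_n -> \bar R},
    mu = @lebesgue_vec n :> (set _ -> _).
Proof.
elim: n => [|n [mu muE]]; first by exists (dirac (0 : 'cV[R]_0)).
by have [nu nuE] := lebesgue_vecS_ex mu; exists nu; rewrite nuE muE.
Qed.

Section lebesgue_vec_measure.
Variable n : nat.

Let leb0 : @lebesgue_vec n set0 = 0%E.
Proof. by have [mu <-] := lebesgue_vec_ex n; exact: measure0. Qed.

Let leb_ge0 A : (0 <= @lebesgue_vec n A)%E.
Proof. by have [mu <-] := lebesgue_vec_ex n; exact: measure_ge0. Qed.

Let leb_sigma_additive : semi_sigma_additive (@lebesgue_vec n).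
Proof.
by have [mu <-] := lebesgue_vec_ex n; exact: measure_semi_sigma_additive.
Qed.

HB.instance Definition _ :=
  isMeasure.Build _ _ _ (@lebesgue_vec n) leb0 leb_ge0 leb_sigma_additive.

Let leb_sigma_finite : sigma_finite setT (@lebesgue_vec n).
Proof. by have [mu <-] := lebesgue_vec_ex n; exact: sigma_finiteT. Qed.

HB.instance Definition _ :=
  Measure_isSigmaFinite.Build _ _ _ (@lebesgue_vec n) leb_sigma_finite.

End lebesgue_vec_measure.

Lemma lebesgue_vec_box n (A : 'I_n -> set R) :
  (forall i, measurable (A i)) ->
  lebesgue_vec [set v : 'cV[R]_n | forall i, A i (v i ord0)] =
  (\prod_i lebesgue_measure (A i))%E.
Proof.
elim: n A => [|n IHn] A mA.
  by rewrite big_ord0 /= diracE mem_set // => i; case: i.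
rewrite big_ord_recl -IHn; last by move=> i; exact: mA.
have mB : measurable [set v : 'cV[R]_n | forall i, A (lift ord0 i) (v i ord0)].
  rewrite (_ : [set _ | _] =
      \bigcap_(i in setT) [set v : 'cV[R]_n | A (lift ord0 i) (v i ord0)]).
    apply: fin_bigcap_measurable => // i _.
    by rewrite -[X in measurable X]setTI; exact: measurable_entry.
  by apply/seteqP; split => [v Av i _|v Av i]; exact: Av.
rewrite -(product_measure1E lebesgue_measure _ (mA ord0) mB) /= /pushforward.
rewrite (_ : _ @^-1` _ = A ord0 `*`
    [set v : 'cV[R]_n | forall i, A (lift ord0 i) (v i ord0)]) //.
apply/seteqP; split => -[x v] /=.
  move=> Axv; split => [|i].
    by have := Axv ord0; rewrite consv0.
  by have := Axv (lift ord0 i); rewrite consvS.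
by move=> [Ax Av] i; case: (unliftP ord0 i) => [j|] ->; rewrite ?consvS ?consv0.
Qed.

End lebesgue_vec.

Section euclidean.
Context {R : realType}.

(* The library norm on matrices is the sup norm; this is the Frobenius one. *)
Definition frob m n (A : 'M[R]_(m, n)) : R := Num.sqrt (\tr (A *m A^T)).

Definition posdefmx n (A : 'M[R]_n) : Prop :=
  A^T = A /\
  forall x : 'cV[R]_n, x != 0 -> 0 < (x^T *m A *m x) ord0 ord0.

Definition nonzero {n} : set 'cV[R]_n := [set z | z != 0].

Definition poly_growth n (D : set 'cV[R]_n) (g : 'cV[R]_n -> R) : Prop :=
  exists (C : R) (k : nat), forall x, D x -> `|g x| <= C * (1 + frob x) ^+ k.

Definition partial n (i : 'I_n) (f : 'cV[R]_n -> R) (x : 'cV[R]_n) : R :=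
  'D_(delta_mx i ord0) f x.

Definition iter_partial n (s : seq 'I_n) (f : 'cV[R]_n -> R) : 'cV[R]_n -> R :=
  foldr (@partial n) f s.

(* C^k on an open set U *)
Definition Ck_on n (k : nat) (U : set 'cV[R]_n) (f : 'cV[R]_n -> R) : Prop :=
  (forall (s : seq 'I_n) i x, (size s < k)%N -> U x ->
     derivable (iter_partial s f) x (delta_mx i ord0)) /\
  (forall (s : seq 'I_n) x, (size s <= k)%N -> U x ->
     {for x, continuous (iter_partial s f)}).

(* C^k on the open set U, the derivatives of order <= k having continuous
   extensions to the closure; f itself is its own extension. *)
Definition Ck_closure n (k : nat) (U : set 'cV[R]_n) (f : 'cV[R]_n -> R) : Prop :=
  [/\ Ck_on k U f,
      {within closure U, continuous f} &
      forall s : seq 'I_n, (size s <= k)%N ->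
        exists g : 'cV[R]_n -> R, {within closure U, continuous g} /\
          (forall x, U x -> g x = iter_partial s f x)].

Definition Ck_poly n (k : nat) (f : 'cV[R]_n -> R) : Prop :=
  Ck_on k setT f /\
  forall s : seq 'I_n, (size s <= k)%N -> poly_growth setT (iter_partial s f).

Definition cadlag n (f : R -> 'cV[R]_n) : Prop :=
  (forall t, 0 <= t -> f s @[s --> t^'+] --> f t) /\
  (forall t, 0 < t -> cvg (f s @[s --> t^'-])).

Definition left_limit n (f : R -> 'cV[R]_n) (t : R) : 'cV[R]_n :=
  lim (f s @[s --> t^'-]).

End euclidean.

Section stochastic.
Context {R : realType} {d : measure_display} {Omega : measurableType d}.
Variable P : probability Omega R.

(* Mutual independence of a finite family of sigma-algebras. *)
Definition independent_sigma (I : finType) (G : I -> set (set Omega)) : Prop :=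
  forall (J : {set I}) (A : I -> set Omega), (forall i, i \in J -> G i (A i)) ->
    P (\bigcap_(i in [set` J]) A i) = (\prod_(i in J) P (A i))%E.

Definition sigma_of d' (T : measurableType d') (X : Omega -> T) :
  set (set Omega) := preimage_set_system setT X measurable.

(* Time is [0, +oo[: only indices t >= 0 are meaningful. *)
Definition filtration (Ft : R -> set (set Omega)) : Prop :=
  (forall t, 0 <= t -> sigma_algebra setT (Ft t) /\ Ft t `<=` measurable) /\
  (forall s t, 0 <= s -> s <= t -> Ft s `<=` Ft t).

Definition adapted d' (T : measurableType d') (Ft : R -> set (set Omega))
    (Y : R -> Omega -> T) : Prop :=
  forall t, 0 <= t -> sigma_of (Y t) `<=` Ft t.

Definition wiener (Ft : R -> set (set Omega)) r
    (W : R -> Omega -> 'cV[R]_r) : Prop :=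
  [/\ adapted Ft W,
      {ae P, forall w, W 0 w = 0},
      {ae P, forall w, {within [set t | 0 <= t], continuous (W ^~ w)}},
      forall s t, 0 <= s -> s < t ->
        forall B : 'I_r -> set R, (forall j, measurable (B j)) ->
          P [set w | forall j, B j ((W t w - W s w) j ord0)] =
          (\prod_j normal_prob 0 (Num.sqrt (t - s)) (B j))%E &
      forall s t, 0 <= s -> s < t ->
        forall A B, Ft s A -> sigma_of (fun w => W t w - W s w) B ->
          P (A `&` B) = (P A * P B)%E].

Definition jump_domain {n} : set (measurableTypeR R * 'cV[R]_n)%type :=
  [set s : R | 0 <= s] `*` nonzero.

(* f(z) dz dt on R_+ x (R^n \ {0}) *)
Definition jump_intensity n (f : 'cV[R]_n -> R)
    (A : set (measurableTypeR R * 'cV[R]_n)%type) : \bar R :=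
  (\int[lebesgue_measure \x @lebesgue_vec R n]_(sz in A `&` jump_domain)
     (f sz.2)%:E)%E.

(* The law of mu(A) is written with the explicit Poisson weights: the library's
   poisson_pmf is not a probability mass function when the rate is 0. *)
Definition poisson_random_measure (Ft : R -> set (set Omega)) n
    (f : 'cV[R]_n -> R)
    (mu : Omega -> {measure set (measurableTypeR R * 'cV[R]_n)%type -> \bar R})
    : Prop :=
  [/\ forall w, mu w (~` jump_domain) = 0%E,
      forall w A, measurable A ->
        (exists k : nat, mu w A = k%:R%:E) \/ mu w A = +oo%E,
      forall A, measurable A ->
        measurable_fun setT (fun w => mu w A) /\
        (forall t, 0 <= t -> A `<=` `[0, t] `*` nonzero ->
           sigma_of (fun w => mu w A) `<=` Ft t),
      forall A, measurable A ->
        ((jump_intensity f A < +oo)%E -> forall k : nat,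
           let rate := fine (jump_intensity f A) in
           P [set w | mu w A = k%:R%:E] =
           (rate ^+ k / k`!%:R * expR (- rate))%:E) /\
        (jump_intensity f A = +oo%E -> P [set w | mu w A = +oo%E] = 1%E) &
      forall k (A : 'I_k -> set (measurableTypeR R * 'cV[R]_n)%type),
        (forall i, measurable (A i)) -> trivIset setT A ->
        independent_sigma (fun i => sigma_of (fun w => mu w (A i)))].

(* The sigma-algebras whose independence is required at time t: the past
   (None), the future increments of W_i (Some (false, i)) and the restriction
   of mu_i to times after t (Some (true, i)). *)
Definition innovation_sigma (l : nat) (dz r : 'I_l -> nat)
    (Ft : R -> set (set Omega))
    (W : forall i, R -> Omega -> 'cV[R]_(r i))
    (mu : forall i, Omega ->
       {measure set (measurableTypeR R * 'cV[R]_(dz i))%type -> \bar R})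
    (t : R) (o : option (bool * 'I_l)) : set (set Omega) :=
  match o with
  | None => Ft t
  | Some (false, i) =>
      <<s \bigcup_(u in [set u | t <= u])
            sigma_of (fun w => W i u w - W i t w) >>
  | Some (true, i) =>
      <<s \bigcup_(A in measurable)
            sigma_of (fun w => mu i w (A `&` (`]t, +oo[ `*` nonzero))) >>
  end.

(* Y_t = x0 + int_0^t a(Y_{s-}) ds + S W_t
           + int_{]0,t] x (R^n \ {0})} c(Y_{s-}, z) mu(ds, dz);
   the diffusion matrix is constant and mu is locally finite, so that all
   terms are pathwise. *)
Definition jump_sde n r (a : 'cV[R]_n -> 'cV[R]_n) (S : 'M[R]_(n, r))
    (c : 'cV[R]_n -> 'cV[R]_n -> 'cV[R]_n) (x0 : 'cV[R]_n)
    (W : R -> Omega -> 'cV[R]_r)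
    (mu : Omega -> {measure set (measurableTypeR R * 'cV[R]_n)%type -> \bar R})
    (Y : R -> Omega -> 'cV[R]_n) : Prop :=
  {ae P, forall w, Y 0 w = x0 /\ forall t, 0 <= t -> forall j,
    let drift s := a (left_limit (Y ^~ w) s) j ord0 in
    let jump (sz : measurableTypeR R * 'cV[R]_n) :=
      c (left_limit (Y ^~ w) sz.1) sz.2 j ord0 in
    [/\ lebesgue_measure.-integrable `]0, t] (EFin \o drift),
        (mu w).-integrable (`]0, t] `*` nonzero) (EFin \o jump) &
        Y t w j ord0 = x0 j ord0
          + \int[lebesgue_measure]_(s in `]0, t]) drift s
          + (S *m W t w) j ord0
          + \int[mu w]_(sz in `]0, t] `*` nonzero) jump sz]}.

End stochastic.

(* Latent processes are numbered xi, delta, epsilon, zeta. *)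
Definition i_xi : 'I_4 := @Ordinal 4 0 isT.
Definition i_delta : 'I_4 := @Ordinal 4 1 isT.
Definition i_eps : 'I_4 := @Ordinal 4 2 isT.
Definition i_zeta : 'I_4 := @Ordinal 4 3 isT.

Definition latent_dim (p1 p2 k1 k2 : nat) (i : 'I_4) : nat :=
  nth 0%N [:: k1; p1; p2; k2] i.

Record sem (R : realType) (p1 p2 k1 k2 : nat) (r : 'I_4 -> nat) := Sem {
  load1 : 'M[R]_(p1, k1);
  load2 : 'M[R]_(p2, k2);
  gam : 'M[R]_(k2, k1);
  beta : 'M[R]_k2;
  vol : forall i, 'M[R]_(latent_dim p1 p2 k1 k2 i, r i)
}.

Section sem_theory.
Context {R : realType} {p1 p2 k1 k2 : nat} {r : 'I_4 -> nat}.
Implicit Type M : sem R p1 p2 k1 k2 r.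

Definition psi M : 'M[R]_k2 := 1%:M - beta M.

Definition cov M i : 'M[R]_(latent_dim p1 p2 k1 k2 i) := vol M i *m (vol M i)^T.

Definition sem_wf M : Prop :=
  [/\ \rank (load1 M) = k1, \rank (load2 M) = k2,
      forall j, beta M j j = 0 & psi M \in unitmx].

Definition sem_cov M : 'M[R]_(p1 + p2) :=
  let Sxx : 'M[R]_k1 := cov M i_xi in
  let Sdd : 'M[R]_p1 := cov M i_delta in
  let See : 'M[R]_p2 := cov M i_eps in
  let Szz : 'M[R]_k2 := cov M i_zeta in
  let L1 := load1 M in let L2 := load2 M in let G := gam M in
  let Pi := invmx (psi M) in
  let S11 := L1 *m Sxx *m L1^T + Sdd in
  let S12 := L1 *m Sxx *m G^T *m Pi^T *m L2^T in
  let S22 := L2 *m Pi *m (G *m Sxx *m G^T + Szz) *m Pi^T *m L2^T + See in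
  block_mx S11 S12 S12^T S22.

Definition observed M (xi : 'cV[R]_k1) (delta : 'cV[R]_p1) (eps : 'cV[R]_p2)
    (eta : 'cV[R]_k2) : 'cV[R]_(p1 + p2) :=
  col_mx (load1 M *m xi + delta) (load2 M *m eta + eps).

End sem_theory.

Section quasi_likelihood.
Context {R : realType} {p : nat}.
Implicit Types (X : R -> 'cV[R]_p) (S : 'M[R]_p).

(* the (i+1)-st increment of X over the grid of mesh h *)
Definition incr X (h : R) (i : nat) : 'cV[R]_p :=
  X (i.+1%:R * h) - X (i%:R * h).

Definition quasi_loglik (D rho h : R) (n : nat) X S : R :=
  let keep i := frob (incr X h i) <= D * h `^ rho in
  - (2 * h)^-1 * (\sum_(i < n)
      ((incr X h i)^T *m invmx S *m incr X h i) ord0 ord0 * (keep i)%:R)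
  - 2^-1 * (\sum_(i < n) ln (\det S) * (keep i)%:R).

Definition limit_loglik (S0 S : 'M[R]_p) : R :=
  - 2^-1 * \tr (invmx S *m S0) - 2^-1 * ln (\det S).

Definition QBIC (q n : nat) (loglik : R) : R := - 2 * loglik + q%:R * ln n%:R.

End quasi_likelihood.

Definition correctly_specified (R : realType) (p M : nat) (q : 'I_M -> nat)
    (Theta : forall m, set 'cV[R]_(q m))
    (Sigma : forall m, 'cV[R]_(q m) -> 'M[R]_p) (Sigma0 : 'M[R]_p)
    (m : 'I_M) : Prop :=
  exists2 theta, Theta m theta & Sigma0 = Sigma m theta.

(* an element of argmin_{m correctly specified} q_m *)
Definition optimal_model (R : realType) (p M : nat) (q : 'I_M -> nat)
    (Theta : forall m, set 'cV[R]_(q m))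
    (Sigma : forall m, 'cV[R]_(q m) -> 'M[R]_p) (Sigma0 : 'M[R]_p)
    (m : 'I_M) : Prop :=
  correctly_specified Theta Sigma Sigma0 m /\
  forall m', correctly_specified Theta Sigma Sigma0 m' -> (q m <= q m')%N.

(* Main.v *)
Require Import Defs.
From HB Require Import structures.
From mathcomp Require Import all_boot all_order all_algebra.
From mathcomp Require Import all_classical all_reals all_analysis.
From mathcomp Require Import measurable_realfun.
From mathcomp Require Import ring lra.

(* Write X = sum_k C_k Y_k for the reduced form of the observation. The jump
   measures have finite intensity, so almost every path has finitely many jumps
   on [0, T] and the cells containing one contribute O(h^(2 rho)) to the truncated
   realised covariance. On the other cells the drift is dominated by increments
   of a continuous nondecreasing function, whose squares sum to o(1), and the
   Gaussian part is controlled by orthogonality of its increments and a fourth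
   moment bound on what the truncation removes. Hence the realised covariance V
   tends to Sigma_0 and the proportion c of kept increments tends to 1, in
   probability, while H_n(S) = - n/2 (tr (S^-1 V) + c ln det S). By the Gaussian
   Kullback inequality the normalised quasi-likelihood of a misspecified model
   stays below that of the true covariance by a fixed gap, uniformly over all
   positive definite S, and n times this gap beats the penalty q ln n. *)

Set Implicit Arguments.
Unset Strict Implicit.
Unset Printing Implicit Defensive.
Import Order.TTheory GRing.Theory Num.Theory.
Import numFieldNormedType.Exports.
Local Open Scope classical_set_scope.
Local Open Scope ring_scope.

(** * Gaussian loss *)

Section matrices.
Context {R : realType}.

(** The maximisation is treated deterministically: on an event that involves only the realised
    covariance and the proportion of kept increments, the criteria compare as claimed for all large
    [n]. The squared threshold is [D^2 h^(2 rho)], and each side of [0 < rho < 1/2] has its task. As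
    [rho > 0], it tends to 0: a kept increment is small even if its cell contains a jump, so
    finitely many such cells are harmless. As [rho < 1/2], [h] is negligible against it, so Gaussian
    increments, of size [sqrt h], rarely exceed it: [n] fourth moments of order [h^2], divided by
    the squared threshold, add up to order [h^(1 - 2 rho)]. The obstacle is to combine bounds that
    depend on the path (number of jumps, modulus of the drift) with moment bounds; both are turned
    into events of probability tending to 1. Products of drift and noise are split by Young's
    inequality with a weight fixed before [n], because the sum of the squared noises is bounded
    without being small. *)

Lemma posdefmx_schur n (a : R) (v : 'cV[R]_n) (B : 'M[R]_n) :
  posdefmx (block_mx (a%:M : 'M[R]_1) v^T v B) ->
  0 < a /\ posdefmx (B - a^-1 *: (v *m v^T)).
Proof.
move=> [sA pA].
have a0 : 0 < a.
  have /pA : col_mx (1%:M : 'M[R]_1) (0 : 'cV[R]_n) != 0.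
    rewrite col_mx_eq0 negb_and.
    by apply/orP; left; apply/eqP => /matrixP /(_ 0 0)/eqP; rewrite !mxE oner_eq0.
  rewrite tr_col_mx mul_row_block mul_row_col trmx0 !mul0mx !mulmx0 !addr0.
  by rewrite trmx1 mul1mx mulmx1 mxE eqxx mulr1n.
split=> //; split.
  have sB : B^T = B.
    by have := sA; rewrite tr_block_mx => /eq_block_mx[_ _ _].
  by rewrite linearB/= linearZ/= trmx_mul trmxK sB.
move=> y y0.
have [s vy] : exists s, v^T *m y = s%:M by exists ((v^T *m y) 0 0); exact: mx11_scalar.
have yv : y^T *m v = s%:M.
  by rewrite -[LHS]trmxK trmx_mul trmxK vy tr_scalar_mx.
(* The first coordinate that minimises the quadratic form of the block matrix over [(t, y)]; the
   minimum is the form of the Schur complement at [y]. *)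
pose t := - (a^-1 * s).
have /pA : col_mx (t%:M : 'M[R]_1) y != 0.
  by rewrite col_mx_eq0 negb_and y0 orbT.
rewrite tr_col_mx mul_row_block mul_row_col tr_scalar_mx.
rewrite !mulmxDl -!mulmxA vy !mulmxA yv -!scalar_mxM.
have E (u : R) : (u%:M : 'M[R]_1) 0 0 = u by rewrite mxE eqxx mulr1n.
have D00 (u v' : 'M[R]_1) : (u + v') 0 0 = u 0 0 + v' 0 0 by rewrite mxE.
rewrite !D00 !E => h.
rewrite mulmxBr mulmxBl -scalemxAr -scalemxAl !mulmxA yv -!mulmxA vy -!scalar_mxM.
rewrite scale_scalar_mx D00 [X in _ + X]mxE E.
rewrite mulmxA; move: h; set z := (y^T *m B *m y) 0 0 => h.
have -> : z - a^-1 * (s * s) = t * a * t + s * t + (t * s + z).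
  by rewrite /t; field; rewrite gt_eqF.
exact: h.
Qed.

(** Recursion on the Schur complement of the first entry: the first column of the factor is [sqrt a]
    above [v / sqrt a]. The positive diagonal turns determinants into products, and their logarithms
    into sums. *)
Lemma cholesky n (A : 'M[R]_n) : posdefmx A ->
  exists L : 'M[R]_n, [/\ A = L *m L^T, is_trig_mx L & forall i, 0 < L i i].
Proof.
elim: n A => [|n IH] A pA.
  exists 0; split; first by apply/matrixP => -[].
    by apply/is_trig_mxP => -[].
  by case.
have [sA _] := pA.
pose A' : 'M[R]_(1 + n) := A.
have EA : A' = block_mx ((A' 0 0)%:M) (dlsubmx A')^T (dlsubmx A') (drsubmx A').
  rewrite -{1}(submxK A'); congr block_mx.
    by rewrite [LHS]mx11_scalar !mxE !lshift0.
  apply/matrixP=> i j; rewrite !mxE.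
  by have /matrixP/(_ (lshift n i) (rshift 1 j)) := sA; rewrite mxE.
have : posdefmx A' by [].
rewrite EA => /posdefmx_schur[a0 /IH[L [EL tL L0]]].
set a := A' 0 0 in EA a0 EL *; set v := dlsubmx A' in EA EL *.
pose Lb : 'M[R]_(1 + n) := block_mx ((Num.sqrt a)%:M : 'M[R]_1) 0 ((Num.sqrt a)^-1 *: v) L.
have sa : Num.sqrt a * Num.sqrt a = a by rewrite -expr2 sqr_sqrtr// ltW.
have sa0 : Num.sqrt a != 0 by rewrite gt_eqF// sqrtr_gt0.
have EL' : A' = Lb *m Lb^T.
  rewrite /Lb tr_block_mx mulmx_block EA trmx0 !(mulmx0, mul0mx, addr0).
  rewrite tr_scalar_mx linearZ/= mul_scalar_mx scale_scalar_mx sa.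
  rewrite mul_scalar_mx scalerA divff// scale1r.
  rewrite -scalemxAl mul_mx_scalar scalerA mulVf// scale1r.
  congr block_mx.
  by rewrite -scalemxAl -scalemxAr scalerA -invfM sa -EL addrCA subrr addr0.
exists Lb; split; first exact: EL'.
- by rewrite (@is_trig_block_mx _ 1 n 1 n)// scalar_mx_is_trig tL eqxx.
- move=> i; have := splitP (i : 'I_(1 + n)) => -[j ij|k ik].
    have -> : i = lshift n j by exact: val_inj.
    by rewrite (@block_mxEul _ 1 n 1 n) mxE eqxx mulr1n sqrtr_gt0.
  have -> : i = rshift 1 k by exact: val_inj.
  by rewrite (@block_mxEdr _ 1 n 1 n).
Qed.

Lemma cholesky_det n (A L : 'M[R]_n) : A = L *m L^T -> is_trig_mx L ->
  \det A = \prod_i (L i i) ^+ 2.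
Proof.
move=> -> tL; rewrite det_mulmx det_tr (det_trig tL) -big_split/=.
by apply: eq_bigr => i _; rewrite expr2.
Qed.

Lemma posdefmx_det n (A : 'M[R]_n) : posdefmx A -> 0 < \det A.
Proof.
move=> /cholesky[L [/cholesky_det h /h -> L0]].
by apply: prodr_gt0 => i _; rewrite exprn_gt0.
Qed.

Lemma mxtrace_mulT m n (K : 'M[R]_(m, n)) :
  \tr (K *m K^T) = \sum_i \sum_j K i j ^+ 2.
Proof.
apply: eq_bigr => i _; rewrite mxE; apply: eq_bigr => j _.
by rewrite mxE expr2.
Qed.

Lemma ln_lt_sub1 (x : R) : 0 < x -> x != 1 -> ln x < x - 1.
Proof.
move=> x0 x1; have := @expR_gt1Dx R (ln x).
by rewrite ln_eq0// x1 lnK// => /(_ isT); lra.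
Qed.

Lemma ln_prod (I : finType) (F : I -> R) : (forall i, 0 < F i) ->
  ln (\prod_i F i) = \sum_i ln (F i).
Proof.
(* Positivity travels with the identity, since the logarithm of a product splits only over positive
   factors. *)
move=> F0; pose Q (x y : R) := 0 < x /\ ln x = y.
suff h : Q (\prod_i F i) (\sum_i ln (F i)) by case: h.
apply: (big_rec2 Q); first by split; rewrite ?ln1.
by move=> i y x _ [y0 <-]; split; rewrite ?mulr_gt0// lnM ?posrE.
Qed.

(** The Gaussian Kullback inequality with its equality case. For the Cholesky factor [L] the trace
    is the sum of all squared entries, so the excess over [n] is a sum of [x - 1 - ln x] over the
    squared diagonal entries plus the off-diagonal squares; it vanishes only for [L = 1]. *)
Lemma mxtrace_ln_det n (B : 'M[R]_n) : posdefmx B ->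
  n%:R <= \tr B - ln (\det B) /\ (\tr B - ln (\det B) = n%:R -> B = 1%:M).
Proof.
move=> /cholesky[L [EB tL L0]].
have L20 i : 0 < L i i ^+ 2 by rewrite exprn_gt0.
have e1 : \tr B - ln (\det B) - n%:R =
    \sum_i ((L i i ^+ 2 - 1 - ln (L i i ^+ 2)) + \sum_(j | j != i) L i j ^+ 2).
  rewrite (cholesky_det EB tL) ln_prod// EB mxtrace_mulT.
  have -> : n%:R = \sum_(i < n) (1 : R) by rewrite sumr_const card_ord.
  rewrite -!sumrB; apply: eq_bigr => i _; rewrite (bigD1 i)//=; ring.
have ge1 i : 0 <= L i i ^+ 2 - 1 - ln (L i i ^+ 2).
  have [->|/(ln_lt_sub1 (L20 i))] := eqVneq (L i i ^+ 2) 1; last by lra.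
  by rewrite ln1; lra.
have ge2 i : 0 <= \sum_(j | j != i) L i j ^+ 2.
  by apply: sumr_ge0 => j _; exact: sqr_ge0.
split; first by rewrite -subr_ge0 e1; apply: sumr_ge0 => i _; rewrite addr_ge0.
move=> /eqP; rewrite -subr_eq0 e1 psumr_eq0; last by move=> i _; rewrite addr_ge0.
move=> /allP h; rewrite EB; suff -> : L = 1%:M by rewrite trmx1 mulmx1.
apply/matrixP => i j; rewrite mxE.
have := h i (mem_index_enum _); rewrite paddr_eq0// => /andP[/eqP h1 /eqP h2].
have [<-|ij] := eqVneq i j.
  have [Li|/(ln_lt_sub1 (L20 i))] := eqVneq (L i i ^+ 2) 1; last by lra.
  by have := L0 i; rewrite mulr1n; nra.
apply/eqP; rewrite mulr0n -sqrf_eq0; move/eqP: h2; rewrite psumr_eq0.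
  by move=> /allP /(_ j (mem_index_enum _)); rewrite eq_sym ij.
by move=> k _; exact: sqr_ge0.
Qed.

(** The previous inequality at [B / 2], where [ln 2 <= 1] pays for the rescaling. Half of the trace
    is left in [tr B - ln det B], which therefore controls the trace. *)
Lemma mxtrace_half_ln_det n (B : 'M[R]_n) : posdefmx B ->
  ln (\det B) <= 2^-1 * \tr B.
Proof.
move=> pB; have p2 : posdefmx (2^-1 *: B).
  split; first by rewrite linearZ/= (proj1 pB).
  move=> x x0; rewrite -scalemxAr -scalemxAl mxE mulr_gt0 ?invr_gt0//.
  exact: (proj2 pB).
have i20 : 0 < (2^-1 : R) ^+ n by rewrite exprn_gt0// invr_gt0.
have [+ _] := mxtrace_ln_det p2.
rewrite mxtraceZ detZ lnM ?posrE//; last exact: posdefmx_det.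
rewrite lnXn ?invr_gt0// lnV ?posrE// mulNrn => h.
have ln2 : ln 2 <= 1 :> R.
  have := @ln_lt_sub1 2 (ltr0Sn _ _).
  by rewrite gt_eqF ?ltr1n// => /(_ isT); lra.
have n0 : 0 <= n%:R :> R by [].
rewrite -[ln 2 *+ n]mulr_natr in h; nra.
Qed.

Lemma posdefmx_sqrt n (S : 'M[R]_n) : posdefmx S ->
  exists2 G, G \in unitmx & S = G *m G^T.
Proof.
move=> /cholesky[G [EG tG G0]]; exists G => //.
by rewrite unitmxE unitfE (det_trig tG) gt_eqF//; exact: prodr_gt0.
Qed.

(* [K = S^(-1/2) G] turns [tr (S^-1 S0)] and [ln det S] into functions of
   [K K^T] alone. *)
Lemma posdefmx_pencil n (S S0 G : 'M[R]_n) : posdefmx S ->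
  G \in unitmx -> S0 = G *m G^T ->
  exists K : 'M[R]_n, [/\ posdefmx (K *m K^T),
    (forall E, \tr (invmx S *m (G *m E *m G^T)) = \tr (K *m E *m K^T)),
    ln (\det S) = ln (\det S0) - ln (\det (K *m K^T)) &
    K *m K^T = 1%:M -> S = S0].
Proof.
move=> pS uG EG.
have [L [EL tL L0]] := cholesky pS.
have uL : L \in unitmx.
  rewrite unitmxE unitfE (det_trig tL) gt_eqF//; exact: prodr_gt0.
have uLT : L^T \in unitmx by rewrite unitmx_tr.
pose K := invmx L *m G.
have uK : K \in unitmx by rewrite unitmx_mul unitmx_inv uL.
have EK : L *m (K *m K^T) *m L^T = S0.
  rewrite /K trmx_mul trmx_inv !mulmxA mulmxV// mul1mx.
  by rewrite -(mulmxA _ (invmx L^T)) mulVmx// mulmx1 EG.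
have pK : posdefmx (K *m K^T).
  split; first by rewrite trmx_mul trmxK.
  move=> x x0; rewrite mulmxA -mulmxA.
  have -> : x^T *m K = (K^T *m x)^T by rewrite trmx_mul trmxK.
  have y0 : K^T *m x != 0.
    have uKT : K^T \in unitmx by rewrite unitmx_tr.
    by apply: contra_neq x0 => h; rewrite -(mulKmx uKT x) h mulmx0.
  have [i yi] : exists i, (K^T *m x) i 0 != 0.
    apply/existsP; apply: contraNT y0; rewrite negb_exists => /forallP h.
    by apply/eqP/matrixP => i j; rewrite (ord1 j) !mxE; have := h i; rewrite negbK mxE => /eqP.
  rewrite mxE (bigD1 i)//= ltr_pwDl//.
    by rewrite mxE -expr2 exprn_even_gt0.
  by apply: sumr_ge0 => j _; rewrite mxE -expr2 sqr_ge0.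
exists K; split => //.
- move=> E; have -> : invmx S = invmx L^T *m invmx L.
    apply: (can_inj (mulKmx (_ : S \in unitmx))); first by rewrite EL unitmx_mul uL.
    by rewrite mulmxV ?EL ?unitmx_mul ?uL// !mulmxA mulmxK// mulmxV.
  by rewrite -mulmxA mxtrace_mulC /K trmx_mul trmx_inv !mulmxA.
- have dE : \det S0 = \det S * \det (K *m K^T).
    by rewrite -EK EL !det_mulmx; ring.
  by rewrite dE lnM ?posrE ?posdefmx_det// addrK.
- by move=> KI; rewrite -EK KI mulmx1 EL.
Qed.

Lemma normrM_le_half_sqr (x y : R) : `|x| * `|y| <= 2^-1 * (x ^+ 2 + y ^+ 2).
Proof.
have := sqr_ge0 (`|x| - `|y|).
rewrite -(real_normK (num_real x)) -(real_normK (num_real y)); lra.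
Qed.

(** Termwise [2 |x y| <= x^2 + y^2]; summing over the free index produces the factor [n]. A
    covariance error thus costs at most a small multiple of the trace term of the loss. *)
Lemma normr_quad_le n (E K : 'M[R]_n) (e : R) : (forall i j, `|E i j| <= e) ->
  `|\tr (K *m E *m K^T)| <= n%:R * e * \tr (K *m K^T).
Proof.
move=> Ee; rewrite mxtrace_mulT mulr_sumr.
apply: (le_trans (ler_norm_sum _ _ _)); apply: ler_sum => i _.
have e0 (j : 'I_n) : 0 <= e by exact: le_trans (Ee j j).
have -> : (K *m E *m K^T) i i = \sum_j \sum_k K i k * E k j * K i j.
  by rewrite mxE; apply: eq_bigr => j _; rewrite !mxE mulr_suml.
apply: (@le_trans _ _ (\sum_j \sum_k e * (2^-1 * (K i k ^+ 2 + K i j ^+ 2)))).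
  apply: (le_trans (ler_norm_sum _ _ _)); apply: ler_sum => j _.
  apply: (le_trans (ler_norm_sum _ _ _)); apply: ler_sum => k _.
  rewrite !normrM mulrAC mulrC ler_pM// ?mulr_ge0//.
  exact: normrM_le_half_sqr.
set s := \sum_j K i j ^+ 2.
have E1 (j : 'I_n) : \sum_k e * (2^-1 * (K i k ^+ 2 + K i j ^+ 2)) =
    e * 2^-1 * s + e * 2^-1 * n%:R * K i j ^+ 2.
  rewrite -mulr_sumr -mulr_sumr big_split/= sumr_const card_ord -[_ *+ n]mulr_natl -/s.
  ring.
under eq_bigr do rewrite E1.
rewrite big_split/= sumr_const card_ord -mulr_sumr -/s -[_ *+ n]mulr_natl.
by rewrite le_eqVlt; apply/orP; left; apply/eqP; field.
Qed.
End matrices.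

(** * Separation and selection by the Gaussian loss *)

Section loss.
Context {R : realType}.

(** This is [- 2 / n] times the quasi-log-likelihood. At [V = S0], [c = 1] it is twice the Kullback
    divergence between the centred Gaussian laws of covariances [S0] and [S], up to a term depending
    on [S0] only. *)
Definition gauss_loss p (S V : 'M[R]_p) (c : R) : R :=
  \tr (invmx S *m V) + c * ln (\det S).

Section fixed_truth.
Variables (p : nat) (S0 : 'M[R]_p).
Hypothesis pS0 : posdefmx S0.

Let uS0 : S0 \in unitmx.
Proof. by rewrite unitmxE unitfE gt_eqF// posdefmx_det. Qed.

Lemma gauss_loss_truth : gauss_loss S0 S0 1 = p%:R + ln (\det S0).
Proof. by rewrite /gauss_loss mulVmx// mxtrace1 mul1r. Qed.

(** With [B = K K^T] from the pencil, the loss is [tr B - ln det B + ln det S0], and the Kullback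
    inequality applies to [B]. *)
Lemma gauss_loss_min S : posdefmx S ->
  gauss_loss S0 S0 1 <= gauss_loss S S0 1 /\
  (gauss_loss S S0 1 = gauss_loss S0 S0 1 -> S = S0).
Proof.
move=> pS; have [G uG EG] := posdefmx_sqrt pS0.
have [K [pB trE detE SE]] := posdefmx_pencil pS uG EG.
have := trE 1%:M; rewrite !mulmx1 -EG => trB.
have [h1 h2] := mxtrace_ln_det pB.
rewrite gauss_loss_truth /gauss_loss trB detE mul1r; split; first by lra.
by move=> h; apply: SE; apply: h2; lra.
Qed.

(* [V] and [c] stand for the truncated realised covariance and the proportion
   of kept increments. The bound is uniform over all positive definite [S], which
   replaces compactness of the parameter space. *)
Lemma gauss_loss_lower : exists a b : R, [/\ 0 <= a, 0 <= b &
  forall (e : R) V c S, posdefmx S -> (forall i j, `|(V - S0) i j| <= e) ->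
    0 <= e -> 1 - e <= c <= 1 ->
    gauss_loss S S0 1 - e * (a * `|gauss_loss S S0 1| + b) <= gauss_loss S V c].
Proof.
have [G uG EG] := posdefmx_sqrt pS0.
pose s := \sum_i \sum_k `|invmx G i k|.
pose C := p%:R * s ^+ 2; pose lam := `|ln (\det S0)|.
have s0 : 0 <= s by apply: sumr_ge0 => i _; exact: sumr_ge0.
have si i : \sum_k `|invmx G i k| <= s.
  rewrite /s [leRHS](bigD1 i)//= lerDl; apply: sumr_ge0 => j _; exact: sumr_ge0.
have C0 : 0 <= C by rewrite mulr_ge0// sqr_ge0.
exists (2 * C + 1), (2 * C * lam); split.
- by rewrite addr_ge0// mulr_ge0.
- by rewrite !mulr_ge0 ?normr_ge0.
move=> e V c S pS Ve e0 /andP[c1 c2].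
have [K [pB trE detE _]] := posdefmx_pencil pS uG EG.
(* The error [V - S0] in the coordinates where [S0] is the identity. *)
pose E := invmx G *m (V - S0) *m (invmx G)^T.
have EV : V = S0 + G *m E *m G^T.
  rewrite /E !mulmxA mulmxV// mul1mx -mulmxA -trmx_mul mulmxV// trmx1 mulmx1.
  by rewrite addrC subrK.
have Ee i j : `|E i j| <= e * s ^+ 2.
  have -> : E i j = \sum_l \sum_k invmx G i k * (V - S0) k l * invmx G j l.
    rewrite /E mxE; apply: eq_bigr => l _.
    by rewrite !mxE mulr_suml; apply: eq_bigr => k _; rewrite !mxE.
  apply: (le_trans (ler_norm_sum _ _ _)).
  apply: (@le_trans _ _ (\sum_l \sum_k (`|invmx G i k| * e * `|invmx G j l|))).
    apply: ler_sum => l _; apply: (le_trans (ler_norm_sum _ _ _)).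
    by apply: ler_sum => k _; rewrite !normrM ler_wpM2r// ler_wpM2l.
  under eq_bigr do rewrite -mulr_suml -mulr_suml.
  rewrite -mulr_sumr mulrAC mulrC ler_wpM2l// expr2.
  by apply: ler_pM => //; exact: sumr_ge0.
have := trE 1%:M; rewrite !mulmx1 -EG => trB.
have quad := normr_quad_le K Ee.
have half := mxtrace_half_ln_det pB.
rewrite /gauss_loss [in \tr (_ *m V)]EV mulmxDr mxtraceD trE trB detE mul1r.
move: quad half; set t := \tr (K *m K^T); set x := \tr (K *m E *m K^T).
set ld := ln (\det S0); set lb := ln (\det _) => quad half.
have t0 : 0 <= t.
  rewrite /t mxtrace_mulT; apply: sumr_ge0 => i _; apply: sumr_ge0 => j _.
  exact: sqr_ge0.
have {}quad : - (C * e * t) <= x.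
  move: quad; rewrite ler_norml => /andP[+ _].
  by rewrite /C; apply: le_trans; rewrite le_eqVlt; apply/orP; left; apply/eqP; ring.
pose m := t + (ld - lb).
(* [m] is the loss of [S] at [V = S0], [c = 1]; [half] bounds [lb] by [t / 2], so [m] is at least
   [t / 2 + ld]. *)
have tm : t <= 2 * `|m| + 2 * lam.
  have := ler_norm m; have := ler_norm (- ld); rewrite normrN -/lam /m; lra.
(* Only a positive [ld - lb] matters, and then it is at most [m] because [t >= 0]. *)
have lm : (1 - c) * (ld - lb) <= e * `|m|.
  have [l0|l0] := leP (ld - lb) 0.
    apply: (@le_trans _ _ 0); last by rewrite mulr_ge0.
    by rewrite mulr_ge0_le0// subr_ge0.
  have := ler_norm m; have := normr_ge0 m; rewrite /m => m0 m1.
  apply: ler_pM; [lra|exact: ltW|lra|lra].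
have Cet : C * e * t <= C * e * (2 * `|m| + 2 * lam).
  by rewrite ler_wpM2l// mulr_ge0.
rewrite -/m; have -> : m - e * ((2 * C + 1) * `|m| + 2 * C * lam) =
  m - C * e * (2 * `|m| + 2 * lam) - e * `|m| by ring.
by rewrite /m in lm Cet *; lra.
Qed.

Lemma gauss_loss_upper : exists2 b : R, 0 <= b &
  forall (e : R) V c, (forall i j, `|(V - S0) i j| <= e) ->
    0 <= e -> 1 - e <= c <= 1 ->
    gauss_loss S0 V c <= gauss_loss S0 S0 1 + e * b.
Proof.
pose s := \sum_i \sum_k `|invmx S0 i k|.
have s0 : 0 <= s by apply: sumr_ge0 => i _; exact: sumr_ge0.
exists (s + `|ln (\det S0)|); first by rewrite addr_ge0.
move=> e V c Ve e0 /andP[c1 c2].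
have -> : gauss_loss S0 V c = gauss_loss S0 S0 1 +
    (\tr (invmx S0 *m (V - S0)) - (1 - c) * ln (\det S0)).
  by rewrite /gauss_loss mulmxBr linearB/=; ring.
rewrite lerD2l mulrDr lerD//.
  rewrite /s /mxtrace mulr_sumr; apply: ler_sum => i _.
  rewrite mxE mulr_sumr; apply: ler_sum => k _.
  rewrite mulrC; apply: (le_trans (ler_norm _)).
  by rewrite normrM ler_wpM2r.
rewrite -mulrN; apply: (@le_trans _ _ ((1 - c) * `|ln (\det S0)|)).
  by rewrite ler_wpM2l ?subr_ge0// -normrN ler_norm.
by rewrite ler_wpM2r//; lra.
Qed.

(** The lower bound [x - e (a |x| + b)] is nondecreasing in [x] once [e a <= 1], so among all [S] of
    limiting loss at least [m0] the worst case is [m0]. The last clause bounds the loss below over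
    all positive definite [S], which makes the suprema of the quasi-likelihood finite. *)
Lemma gauss_loss_gap (m0 : R) : gauss_loss S0 S0 1 < m0 ->
  exists e eta B : R, [/\ 0 < e, 0 < eta &
    forall V c, (forall i j, `|(V - S0) i j| <= e) -> 1 - e <= c <= 1 ->
    (forall S, posdefmx S -> m0 <= gauss_loss S S0 1 ->
       gauss_loss S0 V c + eta <= gauss_loss S V c) /\
    (forall S, posdefmx S -> B <= gauss_loss S V c)].
Proof.
move=> m0_gt; have [a [b [a0 b0 low]]] := gauss_loss_lower.
have [b' b'0 up] := gauss_loss_upper.
set ms := gauss_loss S0 S0 1 in m0_gt up *.
(* [g] is half of the gap: [e K <= g] spends it on the errors of the bounds at [m0] and at [S0], and
   the other half is the margin that remains. *)
pose K := a * `|m0| + b + b' + 1; pose g := (m0 - ms) / 2.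
have g0 : 0 < g by rewrite divr_gt0// subr_gt0.
have K0 : 0 < K by rewrite ltr_wpDl// !addr_ge0// mulr_ge0.
pose e := Num.min (a + 1)^-1 (g / K).
have a10 : 0 < a + 1 by rewrite ltr_wpDl.
have e0 : 0 < e by rewrite lt_min invr_gt0 a10 divr_gt0.
have ea : e * a <= 1.
  have : e <= (a + 1)^-1 by rewrite ge_min lexx.
  by rewrite -[X in _ <= X]mul1r ler_pdivlMr//; nra.
have eK : e * K <= g.
  by rewrite -ler_pdivlMr// ge_min lexx orbT.
have mono (x y : R) : x <= y ->
    x - e * (a * `|x| + b) <= y - e * (a * `|y| + b).
  move=> xy; have h : e * a * (`|y| - `|x|) <= y - x.
    apply: (@le_trans _ _ (e * a * (y - x))).
      rewrite ler_wpM2l ?mulr_ge0 ?(ltW e0)//.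
      by rewrite (le_trans (lerB_dist _ _))// ger0_norm// subr_ge0.
    by rewrite -[leRHS]mul1r ler_wpM2r// subr_ge0.
  by have -> : e * (a * `|y| + b) = e * a * (`|y| - `|x|) + e * (a * `|x| + b);
    [ring | lra].
exists e, g, (ms - e * (a * `|ms| + b)); split => // V c Ve ce; split=> S pS.
  move=> mS; have := low e V c S pS Ve (ltW e0) ce.
  have := up e V c Ve (ltW e0) ce; have := mono _ _ mS.
  have : e * (a * `|m0| + b) + e * b' <= e * K.
    by rewrite -mulrDr ler_wpM2l ?(ltW e0)// lerDl.
  rewrite /g in eK *; lra.
have := low e V c S pS Ve (ltW e0) ce.
by apply: le_trans; apply: mono; exact: (gauss_loss_min pS).1.
Qed.

End fixed_truth.

Lemma limit_loglikE p (S0 S : 'M[R]_p) :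
  limit_loglik S0 S = - 2^-1 * gauss_loss S S0 1.
Proof. by rewrite /limit_loglik /gauss_loss; ring. Qed.

(** [ln n = 2 ln (sqrt n) < 2 sqrt n], and [sqrt n] is negligible against [n]. *)
Lemma ln_nat_lt (a eta : R) : 0 < eta ->
  \forall n \near \oo, a * ln n%:R < n%:R * eta.
Proof.
move=> eta0; pose C := 2 * `|a| / eta.
near=> n.
have n0 : 0 < n%:R :> R by rewrite ltr0n; near: n; exact: nbhs_infty_gt.
have Cn : C ^+ 2 < n%:R by near: n; exact: nbhs_infty_gtr.
have sn : Num.sqrt n%:R ^+ 2 = n%:R :> R by rewrite sqr_sqrtr// ltW.
have s0 : 0 < Num.sqrt n%:R :> R by rewrite sqrtr_gt0.
have lnn : ln n%:R = 2 * ln (Num.sqrt n%:R) :> R.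
  by rewrite -{1}sn lnXn// mulr_natl.
have lns := ln_sublinear s0.
have Cs : C < Num.sqrt n%:R.
  have C0 : 0 <= C by rewrite mulr_ge0 ?invr_ge0 ?(ltW eta0)// mulr_ge0.
  by rewrite -sn ltr_pXn2r ?nnegrE ?(ltW s0) in Cn.
have aC : 2 * `|a| < Num.sqrt n%:R * eta by rewrite -ltr_pdivrMr.
have : 0 <= ln n%:R :> R by rewrite ln_ge0// ler1n -(ltr0n R).
rewrite lnn => ln0.
rewrite -[X in _ < X * eta]sn; move: aC lns ln0 s0.
set s := Num.sqrt _; set l := ln s => aC ls l0 s0.
apply: (@le_lt_trans _ _ (`|a| * (2 * s))).
  apply: (@le_trans _ _ (`|a| * (2 * l))); first by rewrite ler_wpM2r// ler_norm.
  by rewrite ler_wpM2l//; lra.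
by have -> : `|a| * (2 * s) = s * (2 * `|a|); [ring | rewrite expr2 -mulrA ltr_pM2l].
Unshelve. all: by end_near. Qed.

Lemma le_closure q (U : set 'cV[R]_q) (f : 'cV[R]_q -> R) (B : R) :
  {within closure U, continuous f} -> (forall x, U x -> f x <= B) ->
  forall x, closure U x -> f x <= B.
Proof.
move=> cf fB x Ux; rewrite leNgt; apply/negP => Bfx.
have /subspace_continuousP/(_ x Ux) h := cf.
have [y [Uy]] := Ux _ (cvgr_gt _ h _ Bfx).
by move=> /(_ (subset_closure Uy)); rewrite ltNge fB.
Qed.

(** The deterministic core of the comparison: random data enter through [V] and [c] alone, and [e]
    is fixed before [n]. The maximal likelihood of the correct model is at least the value at [S0];
    that of the misspecified one stays below this value by [n eta / 2], on [Th] by the gap and on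
    its closure by continuity. *)
Lemma QBIC_select p (S0 : 'M[R]_p) q qs (Th : set 'cV[R]_q) (Ths : set 'cV[R]_qs)
    (Sig : 'cV[R]_q -> 'M[R]_p) (Sigs : 'cV[R]_qs -> 'M[R]_p) thbar :
  posdefmx S0 ->
  (forall th, closure Th th -> posdefmx (Sig th)) ->
  (forall th, closure Ths th -> posdefmx (Sigs th)) ->
  (exists2 th, Ths th & S0 = Sigs th) -> ~ (exists2 th, Th th & S0 = Sig th) ->
  Th thbar -> limit_loglik S0 (Sig thbar) =
    sup [set limit_loglik S0 (Sig th) | th in Th] ->
  exists2 e : R, 0 < e & \forall n \near \oo, forall V c,
    (forall i j, `|(V - S0) i j| <= e) -> 1 - e <= c <= 1 ->
    forall l : 'M[R]_p -> R,
    (forall S, l S = - (n%:R / 2 * gauss_loss S V c)) ->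
    {within closure Th, continuous (l \o Sig)} ->
    forall th ths, closure Th th ->
      l (Sigs ths) = sup [set l (Sigs t) | t in closure Ths] ->
      QBIC qs n (l (Sigs ths)) < QBIC q n (l (Sig th)).
Proof.
move=> pS0 pS pSs [th0 Th0 E0] mis Thbar supE.
(* The least limiting loss within the misspecified model. It is attained, at [thbar], so equality
   with the loss of [S0] would put [S0] into the model. *)
pose m0 := gauss_loss (Sig thbar) S0 1.
have pbar := pS _ (subset_closure Thbar).
have m0_gt : gauss_loss S0 S0 1 < m0.
  have [h1 h2] := gauss_loss_min pS0 pbar.
  rewrite lt_neqAle h1 andbT; apply/eqP => /esym/h2 h.
  by apply: mis; exists thbar.
have m0_min th : Th th -> m0 <= gauss_loss (Sig th) S0 1.
  move=> Hth; suff : limit_loglik S0 (Sig th) <= limit_loglik S0 (Sig thbar).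
    by rewrite !limit_loglikE /m0; lra.
  rewrite supE; apply: ub_le_sup; last by exists th.
  exists (- 2^-1 * gauss_loss S0 S0 1) => _ [t Ht <-].
  rewrite limit_loglikE; have := (gauss_loss_min pS0 (pS _ (subset_closure Ht))).1.
  lra.
have [e [eta [B [e0 eta0 gap]]]] := gauss_loss_gap pS0 m0_gt.
exists e => //; near=> n => V c Ve ce l lE lc th ths Hth supl.
have n0 : 0 < n%:R :> R by rewrite ltr0n; near: n; exact: nbhs_infty_gt.
have qn : qs%:R * ln n%:R < n%:R * eta by near: n; exact: ln_nat_lt.
have [gap1 gap2] := gap V c Ve ce.
have ls : l S0 <= l (Sigs ths).
  rewrite supl E0; apply: ub_le_sup; last by exists th0 => //; exact: subset_closure.
  (* [sup] is 0 on a set without upper bound; the uniform lower bound [B] on the loss excludes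
     this. *)
  exists (- (n%:R / 2 * B)) => _ [t Ht <-].
  by rewrite lE lerN2 ler_wpM2l ?divr_ge0 ?(ltW n0)//; exact/gap2/pSs.
have lm : l (Sig th) <= l S0 - n%:R / 2 * eta.
  apply: (le_closure lc) Hth => t Ht /=.
  rewrite !lE -opprD lerN2 -mulrDr ler_wpM2l ?divr_ge0 ?(ltW n0)//.
  by apply: gap1; [exact/pS/subset_closure | exact: m0_min].
have lnn : 0 <= ln n%:R :> R by rewrite ln_ge0// ler1n -(ltr0n R).
have : 0 <= q%:R * ln n%:R :> R by rewrite mulr_ge0.
rewrite /QBIC; lra.
Unshelve. all: by end_near. Qed.

Definition kept (D rho h : R) p (X : R -> 'cV[R]_p) (i : nat) : bool :=
  frob (incr X h i) <= D * h `^ rho.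

Lemma quasi_loglikE p (X : R -> 'cV[R]_p) (D rho h : R) n (S : 'M[R]_p) :
  0 < h -> (0 < n)%N ->
  quasi_loglik D rho h n X S = - (n%:R / 2 * gauss_loss S
    ((n%:R * h)^-1 *: \sum_(i < n) (kept D rho h X i)%:R *: (incr X h i *m (incr X h i)^T))
    (n%:R^-1 * \sum_(i < n) (kept D rho h X i)%:R)).
Proof.
move=> h0 n0; have nz : n%:R != 0 :> R by rewrite pnatr_eq0 -lt0n.
rewrite /quasi_loglik /gauss_loss -scalemxAr mulmx_sumr mxtraceZ linear_sum/=.
under [X in _ - _ * X]eq_bigr do rewrite mulrC.
rewrite -mulr_suml.
have -> : \sum_(i < n) \tr (invmx S *m ((kept D rho h X i)%:R *:
    (incr X h i *m (incr X h i)^T))) =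
    \sum_(i < n) ((incr X h i)^T *m invmx S *m incr X h i) ord0 ord0 *
    (kept D rho h X i)%:R.
  apply: eq_bigr => i _; rewrite -scalemxAr mxtraceZ mulrC; congr (_ * _).
  by rewrite mulmxA mxtrace_mulC mulmxA trace_mx11.
set a := \sum_(i < n) _; set b := \sum_(i < n) _; field.
by rewrite nz gt_eqF.
Qed.

End loss.

(** * Measurability of the maximal quasi-likelihood *)

Section sup_measurability.
Context {R : realType}.

Lemma rat_dense q (U : set 'cV[R]_q) x : open U -> U x ->
  exists v : 'cV[rat]_q, U (map_mx ratr v).
Proof.
move=> oU Ux; have /nbhs_ballP[e /= e0 eU] := open_nbhs_nbhs (conj oU Ux).
have H i : exists r : rat, `|x i ord0 - ratr r| < e.
  have /rat_in_itvoo[r] : x i ord0 - e < x i ord0 + e by lra.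
  by rewrite in_itv/= => /andP[h1 h2]; exists r; rewrite ltr_norml; lra.
have [r rE] := choice H; exists (\col_i r i); apply: eU.
by split=> // i j; rewrite (ord1 j) !mxE; exact: rE.
Qed.

(** Continuity relative to the closure first moves [x] to a point of [U], and openness of [U] then
    moves that point to a rational one. *)
Lemma gt_dense q (U : set 'cV[R]_q) (g : 'cV[R]_q -> R) (s : R) x :
  open U -> {within closure U, continuous g} -> closure U x -> s < g x ->
  exists v : 'cV[rat]_q, U (map_mx ratr v) /\ s < g (map_mx ratr v).
Proof.
move=> oU cg Ux sx; have /subspace_continuousP/(_ x Ux) h := cg.
have [y [Uy Ay]] := Ux _ (nbhs_interior (cvgr_gt _ h _ sx)).
have [] := @rat_dense _ (U `&` _) y (openI oU (open_interior _)) (conj Uy Ay).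
move=> v [Uv Av]; exists v; split => //.
by apply: (interior_subset Av); exact: subset_closure.
Qed.

(** The supremum reduces to one over countably many rational points of [U]. It is formed in the
    extended reals, where a sequence of measurable functions has a measurable supremum, bounded or
    not. *)
Lemma measurable_sup_closure d (T : measurableType d) q (U : set 'cV[R]_q)
    (f : T -> 'cV[R]_q -> R) : open U -> U !=set0 ->
  (forall th, measurable_fun setT (f ^~ th)) ->
  (forall w, {within closure U, continuous (f w)}) ->
  measurable_fun setT (fun w => sup [set f w th | th in closure U]).
Proof.
move=> oU [th0 Uth0] mf cf.
(* Enumerates the rational vectors; those outside [U] are replaced by [th0], so that every term lies
   in [U]. *)
pose t k : 'cV[R]_q := if @unpickle 'cV[rat]_q k is Some v then
  (if `[< U (map_mx ratr v) >] then map_mx ratr v else th0) else th0.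
have Ut k : U (t k).
  by rewrite /t; case: unpickle => [v|//]; case: asboolP.
have tE v : U (map_mx ratr v) -> exists k, t k = map_mx ratr v.
  by move=> Uv; exists (pickle v); rewrite /t pickleK; case: asboolP.
rewrite (_ : (fun _ => _) = fine \o (fun w => esups (fun k => (f w (t k))%:E) 0%N)).
  apply: measurableT_comp; first exact: fine_measurable.
  by apply: measurable_fun_esups => k; apply/measurable_EFinP; exact: mf.
apply/funext => w /=.
have sE : ereal_sup (EFin @` [set f w th | th in closure U]) =
    esups (fun k => (f w (t k))%:E) 0%N.
  apply/eqP; rewrite eq_le; apply/andP; split.
    apply: ge_ereal_sup => _ [_ [th Uth <-] <-].
    rewrite leNgt; apply/negP => h.
    have h0 : ((f w (t 0%N))%:E <= esups (fun k => (f w (t k))%:E) 0%N)%E.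
      by apply: ereal_sup_ubound; exists 0%N.
    case E : (esups _ _) h h0 => [s||]. 2: { by rewrite ltNge leey. } 2: { by move=> _; rewrite leNgt ltNyr. }
    rewrite lte_fin => h _.
    have [v [Uv sv]] := gt_dense oU (cf w) Uth h.
    have [k tk] := tE v Uv.
    have : ((f w (t k))%:E <= esups (fun k => (f w (t k))%:E) 0%N)%E.
      by apply: ereal_sup_ubound; exists k.
    by rewrite E lee_fin tk leNgt sv.
  apply: ge_ereal_sup => _ [k _ <-]; apply: ereal_sup_ubound.
  by exists (f w (t k)) => //; exists (t k) => //; exact: subset_closure.
rewrite -sE; set A := [set f w th | th in _].
have A0 : A !=set0 by exists (f w th0), th0 => //; exact: subset_closure.
(* Without an upper bound both conventions give 0: [sup] of the set, and [fine +oo]. *)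
have [ubA|nubA] := pselect (has_ubound A); first by rewrite ereal_sup_EFin.
by rewrite hasNub_ereal_sup// sup_out//; apply: contra_not nubA => -[].
Qed.

End sup_measurability.

Section loglik_measurability.
Context {R : realType} d (T : measurableType d).

Lemma measurable_fun_mx_entry m n (F : T -> 'M[R]_(m, n)) i j :
  measurable_fun setT F -> measurable_fun setT (fun w => F w i j).
Proof. by move=> /measurable_mxP. Qed.

Lemma measurable_mulmx m n p (F : T -> 'M[R]_(m, n)) (G : T -> 'M[R]_(n, p)) :
  measurable_fun setT F -> measurable_fun setT G ->
  measurable_fun setT (fun w => F w *m G w).
Proof.
move=> mF mG; apply/measurable_mxP => i j.
under eq_fun do rewrite mxE.
apply: measurable_sum => k; apply: measurable_funM; exact: measurable_fun_mx_entry.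
Qed.

Lemma measurable_addmx m n (F G : T -> 'M[R]_(m, n)) :
  measurable_fun setT F -> measurable_fun setT G ->
  measurable_fun setT (fun w => F w + G w).
Proof.
move=> mF mG; apply/measurable_mxP => i j.
under eq_fun do rewrite mxE.
by apply: measurable_funD; exact: measurable_fun_mx_entry.
Qed.

Lemma measurable_oppmx m n (F : T -> 'M[R]_(m, n)) :
  measurable_fun setT F -> measurable_fun setT (fun w => - F w).
Proof.
move=> mF; apply/measurable_mxP => i j.
under eq_fun do rewrite mxE.
by apply: measurableT_comp => //; exact: measurable_fun_mx_entry.
Qed.

Lemma measurable_trmx m n (F : T -> 'M[R]_(m, n)) :
  measurable_fun setT F -> measurable_fun setT (fun w => (F w)^T).
Proof.
move=> mF; apply/measurable_mxP => i j.
by under eq_fun do rewrite mxE; exact: measurable_fun_mx_entry.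
Qed.

Lemma measurable_frob m n (F : T -> 'M[R]_(m, n)) :
  measurable_fun setT F -> measurable_fun setT (fun w => frob (F w)).
Proof.
have ms : measurable_fun setT (@Num.sqrt R).
  by apply: continuous_measurable_fun; exact: sqrt_continuous.
move=> mF; apply: (measurableT_comp ms).
rewrite /mxtrace; apply: measurable_sum => i; apply: measurable_fun_mx_entry.
by apply: measurable_mulmx => //; exact: measurable_trmx.
Qed.

Variables (p : nat) (X : T -> R -> 'cV[R]_p).
Hypothesis mX : forall t, 0 <= t -> measurable_fun setT (X ^~ t).

Lemma measurable_incr h i : 0 <= h ->
  measurable_fun setT (fun w => incr (X w) h i).
Proof.
move=> h0; apply: measurable_addmx; first by apply: mX; rewrite mulr_ge0.
by apply: measurable_oppmx; apply: mX; rewrite mulr_ge0.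
Qed.

Lemma measurable_kept D rho h i : 0 <= h ->
  measurable_fun setT (fun w => (kept D rho h (X w) i)%:R : R).
Proof.
have mb : measurable_fun setT (fun b : bool => b%:R : R) by [].
move=> h0; apply: (measurableT_comp mb).
by apply: measurable_fun_ler => //; apply: measurable_frob; exact: measurable_incr.
Qed.

Lemma measurable_quasi_loglik D rho h n S : 0 <= h ->
  measurable_fun setT (fun w => quasi_loglik D rho h n (X w) S).
Proof.
move=> h0; rewrite /quasi_loglik.
apply: measurable_funB; apply: measurable_funM => //; apply: measurable_sum => i.
  apply: measurable_funM; last exact: measurable_kept.
  apply: measurable_fun_mx_entry; apply: measurable_mulmx; last exact: measurable_incr.
  apply: measurable_mulmx => //; apply: measurable_trmx; exact: measurable_incr.
by apply: measurable_funM => //; exact: measurable_kept.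
Qed.

End loglik_measurability.

(** * Moments of Wiener increments *)

Section normal_moments.
Context {R : realType}.
Notation leb := (@lebesgue_measure R).

Lemma normal_pdf0E (s x : R) : s != 0 ->
  normal_pdf 0 s x = normal_peak s * expR (- (x ^+ 2 / (2 * s ^+ 2))).
Proof. by move=> s0; rewrite normal_pdfE// /normal_fun subr0 mulNr mulr_natl. Qed.

Lemma is_derive_normal_pdf (s x : R) : s != 0 ->
  is_derive x 1 (normal_pdf 0 s) (- (x / s ^+ 2) * normal_pdf 0 s x).
Proof.
move=> s0; rewrite normal_pdf0E//.
have -> : normal_pdf 0 s = (fun x => normal_peak s * expR (- (x ^+ 2 / (2 * s ^+ 2)))).
  by apply/funext => y; rewrite normal_pdf0E.
apply: is_derive_eq; rewrite /GRing.scale/=.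
by field.
Qed.

(** With [u = x^2 / (4 s^2)], doubling the variance leaves a spare factor [expR (- u)], and
    [u^2 expR (- u) <= 2]. The constant is [16 * 2 * 2]: from [x^4 = 16 s^4 u^2], from this bound,
    and from the ratio of the peaks, which is at most 2. *)
Lemma normal_pdf_expr4_le (s x : R) : 0 < s ->
  x ^+ 4 * normal_pdf 0 s x <= 64 * s ^+ 4 * normal_pdf 0 (Num.sqrt 2 * s) x.
Proof.
move=> s0; have r20 : 0 < Num.sqrt 2 :> R by rewrite sqrtr_gt0.
have r2E : Num.sqrt 2 ^+ 2 = 2 :> R by rewrite sqr_sqrtr.
have t0 : 0 < Num.sqrt 2 * s by rewrite mulr_gt0.
rewrite !normal_pdf0E ?gt_eqF// exprMn r2E.
pose u := x ^+ 2 / (4 * s ^+ 2).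
have u0 : 0 <= u by rewrite divr_ge0 ?sqr_ge0// mulr_ge0 ?sqr_ge0.
have s20 : s ^+ 2 != 0 by rewrite expf_neq0// gt_eqF.
have sn0 : s != 0 by rewrite gt_eqF.
have -> : x ^+ 2 / (2 * s ^+ 2) = u + u by rewrite /u; field.
have -> : x ^+ 2 / (2 * (2 * s ^+ 2)) = u by rewrite /u; field.
have -> : x ^+ 4 = 16 * s ^+ 4 * u ^+ 2 by rewrite /u; field.
have pk : normal_peak s <= 2 * normal_peak (Num.sqrt 2 * s).
  have E : 2 * s ^+ 2 * pi *+ 2 = 2 * (s ^+ 2 * pi *+ 2) by rewrite -mulrA mulrnAr.
  rewrite /normal_peak exprMn r2E E (sqrtrM _ (ler0n _ 2)) invfM mulrA.
  rewrite ler_peMl ?invr_ge0 ?sqrtr_ge0//.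
  by rewrite ler_pdivlMr// mul1r; nra.
rewrite opprD expRD.
set p := normal_peak _ in pk *; set q := normal_peak _ in pk *.
have p0 : 0 <= p by exact: normal_peak_ge0.
have e0 : 0 < expR (- u) by exact: expR_gt0.
have ue : u ^+ 2 * expR (- u) <= 2.
  rewrite expRN ler_pdivrMr ?expR_gt0//.
  have : 1 + u ^+ 2 / 2%:R <= expR u by exact: (expR_ge1Dxn 1 u0).
  lra.
have s40 : 0 <= s ^+ 4 by rewrite exprn_ge0// ltW.
have -> : 16 * s ^+ 4 * u ^+ 2 * (p * (expR (- u) * expR (- u))) =
  16 * s ^+ 4 * expR (- u) * (u ^+ 2 * expR (- u)) * p by ring.
have -> : 64 * s ^+ 4 * (q * expR (- u)) =
  16 * s ^+ 4 * expR (- u) * 2 * (2 * q) by ring.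
have c0 : 0 <= 16 * s ^+ 4 * expR (- u) by rewrite mulr_ge0 ?(ltW e0)// mulr_ge0.
apply: ler_pM => //; last by rewrite ler_wpM2l.
exact: (mulr_ge0 c0 (mulr_ge0 (sqr_ge0 u) (ltW e0))).
Qed.

(** The fundamental theorem on [[-n, n]] and dominated convergence. For the normal density [g], the
    primitives [- s^2 g] of [x g] and [- s^2 x g] of [(x^2 - s^2) g] give the mean and the
    variance. *)
Lemma integral_line_eq0 (f F : R -> R) : continuous f ->
  leb.-integrable setT (EFin \o f) ->
  (forall x : R, is_derive x 1 F (f x)) ->
  (F n%:R - F (- n%:R)) @[n --> \oo] --> (0 : R) ->
  (\int[leb]_x (f x)%:E = 0)%E.
Proof.
move=> cf fi dF F0.
pose fn n := EFin \o (f \_ `[- (n%:R : R), n%:R]).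
have mf : measurable_fun setT f by exact: continuous_measurable_fun.
have cvg_fn : (\int[leb]_x fn n x)%E @[n --> \oo] --> (\int[leb]_x (f x)%:E)%E.
  have [] // := @dominated_convergence _ _ _ leb setT measurableT fn (EFin \o f)
    (abse \o (EFin \o f)).
  - move=> n; apply/measurable_EFinP; apply/measurable_restrict => //.
    exact: measurable_funTS.
  - exact/measurable_EFinP.
  - apply: aeW => x _; apply: cvg_near_cst; near=> n.
    have xn : `|x| <= n%:R by near: n; exact: nbhs_infty_ger.
    by rewrite /fn /= patchE mem_set//= in_itv/= -ler_norml.
  - exact: integrable_abse.
  - apply: aeW => x n _; rewrite /fn/= patchE.
    by case: ifPn => // _; rewrite normr0 lee_fin.
apply/eqP; rewrite eq_sym; apply/eqP.
apply: (cvg_unique _ _ cvg_fn) => //.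
apply: (@cvg_trans _ ((F n%:R - F (- n%:R))%:E @[n --> \oo])); last by apply: cvg_EFin; [exact: nearW|exact: F0].
apply: near_eq_cvg; near=> n.
have n0 : - n%:R < n%:R :> R.
  have : 0 < n%:R :> R by rewrite ltr0n; near: n; exact: nbhs_infty_gt.
  lra.
rewrite /fn; under eq_integral do rewrite -restrict_EFin.
rewrite -integral_mkcond (continuous_FTC2 n0 (F := F))//.
- exact: continuous_subspaceT.
- have cF x : {for x, continuous F}.
    by apply: differentiable_continuous; apply/derivable1_diffP; case: (dF x).
  split; first by move=> x _; case: (dF x).
    exact: (cvg_at_right_filter (cF _)).
  exact: (cvg_at_left_filter (cF _)).
- by move=> x _; rewrite derive1E; have [_] := dF x.
Unshelve. all: by end_near. Qed.

Lemma measurable_normal_pdfE (s : R) : measurable_fun setT (EFin \o normal_pdf 0 s).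
Proof. by apply/measurable_EFinP; exact: measurable_normal_pdf. Qed.

(** Integration against the law passes through its Radon-Nikodym derivative, which equals the
    density almost everywhere because both have the same integral over every measurable set. *)
Lemma ge0_integral_normal_prob (s : R) (f : R -> R) : (forall x, 0 <= f x) ->
  measurable_fun setT f ->
  (\int[normal_prob 0 s]_x (f x)%:E = \int[leb]_x (f x * normal_pdf 0 s x)%:E)%E.
Proof.
move=> f0 mf; have Nl := normal_prob_dominates 0 s.
rewrite -(Radon_Nikodym_SigmaFinite.change_of_variables Nl)//; last exact/measurable_EFinP.
apply: ae_eq_integral => //.
- apply: emeasurable_funM; first exact/measurable_EFinP.
  exact: measurable_int (Radon_Nikodym_SigmaFinite.f_integrable Nl).
- by apply/measurable_EFinP/measurable_funM => //; exact: measurable_normal_pdf.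
under [X in ae_eq _ _ _ X]eq_fun do rewrite EFinM.
apply: ae_eqe_mul2l; apply: integral_ae_eq => //.
- exact: Radon_Nikodym_SigmaFinite.f_integrable.
- exact: measurable_normal_pdfE.
- by move=> E _ mE; rewrite -Radon_Nikodym_SigmaFinite.f_integral.
Qed.

Lemma integral_normal_prob (s : R) (f : R -> R) :
  (normal_prob 0 s).-integrable setT (EFin \o f) ->
  (\int[normal_prob 0 s]_x (f x)%:E = \int[leb]_x (f x * normal_pdf 0 s x)%:E)%E.
Proof.
move=> fi; have mf := measurable_int _ fi; have Nl := normal_prob_dominates 0 s.
rewrite -(Radon_Nikodym_change_of_variables Nl measurableT fi).
apply: ae_eq_integral => //.
- apply: emeasurable_funM => //; apply: measurable_int; exact: Radon_Nikodym_integrable.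
- apply/measurable_EFinP/measurable_funM; first exact/measurable_EFinP.
  exact: measurable_normal_pdf.
under [X in ae_eq _ _ _ X]eq_fun do rewrite EFinM.
apply: ae_eqe_mul2l; apply: integral_ae_eq => //.
- exact: Radon_Nikodym_integrable.
- exact: measurable_normal_pdfE.
- by move=> E _ mE; rewrite -Radon_Nikodym_integral.
Qed.

Section fixed_scale.
Variable s : R.
Hypothesis s0 : 0 < s.
Notation N := (normal_prob 0 s).

Lemma normal_expr4_le : (\int[N]_x (x ^+ 4)%:E <= (64 * s ^+ 4)%:E)%E.
Proof.
have x4 (x : R) : 0 <= x ^+ 4 by rewrite exprn_even_ge0.
rewrite ge0_integral_normal_prob//.
have r20 : 0 < Num.sqrt 2 :> R by rewrite sqrtr_gt0.
apply: (@le_trans _ _ (\int[leb]_x ((64 * s ^+ 4)%:E * (normal_pdf 0 (Num.sqrt 2 * s) x)%:E)))%E.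
  apply: ge0_le_integral => //.
  - by move=> x _; rewrite lee_fin mulr_ge0// normal_pdf_ge0.
  - by apply/measurable_EFinP/measurable_funM => //; exact: measurable_normal_pdf.
  - apply: measurable_funeM; exact: measurable_normal_pdfE.
  - by move=> x _; rewrite -EFinM lee_fin; exact: normal_pdf_expr4_le.
rewrite integralZl//=; last exact: integrable_normal_pdf.
by rewrite integral_normal_pdf mule1.
Qed.

Lemma integrable_normal_expr (k : nat) : (k <= 4)%N ->
  N.-integrable setT (fun x => (x ^+ k)%:E).
Proof.
move=> k4; apply: (@le_integrable _ _ _ N setT measurableT _ (fun x => (1 + x ^+ 4)%:E)).
- by apply/measurable_EFinP; exact: exprn_measurable.
- move=> x _; rewrite lee_fin normrX.
  have [x1|x1] := leP `|x| 1.
    apply: (@le_trans _ _ 1); first exact: exprn_ile1.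
    by rewrite ger0_norm ?lerDl ?addr_ge0// exprn_even_ge0.
  apply: (@le_trans _ _ (`|x| ^+ 4)); first by rewrite ler_eXn2l.
  rewrite -normrX !ger0_norm ?lerDr ?addr_ge0// exprn_even_ge0//.
- have -> : (fun x => (1 + x ^+ 4)%:E) = (cst 1 \+ (fun x : R => (x ^+ 4)%:E))%E by [].
  apply: integrableD => //; first exact: finite_measure_integrable_cst.
  apply/integrableP; split; first by apply/measurable_EFinP; exact: exprn_measurable.
  under eq_integral do rewrite gee0_abs ?lee_fin ?exprn_even_ge0//.
  by rewrite (le_lt_trans normal_expr4_le)// ltry.
Qed.

Lemma leb_integrable_normal_pdf (f : R -> R) : continuous f ->
  N.-integrable setT (EFin \o f) ->
  leb.-integrable setT (fun x => (f x * normal_pdf 0 s x)%:E).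
Proof.
move=> cf fi; have mf : measurable_fun setT f by exact: continuous_measurable_fun.
apply/integrableP; split.
  by apply/measurable_EFinP/measurable_funM => //; exact: measurable_normal_pdf.
under eq_integral do rewrite abse_EFin normrM (ger0_norm (normal_pdf_ge0 _ _ _)).
rewrite -ge0_integral_normal_prob//; last exact: measurableT_comp.
by move/integrableP : fi => [].
Qed.

Lemma normal_pdf_tail : (n%:R * normal_pdf 0 s n%:R) @[n --> \oo] --> (0 : R).
Proof.
pose C := 64 * s ^+ 4 * normal_peak (Num.sqrt 2 * s).
(* [harmonic k] is [1 / (k + 1)], hence the predecessor. *)
apply: (@squeeze_cvgr _ _ _ _ (cst 0) (fun n => C * harmonic n.-1)).
- near=> n; rewrite mulr_ge0 ?normal_pdf_ge0//=.
  have n0 : (0 < n)%N by near: n; exact: nbhs_infty_gt.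
  have nr0 : 0 < n%:R :> R by rewrite ltr0n.
  have n1 : 1 <= n%:R :> R by rewrite ler1n.
  rewrite prednK// ler_pdivlMr// (le_trans _ (_ : 64 * s ^+ 4 * normal_pdf 0 (Num.sqrt 2 * s) n%:R <= C))//; last first.
    rewrite ler_wpM2l ?mulr_ge0 ?exprn_ge0 ?(ltW s0)// normal_pdf_ub//.
    by rewrite gt_eqF// mulr_gt0// sqrtr_gt0.
  apply: le_trans (normal_pdf_expr4_le _ s0).
  rewrite mulrAC -expr2 ler_wpM2r ?normal_pdf_ge0//.
  by rewrite ler_weXn2l.
- exact: cvg_cst.
- rewrite -[X in _ --> X](mulr0 C); apply: cvgM; first exact: cvg_cst.
  by rewrite -cvg_shiftS /=; exact: cvg_harmonic.
Unshelve. all: by end_near. Qed.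

Lemma normal_mean : (\int[N]_x x%:E = 0)%E.
Proof.
have s20 : s ^+ 2 != 0 by rewrite expf_neq0// gt_eqF.
have xi := integrable_normal_expr (isT : 1 <= 4)%N.
rewrite (@integral_normal_prob s id)//.
have cpdf : continuous (normal_pdf 0 s) by apply: continuous_normal_pdf; rewrite gt_eqF.
apply: (integral_line_eq0 (F := fun x => - s ^+ 2 * normal_pdf 0 s x)).
- by move=> x; apply: cvgM; [exact: cvg_id | exact: cpdf].
- by apply: leb_integrable_normal_pdf => // x; exact: cvg_id.
- move=> x; have dpdf := is_derive_normal_pdf x (lt0r_neq0 s0).
  by apply: is_derive_eq; rewrite /GRing.scale/=; field; rewrite gt_eqF.
- under eq_cvg do rewrite !normal_pdf0E ?gt_eqF// sqrrN subrr.
  exact: cvg_cst.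
Qed.

Lemma normal_variance : (\int[N]_x (x ^+ 2)%:E = (s ^+ 2)%:E)%E.
Proof.
have s20 : s ^+ 2 != 0 by rewrite expf_neq0// gt_eqF.
have x2i := integrable_normal_expr (isT : 2 <= 4)%N.
have ci : N.-integrable setT (EFin \o cst (s ^+ 2)).
  exact: finite_measure_integrable_cst.
have cpdf : continuous (normal_pdf 0 s) by apply: continuous_normal_pdf; rewrite gt_eqF.
have i2 : N.-integrable setT (EFin \o (fun x => x ^+ 2 - s ^+ 2)).
  exact: (integrableB measurableT x2i ci).
have c2 : continuous (fun x : R => x ^+ 2 - s ^+ 2).
  by move=> x; apply: cvgB; [exact: exprn_continuous | exact: cvg_cst].
have : (\int[N]_x (x ^+ 2 - s ^+ 2)%:E = 0)%E.
  rewrite (@integral_normal_prob s (fun x => x ^+ 2 - s ^+ 2))//.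
  apply: (integral_line_eq0 (F := fun x => - s ^+ 2 * (x * normal_pdf 0 s x))).
  - by move=> x; apply: cvgM; [exact: c2 | exact: cpdf].
  - exact: leb_integrable_normal_pdf.
  - move=> x; have dpdf := is_derive_normal_pdf x (lt0r_neq0 s0).
    by apply: is_derive_eq; rewrite /GRing.scale/=; field; rewrite gt_eqF.
  - under eq_cvg => n.
      rewrite (_ : _ - _ = - 2 * s ^+ 2 * (n%:R * normal_pdf 0 s n%:R)).
        over.
      by rewrite !normal_pdf0E ?gt_eqF// sqrrN; ring.
    have h : (- 2 * s ^+ 2 * (n%:R * normal_pdf 0 s n%:R)) @[n --> \oo] --> (- 2 * s ^+ 2 * 0 : R).
      by apply: cvgM; [exact: cvg_cst | exact: normal_pdf_tail].
    by rewrite mulr0 in h.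
under eq_integral do rewrite EFinB.
rewrite integralB//= integral_cst//= probability_setT mule1.
by move/eqP; rewrite sube_eq ?add0e//; [move/eqP|exact: integrable_fin_num].
Qed.

End fixed_scale.
End normal_moments.

(** * Expectations, image laws and independence *)

Section expectation.
Context {R : realType} {d : measure_display} {Omega : measurableType d}.
Variable P : probability Omega R.
Local Notation L1 f := (P.-integrable setT (EFin \o f)).
Local Notation E f := (\int[P]_w f w)%R.
Implicit Types f g : Omega -> R.

Lemma L1_measurable f : L1 f -> measurable_fun setT f.
Proof. by move=> /measurable_int/measurable_EFinP. Qed.

Lemma L1D f g : L1 f -> L1 g -> L1 (fun w => f w + g w).
Proof. by move=> fi gi; exact: (integrableD measurableT fi gi). Qed.

Lemma L1B f g : L1 f -> L1 g -> L1 (fun w => f w - g w).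
Proof. by move=> fi gi; exact: (integrableB measurableT fi gi). Qed.

Lemma L1Z (r : R) f : L1 f -> L1 (fun w => r * f w).
Proof. by move=> fi; exact: (integrableZl measurableT r fi). Qed.

Lemma L1_cst (r : R) : L1 (fun=> r).
Proof. exact: finite_measure_integrable_cst. Qed.

Lemma L1_le f g : measurable_fun setT f -> (forall w, `|f w| <= g w) -> L1 g -> L1 f.
Proof.
move=> mf fg gi; apply: (le_integrable measurableT _ _ gi); first exact/measurable_EFinP.
by move=> w _ /=; rewrite lee_fin (le_trans (fg w))// ler_norm.
Qed.

Lemma L1_sum (I : Type) (r : seq I) (F : I -> Omega -> R) :
  (forall i, L1 (F i)) -> L1 (fun w => \sum_(i <- r) F i w).
Proof.
move=> Fi; elim: r => [|i r IH].
  by under eq_fun do rewrite big_nil; exact: L1_cst.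
by under eq_fun do rewrite big_cons; exact: L1D.
Qed.

Lemma ev_sum (I : Type) (r : seq I) (F : I -> Omega -> R) :
  (forall i, L1 (F i)) -> E (fun w => \sum_(i <- r) F i w) = \sum_(i <- r) E (F i).
Proof.
move=> Fi; elim: r => [|i r IH].
  under eq_Rintegral do rewrite big_nil.
  by rewrite Rintegral_cst// mul0r big_nil.
under eq_Rintegral do rewrite big_cons.
by rewrite RintegralD ?big_cons ?IH//; exact: L1_sum.
Qed.

Lemma ev_cst (r : R) : E (fun=> r) = r.
Proof. by rewrite Rintegral_cst//= (@probability_setT _ _ _ P) mulr1. Qed.

Section law.
Context {d'} {T : measurableType d'}.
Variables (x : Omega -> T) (N : probability T R) (f : T -> R).
Hypothesis mx : measurable_fun setT x.
Hypothesis xN : forall B, measurable B -> P (x @^-1` B) = N B.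
Hypothesis fi : N.-integrable setT (EFin \o f).

Let X : {mfun Omega >-> T} := HB.pack x (isMeasurableFun.Build _ _ _ _ _ mx).

Let XN A : measurable A -> A `<=` setT -> distribution P X A = N A.
Proof. by move=> mA _; exact: xN. Qed.

Lemma law_integrable : L1 (f \o x).
Proof.
have mf := measurable_int _ fi; apply/integrableP; split; first exact: (measurableT_comp mf mx).
move/integrableP : fi => [_]; rewrite -(eq_measure_integral _ XN).
rewrite ge0_integral_pushforward//; exact: measurableT_comp.
Qed.

Lemma law_ev : E (f \o x) = (\int[N]_y f y)%R.
Proof.
have mf := measurable_int _ fi; rewrite /Rintegral -(eq_measure_integral _ XN).
by rewrite integral_pushforward//; exact: law_integrable.
Qed.

End law.

Definition indep2 f g := forall A B, measurable A -> measurable B ->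
  P (f @^-1` A `&` g @^-1` B) = (P (f @^-1` A) * P (g @^-1` B))%E.

Section indep2.
Variables f g : Omega -> R.
Hypotheses (fi : L1 f) (gi : L1 g) (fg : indep2 f g).

Let mf := L1_measurable fi.
Let mg := L1_measurable gi.
Let X : {mfun Omega >-> R} := HB.pack f (isMeasurableFun.Build _ _ _ _ _ mf).
Let Y : {mfun Omega >-> R} := HB.pack g (isMeasurableFun.Build _ _ _ _ _ mg).
Let mXY : measurable_fun setT (fun w => (f w, g w)).
Proof. exact: measurable_fun_pair. Qed.
Let XY : {mfun Omega >-> (R * R)%type} :=
  HB.pack (fun w => (f w, g w)) (isMeasurableFun.Build _ _ _ _ _ mXY).
Let PX := distribution P X.
Let PY := distribution P Y.

(** Independence says that the two measures agree on rectangles, hence everywhere; expectations of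
    products then reduce to Fubini. *)
Let XYE A : measurable A -> A `<=` setT -> (PX \x PY)%E A = distribution P XY A.
Proof. by move=> mA _; apply: product_measure_unique => // B C mB mC; exact: fg. Qed.

Let mprod : measurable_fun setT (fun xy : R * R => (xy.1 * xy.2)%:E).
Proof. by apply/measurable_EFinP/measurable_funM; [exact: measurable_fst|exact: measurable_snd]. Qed.

Let iX : PX.-integrable setT (EFin \o id).
Proof. by apply: (integrable_pushforward (phi := X)) => //; exact/measurable_EFinP. Qed.

Let iY : PY.-integrable setT (EFin \o id).
Proof. by apply: (integrable_pushforward (phi := Y)) => //; exact/measurable_EFinP. Qed.

Let iprod : (PX \x PY)%E.-integrable setT (fun xy : R * R => (xy.1 * xy.2)%:E).
Proof.
have iY' := integrable_abse iY; have iX' := integrable_abse iX.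
apply/integrable12ltyP => //.
have inner x : (\int[PY]_y `|(x * y)%:E| = `|x%:E| * \int[PY]_y `|y%:E|)%E.
  rewrite -[RHS](integralZl measurableT iY' `|x|).
  by apply: eq_integral => y _; rewrite EFinM abseM.
under eq_integral do rewrite inner.
have [_ lX] := (integrableP _ _ _ iX); have [_ lY] := (integrableP _ _ _ iY).
rewrite ge0_integralZr//; last 2 first.
- exact: (measurable_int _ iX').
- exact: integral_ge0.
by rewrite lte_mul_pinfty ?integral_ge0// ge0_fin_numE ?integral_ge0.
Qed.

Lemma indep2_L1 : L1 (fun w => f w * g w).
Proof.
apply/integrableP; split; first by apply/measurable_EFinP/measurable_funM.
move/integrableP : iprod => [_]; rewrite (eq_measure_integral _ XYE).
by rewrite ge0_integral_pushforward//; exact: measurableT_comp.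
Qed.

Lemma indep2_ev : E (fun w => f w * g w) = E f * E g.
Proof.
have -> : E (fun w => f w * g w) = fine (\int[(PX \x PY)%E]_xy (xy.1 * xy.2)%:E).
  rewrite /Rintegral (eq_measure_integral _ XYE) integral_pushforward//.
  exact: indep2_L1.
rewrite -integral12_prod_meas1//=.
have inner x : (\int[PY]_y (x * y)%:E = x%:E * (fine (\int[PY]_y y%:E))%:E)%E.
  rewrite fineK; last exact: (integrable_fin_num measurableT iY).
  exact: (integralZl measurableT iY x).
rewrite (eq_integral (fun x : R => x%:E * (fine (\int[PY]_y y%:E))%:E)%E); last first.
  by move=> x _; exact: inner.
rewrite (integralZr measurableT iX) fineM//; last exact: integrable_fin_num.
congr (_ * _).
  by rewrite (integral_pushforward (phi := X))//; exact/measurable_EFinP.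
by rewrite (integral_pushforward (phi := Y))//; exact/measurable_EFinP.
Qed.

End indep2.

End expectation.

(** * Convergence in probability *)

Section whp.
Context {R : realType} {d : measure_display} {Omega : measurableType d}.
Variable P : probability Omega R.
Local Notation L1 f := (P.-integrable setT (EFin \o f)).

(* [G n] may fail to be measurable, hence the measurable exceptional sets. *)
Definition whp (G : nat -> set Omega) := exists B : nat -> set Omega,
  [/\ forall n, measurable (B n), (P (B n) @[n --> \oo] --> 0)%E &
      \forall n \near \oo, ~` B n `<=` G n].

Lemma whp_sub (G G' : nat -> set Omega) :
  whp G -> (\forall n \near \oo, G n `<=` G' n) -> whp G'.
Proof.
move=> [B [mB PB BG]] GG'; exists B; split => //.
near=> n; apply: (@subset_trans _ (G n)); first by near: n.
by near: n.
Unshelve. all: by end_near. Qed.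

Lemma whpT : whp (fun=> setT).
Proof.
exists (fun=> set0); split => //.
- rewrite measure0; exact: cvg_cst.
- exact: nearW.
Qed.

Lemma whpI (G G' : nat -> set Omega) :
  whp G -> whp G' -> whp (fun n => G n `&` G' n).
Proof.
move=> [B [mB PB BG]] [B' [mB' PB' BG']]; exists (fun n => B n `|` B' n); split.
- by move=> n; exact: measurableU.
- apply: (@squeeze_cvge _ _ _ _ (fun=> 0%E) _ (fun n => P (B n) + P (B' n))%E).
  + by apply: nearW => n; rewrite measure_ge0/= measureU2.
  + exact: cvg_cst.
  + by rewrite -(adde0 0%E); exact: cvgeD.
- near=> n; rewrite setCU; apply: setISS.
    by near: n.
  by near: n.
Unshelve. all: by end_near. Qed.

Lemma whp_all (I : finType) (G : I -> nat -> set Omega) :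
  (forall i, whp (G i)) -> whp (fun n => [set w | forall i, G i n w]).
Proof.
move=> wG; suff : forall s : seq I, whp (fun n => [set w | forall i, i \in s -> G i n w]).
  move=> /(_ (enum I)) h; apply: (whp_sub h); apply: nearW => n w /= h' i.
  by apply: h'; rewrite mem_enum.
elim=> [|i s IH]; first by apply: (whp_sub whpT); apply: nearW => n w _ i.
apply: (whp_sub (whpI (wG i) IH)); apply: nearW => n w [Gi Gs] j.
by rewrite inE => /orP[/eqP->//|/Gs].
Qed.

(** Markov's inequality. Integrability is asked for large [n] only, as the grid of mesh [T / n]
    makes sense for [n > 0]. *)
Lemma whp_L1 (Z : nat -> Omega -> R) (b : nat -> R) (e : R) :
  (forall n w, 0 <= Z n w) ->
  (\forall n \near \oo, L1 (Z n) /\ (\int[P]_w Z n w)%R <= b n) ->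
  (b n @[n --> \oo] --> (0 : R)) -> 0 < e ->
  whp (fun n => [set w | Z n w < e]).
Proof.
move=> Z0 near_Z bZ e0.
(* The empty set is a measurable default at the finitely many [n] where integrability may fail. *)
pose B n := if pselect (L1 (Z n)) then [set w | e <= Z n w] else set0.
exists B; split.
- move=> n; rewrite /B; case: pselect => [Zi|_] /=; last exact: measurable0.
  by have := emeasurable_fun_c_infty measurableT (measurable_int _ Zi) e%:E; rewrite setTI.
- have be : (b n / e)%:E @[n --> \oo] --> (0%:E : \bar R).
    apply: cvg_EFin; first exact: nearW.
    rewrite -[X in _ --> X](mul0r e^-1).
    by apply: cvgM => //; exact: cvg_cst.
  suff sq : \forall n \near \oo, (0 <= P (B n) <= (b n / e)%:E)%E.
    exact: (squeeze_cvge sq (cvg_cst _) be).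
  near=> n; rewrite measure_ge0/=.
  have [Zi Zb] : L1 (Z n) /\ (\int[P]_w Z n w)%R <= b n by near: n.
  rewrite /B; case: pselect => [Zi'|//] /=.
  have := le_integral_abse P measurableT (measurable_int _ Zi) e0.
  under eq_integral do rewrite /= ger0_norm//.
  rewrite setTI /= => h.
  rewrite EFinM lee_pdivlMr//.
  rewrite muleC; apply: le_trans (le_trans h _).
    rewrite le_eqVlt; apply/orP; left; apply/eqP; congr (_ * P _)%E.
    by apply/seteqP; split => w /=; rewrite lee_fin ger0_norm.
  by rewrite -(fineK (integrable_fin_num measurableT Zi)) lee_fin.
- near=> n.
  have [Zi _] : L1 (Z n) /\ (\int[P]_w Z n w)%R <= b n by near: n.
  rewrite /B; case: pselect => [Zi'|//] w /=.
  by move/negP; rewrite -ltNge.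
Unshelve. all: by end_near. Qed.

(** Dominated convergence for the indicators of the exceptional events, which tend to 0 almost
    surely and are bounded by 1. *)
Lemma whp_ae (Z : nat -> Omega -> R) (e : R) :
  (forall n, measurable_fun setT (Z n)) ->
  {ae P, forall w, Z n w @[n --> \oo] --> (0 : R)} -> 0 < e ->
  whp (fun n => [set w | `|Z n w| < e]).
Proof.
move=> mZ aeZ e0; pose B n := [set w | e <= `|Z n w|].
have mB n : measurable (B n).
  have mZn : measurable_fun setT (fun w => `|Z n w|) by exact: measurableT_comp.
  have /measurable_EFinP mE := mZn.
  by have := emeasurable_fun_c_infty measurableT mE e%:E; rewrite setTI.
exists B; split => //; last first.
  by apply: nearW => n w /= /negP; rewrite -ltNge.
pose I n w : \bar R := (\1_(B n) w)%:E.
have mI n : measurable_fun setT (I n) by apply/measurable_EFinP; exact: measurable_indic.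
have cI : {ae P, forall w, setT w -> I ^~ w @ \oo --> cst 0%E w}.
  apply: filterS aeZ => w Zw _.
  apply: (@cvg_trans _ ((cst 0%E : nat -> \bar R) @ \oo)); last by rewrite /=; exact: cvg_cst.
  apply: near_eq_cvg; near=> n; have Zn : `|Z n w| < e by near: n; exact: (cvgr0_norm_lt _ Zw).
  by rewrite /= /I indicE memNset// /B/=; apply/negP; rewrite -ltNge.
have I1 : {ae P, forall w n, setT w -> (`|I n w| <= cst 1 w)%E}.
  by apply: aeW => w n _; rewrite lee_fin indicE ger0_norm//; case: (_ \in _).
have i1 : P.-integrable setT (cst 1%E : Omega -> \bar R).
  exact: finite_measure_integrable_cst.
have [_ _] := dominated_convergence measurableT mI (measurable_cst _) cI i1 I1.
rewrite integral0 /=; apply: cvg_trans; apply: near_eq_cvg; apply: nearW => n.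
by rewrite /I integral_indic// setIT.
Unshelve. all: by end_near. Qed.

Lemma whp_cvg1 (G : nat -> set Omega) :
  (\forall n \near \oo, measurable (G n)) -> whp G ->
  (P (G n) @[n --> \oo] --> 1)%E.
Proof.
move=> mG [B [mB PB BG]].
apply: (@squeeze_cvge _ _ _ _ (fun n => 1 - P (B n))%E _ (fun=> 1%E)).
- near=> n; have mGn : measurable (G n) by near: n.
  rewrite probability_le1// andbT -probability_setC// le_measure ?inE//.
    exact: measurableC.
  by near: n.
- rewrite -[X in _ --> X]sube0; apply: cvgeB => //; exact: cvg_cst.
- exact: cvg_cst.
Unshelve. all: by end_near. Qed.

Lemma second_moment_sum n (U : 'I_n -> Omega -> R) (C : R) :
  (forall i j, L1 (fun w => U i w * U j w)) ->
  (forall i j, i != j -> (\int[P]_w (U i w * U j w))%R = 0) ->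
  (forall i, (\int[P]_w (U i w * U i w))%R <= C) ->
  L1 (fun w => (\sum_i U i w) ^+ 2) /\
  (\int[P]_w (\sum_i U i w) ^+ 2)%R <= n%:R * C.
Proof.
move=> Ui orth UC.
have E w : (\sum_i U i w) ^+ 2 = \sum_i \sum_j U i w * U j w.
  by rewrite expr2 mulr_suml; apply: eq_bigr => i _; rewrite mulr_sumr.
have Li : L1 (fun w => \sum_i \sum_j U i w * U j w).
  by apply: L1_sum => i; apply: L1_sum.
split; first by under eq_fun do rewrite E.
under eq_Rintegral do rewrite E.
rewrite ev_sum; last by move=> i; exact: L1_sum.
rewrite mulr_natl -[X in _ *+ X](card_ord n) -sumr_const.
apply: ler_sum => i _; rewrite ev_sum// (bigD1 i)//= big1 ?addr0//.
by move=> j ji; rewrite orth// eq_sym.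
Qed.

End whp.

(** * Second moments of Wiener increments on the grid *)

Section sigma_measurable.
Context {R : realType} {Omega : Type}.

Definition sigma_measurable (G : set (set Omega)) (f : Omega -> R) :=
  forall B, measurable B -> G (f @^-1` B).

End sigma_measurable.

Section sigma_measurable_pointed.
Context {R : realType} {Omega : pointedType} (G : set (set Omega)).
Hypothesis sG : sigma_algebra setT G.

(** Makes [G] the sigma-algebra of a measurable type, so that the closure properties of measurable
    functions hold relative to [G]. *)
Lemma sigma_measurableP (f : Omega -> R) :
  sigma_measurable G f <-> measurable_fun setT (f : g_sigma_algebraType G -> R).
Proof.
have mE : (@measurable _ (g_sigma_algebraType G)) = G.
  exact: sigma_algebra_id.
split=> [mf _ B mB|mf B mB]; first by rewrite setTI mE; exact: mf.
by rewrite -mE -[X in measurable X]setTI; exact: mf.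
Qed.

Lemma sigma_measurableB (f g : Omega -> R) : sigma_measurable G f ->
  sigma_measurable G g -> sigma_measurable G (fun w => f w - g w).
Proof.
by move=> /sigma_measurableP mf /sigma_measurableP mg; apply/sigma_measurableP/measurable_funB.
Qed.

Lemma sigma_measurableM (f g : Omega -> R) : sigma_measurable G f ->
  sigma_measurable G g -> sigma_measurable G (fun w => f w * g w).
Proof.
by move=> /sigma_measurableP mf /sigma_measurableP mg; apply/sigma_measurableP/measurable_funM.
Qed.

End sigma_measurable_pointed.

Section wiener_increments.
Context {R : realType} {d : measure_display} {Omega : measurableType d}.
Variables (P : probability Omega R) (Ft : R -> set (set Omega)).
Local Notation L1 f := (P.-integrable setT (EFin \o f)).
Local Notation E f := (\int[P]_w f w)%R.
Hypothesis hF : filtration Ft.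

Variables (r : nat) (W : R -> Omega -> 'cV[R]_r).
Hypothesis hW : wiener P Ft W.

Definition winc (s t : R) (a : 'I_r) (w : Omega) : R := (W t w - W s w) a ord0.

Lemma wiener_measurable t : 0 <= t -> measurable_fun setT (W t).
Proof.
move=> t0 _ B mB; apply: ((hF.1 t t0).2).
have [adW _ _ _ _] := hW; apply: (adW t t0).
by exists B.
Qed.

Lemma winc_measurable s t a : 0 <= s -> 0 <= t -> measurable_fun setT (winc s t a).
Proof.
move=> s0 t0; apply: measurable_fun_mx_entry; apply: measurable_addmx.
  exact: wiener_measurable.
by apply: measurable_oppmx; exact: wiener_measurable.
Qed.

Lemma winc_adapted u s t a : 0 <= s -> s <= u -> 0 <= t -> t <= u ->
  sigma_measurable (Ft u) (winc s t a).
Proof.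
move=> s0 su t0 tu; have u0 := le_trans s0 su.
have adW v : 0 <= v -> v <= u -> sigma_measurable (Ft u) (fun w => W v w a ord0).
  move=> v0 vu B mB; apply: (hF.2 v u v0 vu).
  have [adW _ _ _ _] := hW; apply: (adW v v0).
  exists [set M : 'cV[R]_r | B (M a ord0)]; last by rewrite setTI.
  by rewrite -[X in measurable X]setTI; exact: measurable_entry.
rewrite (_ : winc s t a = fun w => W t w a ord0 - W s w a ord0).
  by apply: sigma_measurableB; [exact: (hF.1 u u0).1|exact: adW|exact: adW].
by apply/funext => w; rewrite /winc !mxE.
Qed.

Section law.
Variables (s t : R) (s0 : 0 <= s) (st : s < t).
Let t0 : 0 <= t := le_trans s0 (ltW st).
Let ts : 0 < t - s. Proof. by rewrite subr_gt0. Qed.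

(** The law of the increment is given on boxes; the whole line in the other coordinates leaves the
    marginal. *)
Lemma winc_law a B : measurable B ->
  P (winc s t a @^-1` B) = normal_prob 0 (Num.sqrt (t - s)) B.
Proof.
move=> mB; have [_ _ _ law _] := hW.
have := law s t s0 st (fun j => if j == a then B else setT).
rewrite (bigD1 a)//= eqxx big1 ?mule1.
  move=> <-.
    congr (P _); apply/seteqP; split => w /=.
      by move=> h j; case: eqP => // ->.
    by move=> /(_ a); rewrite eqxx.
  by move=> j; case: ifP.
by move=> j /negbTE ->; exact: probability_setT.
Qed.

Lemma winc_indep_coord a b : a != b -> indep2 P (winc s t a) (winc s t b).
Proof.
move=> ab A B mA mB; rewrite !winc_law//; have [_ _ _ law _] := hW.
have := law s t s0 st (fun j => if j == a then A else if j == b then B else setT).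
rewrite (bigD1 a)//= eqxx (bigD1 b) /=; last by rewrite eq_sym.
rewrite (negbTE (_ : b != a)) 1?eq_sym// eqxx big1 ?mule1.
  move=> <-.
    congr (P _); apply/seteqP; split => w /=.
      by move=> [h1 h2] j; case: eqP => [->//|_]; case: eqP => // ->.
    move=> h; have := h b; have := h a; rewrite !eqxx (negbTE (_ : b != a)) 1?eq_sym//.
  by move=> j; case: ifP => // _; case: ifP.
by move=> j /andP[/negbTE -> /negbTE ->]; exact: probability_setT.
Qed.

(** [phi] acts on the whole increment so as to cover products of two coordinates. *)
Lemma winc_indep_past (g : Omega -> R) (phi : 'cV[R]_r -> R) :
  sigma_measurable (Ft s) g -> measurable_fun setT phi ->
  indep2 P g (fun w => phi (W t w - W s w)).
Proof.
move=> mg mphi A B mA mB; have [_ _ _ _ ind] := hW.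
apply: (ind s t) => //; first exact: mg.
exists (phi @^-1` B); last by rewrite setTI.
by rewrite -[X in measurable X]setTI; exact: mphi.
Qed.

Let sq0 : 0 < Num.sqrt (t - s). Proof. by rewrite sqrtr_gt0. Qed.

Lemma winc_expr_L1 a k : (k <= 4)%N -> L1 (fun w => winc s t a w ^+ k).
Proof.
move=> k4; apply: (@law_integrable _ _ _ P _ (measurableTypeR R) (winc s t a)
  (normal_prob 0 (Num.sqrt (t - s))) (fun x => x ^+ k)).
- exact: winc_measurable.
- exact: winc_law.
- exact: integrable_normal_expr.
Qed.

Lemma winc_L1 a : L1 (winc s t a). Proof. exact: (@winc_expr_L1 a 1). Qed.

Lemma winc_mean a : E (winc s t a) = 0.
Proof.
rewrite (@law_ev _ _ _ P _ (measurableTypeR R) (winc s t a) (normal_prob 0 (Num.sqrt (t - s))) id).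
- by rewrite /Rintegral normal_mean.
- exact: winc_measurable.
- exact: winc_law.
- exact: (integrable_normal_expr sq0 (isT : 1 <= 4)%N).
Qed.

Lemma winc_var a : E (fun w => winc s t a w ^+ 2) = t - s.
Proof.
rewrite (@law_ev _ _ _ P _ (measurableTypeR R) (winc s t a) (normal_prob 0 (Num.sqrt (t - s))) (fun x => x ^+ 2)).
- by rewrite /Rintegral normal_variance//= sqr_sqrtr// ltW.
- exact: winc_measurable.
- exact: winc_law.
- exact: (integrable_normal_expr sq0 (isT : 2 <= 4)%N).
Qed.

Lemma winc_expr4 a : E (fun w => winc s t a w ^+ 4) <= 64 * (t - s) ^+ 2.
Proof.
rewrite (@law_ev _ _ _ P _ (measurableTypeR R) (winc s t a) (normal_prob 0 (Num.sqrt (t - s))) (fun x => x ^+ 4)).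
- have Ni := integrable_normal_expr sq0 (isT : 4 <= 4)%N.
  rewrite -lee_fin /Rintegral fineK; last exact: integrable_fin_num.
  apply: le_trans (normal_expr4_le sq0) _; rewrite lee_fin.
  by rewrite (_ : 4 = 2 * 2)%N// exprM sqr_sqrtr// ltW.
- exact: winc_measurable.
- exact: winc_law.
- exact: (integrable_normal_expr sq0 (isT : 4 <= 4)%N).
Qed.

End law.
End wiener_increments.

Section grid_increments.
Context {R : realType} {d : measure_display} {Omega : measurableType d}.
Variables (P : probability Omega R) (Ft : R -> set (set Omega)).
Local Notation L1 f := (P.-integrable setT (EFin \o f)).
Local Notation E f := (\int[P]_w f w)%R.
Hypothesis hF : filtration Ft.

Definition ginc r (W : R -> Omega -> 'cV[R]_r) (h : R) (i : nat) (a : 'I_r) :=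
  winc W (i%:R * h) (i.+1%:R * h) a.

Section one_process.
Variables (r : nat) (W : R -> Omega -> 'cV[R]_r) (h : R).
Hypotheses (hW : wiener P Ft W) (h0 : 0 < h).

Let t_ge0 (i : nat) : 0 <= i%:R * h. Proof. by rewrite mulr_ge0// ltW. Qed.
Let t_lt (i : nat) : i%:R * h < i.+1%:R * h.
Proof. by rewrite ltr_pM2r// ltr_nat. Qed.
Let t_diff (i : nat) : i.+1%:R * h - i%:R * h = h.
Proof. by rewrite -mulrBl -natrB// subSnn mul1r. Qed.
Let t_le (i j : nat) : (i <= j)%N -> i%:R * h <= j%:R * h.
Proof. by move=> ij; rewrite ler_wpM2r ?ler_nat// ltW. Qed.

Lemma ginc_measurable i a : measurable_fun setT (ginc W h i a).
Proof. exact: (winc_measurable hF hW). Qed.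

Lemma ginc_expr_L1 i a k : (k <= 4)%N -> L1 (fun w => ginc W h i a w ^+ k).
Proof. exact: (winc_expr_L1 hF hW). Qed.

Lemma ginc_L1 i a : L1 (ginc W h i a).
Proof. exact: (winc_L1 hF hW). Qed.

Lemma ginc_mean i a : E (ginc W h i a) = 0.
Proof. exact: (winc_mean hF hW). Qed.

Lemma ginc_var i a : E (fun w => ginc W h i a w ^+ 2) = h.
Proof. by rewrite (winc_var hF hW)// t_diff. Qed.

Lemma ginc_expr4 i a : E (fun w => ginc W h i a w ^+ 4) <= 64 * h ^+ 2.
Proof. by have := winc_expr4 hF hW (t_ge0 i) (t_lt i) a; rewrite t_diff. Qed.

Lemma ginc_adapted i j a : (i < j)%N -> sigma_measurable (Ft (j%:R * h)) (ginc W h i a).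
Proof. by move=> ij; apply: (winc_adapted hF hW) => //; apply: t_le => //; exact: ltnW. Qed.

Lemma ginc_indep_past (g : Omega -> R) (phi : 'cV[R]_r -> R) i :
  sigma_measurable (Ft (i%:R * h)) g -> measurable_fun setT phi ->
  indep2 P g (fun w => phi (W (i.+1%:R * h) w - W (i%:R * h) w)).
Proof. exact: (winc_indep_past hW). Qed.

Lemma ginc_orth i j a b : (i < j)%N ->
  L1 (fun w => ginc W h i a w * ginc W h j b w) /\
  E (fun w => ginc W h i a w * ginc W h j b w) = 0.
Proof.
move=> ij; have ind : indep2 P (ginc W h i a) (ginc W h j b).
  apply: (@ginc_indep_past _ (fun v => v b ord0)); first exact: ginc_adapted.
  exact: measurable_entry.
split; first by apply: indep2_L1 => //; exact: ginc_L1.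
by rewrite indep2_ev ?ginc_mean ?mul0r//; exact: ginc_L1.
Qed.

Lemma ginc_prod_L1 i a b : L1 (fun w => ginc W h i a w * ginc W h i b w).
Proof.
apply: (@L1_le _ _ _ _ _ (fun w => ginc W h i a w ^+ 2 + ginc W h i b w ^+ 2)).
- by apply: measurable_funM; exact: ginc_measurable.
- move=> w; rewrite normrM; have := normrM_le_half_sqr (ginc W h i a w) (ginc W h i b w).
  by have := sqr_ge0 (ginc W h i a w); have := sqr_ge0 (ginc W h i b w); lra.
- by apply: L1D; exact: ginc_expr_L1.
Qed.

Lemma ginc_prod_ev i a b :
  E (fun w => ginc W h i a w * ginc W h i b w) = (a == b)%:R * h.
Proof.
have [->|ab] := eqVneq a b.
  by rewrite mul1r -[RHS](ginc_var i b); under eq_Rintegral do rewrite -expr2.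
rewrite mul0r indep2_ev ?ginc_mean ?mul0r//; [exact: ginc_L1|exact: ginc_L1|].
exact: (winc_indep_coord hW).
Qed.

(** The centred products are orthogonal: each has mean 0 and is independent of the past, which
    contains the earlier ones. Only the [n] diagonal terms remain, and fourth moments bound them by
    [64 h^2]. *)
Lemma sum_ginc_same n a b :
  let U (i : 'I_n) w := ginc W h i a w * ginc W h i b w - (a == b)%:R * h in
  L1 (fun w => (\sum_i U i w) ^+ 2) /\
  E (fun w => (\sum_i U i w) ^+ 2) <= n%:R * (64 * h ^+ 2).
Proof.
move=> U; have UL i : L1 (U i) by apply: L1B; [exact: ginc_prod_L1|exact: L1_cst].
have UE i : E (U i) = 0.
  by rewrite /U RintegralB ?ginc_prod_ev ?ev_cst ?subrr//; [exact: ginc_prod_L1|exact: L1_cst].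
have ind (i j : 'I_n) : (i < j)%N -> indep2 P (U i) (U j).
  move=> ij; apply: (@ginc_indep_past _ (fun v => v a ord0 * v b ord0 - (a == b)%:R * h)).
    have sF := (hF.1 _ (t_ge0 j)).1; apply: sigma_measurableB => //.
      by apply: sigma_measurableM => //; exact: ginc_adapted.
    by apply/(sigma_measurableP sF); exact: measurable_cst.
  by apply: measurable_funB => //; apply: measurable_funM; exact: measurable_entry.
(* For [a = b] this is the expansion of the square; otherwise it is [2 x^2 y^2 <= x^4 + y^4]. *)
have sqle w i : U i w * U i w <=
    2^-1 * (ginc W h i a w ^+ 4 + ginc W h i b w ^+ 4) +
    (a == b)%:R * (h ^+ 2 - 2 * h * ginc W h i a w ^+ 2).
  rewrite /U; have [->|_] := eqVneq a b.
    by rewrite !mul1r le_eqVlt; apply/orP; left; apply/eqP; field.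
  rewrite !mul0r subr0 addr0.
  have := sqr_ge0 (ginc W h i a w ^+ 2 - ginc W h i b w ^+ 2); lra.
have dL i : L1 (fun w => 2^-1 * (ginc W h i a w ^+ 4 + ginc W h i b w ^+ 4)).
  by apply: L1Z; apply: L1D; exact: ginc_expr_L1.
have dL' i : L1 (fun w => (a == b)%:R * (h ^+ 2 - 2 * h * ginc W h i a w ^+ 2)).
  by apply: L1Z; apply: L1B; [exact: L1_cst|apply: L1Z; exact: ginc_expr_L1].
have sqL i : L1 (fun w => U i w * U i w).
  apply: (L1_le _ _ (L1D (dL i) (dL' i))).
    by apply: measurable_funM; exact: L1_measurable.
  by move=> w; rewrite ger0_norm ?sqle// -expr2 sqr_ge0.
have UUL i j : i != j -> L1 (fun w => U i w * U j w) /\ E (fun w => U i w * U j w) = 0.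
  rewrite neq_ltn => /orP[ij|ji].
    by split; [exact: (indep2_L1 (UL i) (UL j) (ind _ _ ij))|
      rewrite (indep2_ev (UL i) (UL j) (ind _ _ ij)) UE mul0r].
  rewrite (_ : (fun w => U i w * U j w) = fun w => U j w * U i w); last first.
    by apply/funext => w; rewrite mulrC.
  by split; [exact: (indep2_L1 (UL j) (UL i) (ind _ _ ji))|
    rewrite (indep2_ev (UL j) (UL i) (ind _ _ ji)) UE mul0r].
apply: second_moment_sum.
- by move=> i j; have [<-|/UUL[]//] := eqVneq i j.
- by move=> i j /UUL[].
move=> i; apply: (le_trans (le_Rintegral measurableT (sqL i) (L1D (dL i) (dL' i)) _)) => //.
have x4L c : L1 (fun w => ginc W h i c w ^+ 4) by exact: ginc_expr_L1.
have x2L : L1 (fun w => ginc W h i a w ^+ 2) by exact: ginc_expr_L1.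
rewrite (RintegralD measurableT (dL i) (dL' i)).
rewrite (RintegralZl _ measurableT (L1D (x4L a) (x4L b))).
rewrite (RintegralZl _ measurableT (L1B (L1_cst P (h ^+ 2)) (L1Z (2 * h) x2L))).
rewrite (RintegralD measurableT (x4L a) (x4L b)).
rewrite (RintegralB measurableT (L1_cst P (h ^+ 2)) (L1Z (2 * h) x2L)).
rewrite ev_cst (RintegralZl _ measurableT x2L).
rewrite ginc_var; have := ginc_expr4 i a; have := ginc_expr4 i b.
set e1 := (\int[P]_w _)%R; set e2 := (\int[P]_w _)%R => e1h e2h.
have h2 : 0 <= h ^+ 2 by exact: sqr_ge0.
have -> : h ^+ 2 - 2 * h * h = - h ^+ 2 by ring.
by case: (a == b); rewrite ?mul1r ?mul0r; lra.
Qed.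

End one_process.

Section two_processes.
Variables (r r' : nat) (W : R -> Omega -> 'cV[R]_r) (W' : R -> Omega -> 'cV[R]_r') (h : R).
Hypotheses (hW : wiener P Ft W) (hW' : wiener P Ft W') (h0 : 0 < h).
Local Notation increments W :=
  <<s \bigcup_(u in [set u : R | 0 <= u]) sigma_of (fun w => W u w - W 0 w) >>.
Hypothesis WW' : forall A B, increments W A -> increments W' B ->
  P (A `&` B) = (P A * P B)%E.

Lemma ginc_increments q (V : R -> Omega -> 'cV[R]_q) i a :
  sigma_measurable (increments V) (ginc V h i a).
Proof.
have sV (u : R) : 0 <= u -> sigma_measurable (increments V) (fun w => (V u w - V 0 w) a ord0).
  move=> u0 B mB; apply: sub_sigma_algebra; exists u => //.
  exists [set M : 'cV[R]_q | B (M a ord0)]; last by rewrite setTI.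
  by rewrite -[X in measurable X]setTI; exact: measurable_entry.
rewrite (_ : ginc V h i a = fun w => (V (i.+1%:R * h) w - V 0 w) a ord0 -
    (V (i%:R * h) w - V 0 w) a ord0).
  apply: sigma_measurableB; first exact: smallest_sigma_algebra.
    by apply: sV; rewrite mulr_ge0// ltW.
  by apply: sV; rewrite mulr_ge0// ltW.
by apply/funext => w; rewrite /ginc /winc !mxE; ring.
Qed.

(** The expectation of [U i w * U j w] factors into one covariance per process, so it is 0 off the
    diagonal and [h^2] on it. The constant 64 is that of the bound for a single process, to treat
    both cases alike. *)
Lemma sum_ginc_diff n a b :
  let U (i : 'I_n) w := ginc W h i a w * ginc W' h i b w in
  L1 (fun w => (\sum_i U i w) ^+ 2) /\
  E (fun w => (\sum_i U i w) ^+ 2) <= n%:R * (64 * h ^+ 2).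
Proof.
move=> U.
have ind (i j : 'I_n) : indep2 P (fun w => ginc W h i a w * ginc W h j a w)
    (fun w => ginc W' h i b w * ginc W' h j b w).
  move=> A B mA mB; apply: WW'.
    by apply: sigma_measurableM mA; [exact: smallest_sigma_algebra|exact: ginc_increments|exact: ginc_increments].
  by apply: sigma_measurableM mB; [exact: smallest_sigma_algebra|exact: ginc_increments|exact: ginc_increments].
have orth q (V : R -> Omega -> 'cV[R]_q) c (i j : 'I_n) : wiener P Ft V ->
    L1 (fun w => ginc V h i c w * ginc V h j c w) /\
    E (fun w => ginc V h i c w * ginc V h j c w) = (i == j)%:R * h.
  move=> hV; have [<-|] := eqVneq i j.
    by rewrite mul1r; split; [exact: ginc_prod_L1|rewrite ginc_prod_ev// eqxx mul1r].
  rewrite mul0r neq_ltn => /orP[ij|ji]; first exact: ginc_orth.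
  rewrite (_ : (fun w => _) = fun w => ginc V h j c w * ginc V h i c w); last first.
    by apply/funext => w; rewrite mulrC.
  exact: ginc_orth.
have UUE i j w : U i w * U j w = ginc W h i a w * ginc W h j a w *
    (ginc W' h i b w * ginc W' h j b w) by rewrite /U; ring.
have UUL i j : L1 (fun w => U i w * U j w).
  under eq_fun do rewrite UUE.
  by apply: indep2_L1; [exact: (orth _ _ _ _ _ hW).1|exact: (orth _ _ _ _ _ hW').1|exact: ind].
have UU i j : E (fun w => U i w * U j w) = (i == j)%:R * h ^+ 2.
  under eq_Rintegral do rewrite UUE.
  rewrite indep2_ev//; [|exact: (orth _ _ _ _ _ hW).1|exact: (orth _ _ _ _ _ hW').1].
  rewrite (orth _ _ _ _ _ hW).2 (orth _ _ _ _ _ hW').2.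
  by case: (i == j); rewrite ?mul1r ?mul0r ?expr2.
apply: second_moment_sum => //.
- by move=> i j ij; rewrite UU (negbTE ij) mul0r.
- by move=> i; rewrite UU eqxx mul1r; have := sqr_ge0 h; lra.
Qed.

End two_processes.
End grid_increments.

(** * Drift and jumps *)

Section continuous_monotone.
Context {R : realType}.

Lemma grid_itv (T : R) (n i : nat) : 0 < T -> (i <= n)%N -> (0 < n)%N ->
  i%:R * (T / n%:R) \in `[0, T].
Proof.
move=> T0 iN n0; have nr : 0 < n%:R :> R by rewrite ltr0n.
rewrite in_itv/= mulr_ge0 ?divr_ge0 ?(ltW T0)//= mulrCA ler_piMr ?(ltW T0)//.
by rewrite ler_pdivrMr// mul1r ler_nat.
Qed.

(** Heine-Cantor, from compactness of the segment in its near-covering form: half of the radius is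
    for the move from [x] to [x'], the other half for the mesh. *)
Lemma unif_continuous_mesh (T : R) (G : R -> R) (e : R) : 0 < T -> 0 < e ->
  {within `[0, T], continuous G} ->
  \forall n \near \oo, forall x y, x \in `[0, T] -> y \in `[0, T] ->
    `|y - x| <= T / n%:R -> `|G y - G x| < e.
Proof.
move=> T0 e0 cG; have e20 : 0 < e / 2 by rewrite divr_gt0.
pose Q (n : nat) (x : R) := forall y, y \in `[0, T] ->
  `|y - x| <= T / n%:R -> `|G y - G x| < e.
have cQ : \forall n \near \oo, `[0, T]%classic `<=` Q n.
  have /compact_near_coveringP/near_covering_withinP := @segment_compact R 0 T.
  move=> h; apply: h => x Kx.
  have /subspace_continuousP/(_ x Kx)/cvgrPdist_lt/(_ _ e20) := cG.
  rewrite /= /within/= => /nbhs_ballP[r /= r0 xr].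
  have r20 : 0 < r / 2 by rewrite divr_gt0.
  near=> x' n; move=> Kx' y Ky yx'.
  have nr : T / (r / 2) < n%:R by near: n; exact: nbhs_infty_gtr.
  have n0 : 0 < n%:R :> R by rewrite (le_lt_trans _ nr)// divr_ge0 ?(ltW T0) ?(ltW r20).
  have Tn : T / n%:R < r / 2 by rewrite ltr_pdivrMr// mulrC -ltr_pdivrMr.
  have xx' : `|x - x'| < r / 2.
    by near: x'; apply/nbhs_ballP; exists (r / 2).
  have h1 : `|G x - G x'| < e / 2 by apply: xr => //; rewrite /ball/=; lra.
  have h2 : `|G x - G y| < e / 2.
    apply: xr => //; rewrite /ball/= (le_lt_trans (ler_distD x' _ _))//.
    by rewrite (distrC x' y); lra.
  rewrite (le_lt_trans (ler_distD (G x) _ _))// (distrC (G y)); lra.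
near=> n; move=> x y Kx Ky yx.
have h : `[0, T]%classic `<=` Q n by near: n.
exact: h.
Unshelve. all: by end_near. Qed.

(** The sum of squares is at most the largest increment times [G T - G 0], and uniform continuity
    makes the largest increment small. *)
Lemma sum_sqr_mesh_cvg0 (T : R) (G : R -> R) : 0 < T ->
  {within `[0, T], continuous G} ->
  {in `[0, T] &, {homo G : x y / x <= y}} ->
  \sum_(i < n) (G (i.+1%:R * (T / n%:R)) - G (i%:R * (T / n%:R))) ^+ 2
    @[n --> \oo] --> (0 : R).
Proof.
move=> T0 cG mG; apply/cvgrPdist_le => e e0.
(* [+ 1] keeps [V] positive when [G] is constant. *)
pose V := G T - G 0 + 1.
have I0 : (0 : R) \in `[0, T] by rewrite in_itv/= lexx ltW.
have IT : T \in `[0, T] by rewrite in_itv/= lexx ltW.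
have V0 : 0 < V by rewrite ltr_wpDl// subr_ge0 mG// ltW.
have eV : 0 < e / V by rewrite divr_gt0.
near=> n.
have n0 : (0 < n)%N by near: n; exact: nbhs_infty_gt.
have nr : 0 < n%:R :> R by rewrite ltr0n.
have unif : forall x y, x \in `[0, T] -> y \in `[0, T] ->
    `|y - x| <= T / n%:R -> `|G y - G x| < e / V.
  by near: n; exact: unif_continuous_mesh.
pose t i := G (i%:R * (T / n%:R)).
have tm (i : 'I_n) : 0 <= t i.+1 - t i <= e / V.
  have ti := grid_itv T0 (ltnW (ltn_ord i)) n0.
  have tS := grid_itv T0 (ltn_ord i) n0.
  have le_t : i%:R * (T / n%:R) <= i.+1%:R * (T / n%:R).
    by rewrite ler_wpM2r ?ler_nat// divr_ge0 ?(ltW T0) ?(ltW nr).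
  rewrite subr_ge0 mG//= (le_trans (ler_norm _))// ltW// unif//.
  by rewrite -mulrBl -natrB// subSnn mul1r ger0_norm// divr_ge0 ?(ltW T0) ?(ltW nr).
rewrite sub0r normrN ger0_norm; last by apply: sumr_ge0 => i _; exact: sqr_ge0.
apply: (@le_trans _ _ (\sum_(i < n) e / V * (t i.+1 - t i))).
  apply: ler_sum => i _; have /andP[h1 h2] := tm i.
  by rewrite expr2 ler_wpM2r.
rewrite -mulr_sumr.
have -> : \sum_(i < n) (t i.+1 - t i) = t n - t 0%N.
  by rewrite -(big_mkord xpredT (fun i => t i.+1 - t i)) telescope_sumr.
rewrite /t mul0r mulrCA divff ?gt_eqF// mulr1 mulrAC ler_pdivrMr//.
by rewrite ler_wpM2l ?(ltW e0)// lerDl.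
Unshelve. all: by end_near. Qed.

End continuous_monotone.

(** * Finiteness of the number of jumps *)

Section finite_jumps.
Context {R : realType} {d : measure_display} {Omega : measurableType d}.
Variable P : probability Omega R.

Lemma measurable_nonzero n : measurable (@nonzero R n).
Proof.
rewrite (_ : nonzero = \bigcup_(i in setT) [set z : 'cV[R]_n | z i ord0 != 0]).
  apply: fin_bigcup_measurable => // i _.
  rewrite (_ : [set _ | _] = (fun z : 'cV[R]_n => z i ord0) @^-1` (~` [set 0])).
    by rewrite -[X in measurable X]setTI; apply: measurable_entry => //; exact: measurableC.
  by apply/seteqP; split => z /= /eqP.
apply/seteqP; split => z /=.
  move=> z0; have [i zi] : exists i, z i ord0 != 0.
    apply/existsP; apply: contraNT z0; rewrite negb_exists => /forallP h.
    by apply/eqP/matrixP => i j; rewrite (ord1 j) mxE; have := h i; rewrite negbK => /eqP.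
  by exists i.
by move=> [i _]; apply: contraNN => /eqP ->; rewrite mxE.
Qed.

(** By Tonelli the intensity is the length of []0, T]] times the total mass of [f]. *)
Lemma jump_intensity_lty n (f : 'cV[R]_n -> R) (T : R) :
  measurable_fun nonzero f -> (forall z, z != 0 -> 0 <= f z) ->
  (\int[@lebesgue_vec R n]_(z in nonzero) (f z)%:E < +oo)%E ->
  (jump_intensity f (`]0%R, T] `*` nonzero) < +oo)%E.
Proof.
move=> mf f0 fi; have mz := @measurable_nonzero n.
(* A product of functions on the whole space: [f] is only known off the origin, so it is extended by
   0. *)
pose g (sz : measurableTypeR R * 'cV[R]_n) : \bar R :=
  ((\1_(`]0, T]%classic : set R) sz.1)%:E * ((f \_ nonzero) sz.2)%:E)%E.
have fz0 z : 0 <= (f \_ nonzero) z.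
  by rewrite patchE; case: ifPn => //; rewrite inE => /f0.
have mfz : measurable_fun setT (f \_ nonzero) by exact/(measurable_restrictT _ mz).
have mg : measurable_fun setT g.
  apply: emeasurable_funM; apply/measurable_EFinP.
    have m1 : measurable_fun setT (\1_(`]0, T]%classic) : measurableTypeR R -> R).
      exact: measurable_indic.
    exact: (measurableT_comp m1 measurable_fst).
  exact: (measurableT_comp mfz measurable_snd).
have g0 sz : (0 <= g sz)%E by rewrite mule_ge0// lee_fin// indicE; case: (_ \in _).
have -> : jump_intensity f (`]0, T] `*` nonzero) =
    (\int[lebesgue_measure \x @lebesgue_vec R n]_sz g sz)%E.
  rewrite /jump_intensity (_ : _ `&` jump_domain = `]0%R, T]%classic `*` nonzero); last first.
    apply/seteqP; split => -[s z] /=; first by case.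
    rewrite in_itv/= => -[/andP[s0 sT] zn]; split; first by split => //=; rewrite s0.
    by split => //=; exact: ltW.
  rewrite integral_mkcond; apply: eq_integral => -[s z] _.
  rewrite /g !patchE /= in_setX indicE /=.
  by case: (s \in _); case: (z \in _); rewrite ?mul1e ?mul0e.
pose c := (\int[@lebesgue_vec R n]_(z in nonzero) (f z)%:E)%E.
have cE : (\int[@lebesgue_vec R n]_z ((f \_ nonzero) z)%:E = c)%E.
  rewrite /c [RHS]integral_mkcond; apply: eq_integral => z _.
  by rewrite !patchE; case: ifP.
have c0 : (0 <= c)%E by apply: integral_ge0 => z /f0; rewrite lee_fin.
rewrite (fubini_tonelli1 _ mg)// /fubini_F /g /=.
pose I1 (s : measurableTypeR R) : R := \1_(`]0, T]%classic : set R) s.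
have mI1 : measurable_fun setT I1 by exact: measurable_indic.
have I10 s : 0 <= I1 s by rewrite /I1 indicE; case: (_ \in _).
have inner (s : measurableTypeR R) :
    (\int[@lebesgue_vec R n]_z ((I1 s)%:E * ((f \_ nonzero) z)%:E) = (I1 s)%:E * c)%E.
  rewrite ge0_integralZl// ?lee_fin//; last 2 first.
  - exact/measurable_EFinP.
  - by move=> z _; rewrite lee_fin.
  by rewrite cE.
rewrite (eq_integral (fun s : measurableTypeR R => (I1 s)%:E * c)%E); last first.
  by move=> s _; exact: inner.
rewrite ge0_integralZr//; last 2 first.
- exact/measurable_EFinP.
- by move=> s _; rewrite lee_fin.
rewrite integral_indic// setIT lte_mul_pinfty//.
  rewrite ge0_fin_numE//; apply: (@le_lt_trans _ _ (lebesgue_measure `[0, T]%classic)).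
    by apply: le_measure; rewrite ?inE//; exact: subset_itv_oc_cc.
  by rewrite lebesgue_measure_itv/=; case: ifP => _; rewrite ?ltry// -EFinD ltry.
Qed.

(** The Poisson weights sum to 1 by the exponential series, so the finite values already carry the
    whole probability. *)
Lemma integer_valued_ae_lty (N : Omega -> \bar R) (a : R) :
  (forall w, (exists k : nat, N w = k%:R%:E) \/ N w = +oo%E) ->
  measurable_fun setT N ->
  (forall k : nat, P [set w | N w = k%:R%:E] =
     (a ^+ k / k`!%:R * expR (- a))%:E) ->
  {ae P, forall w, (N w < +oo)%E}.
Proof.
move=> Nint mN law.
pose S k := [set w | N w = (k%:R : R)%:E].
have mS k : measurable (S k).
  by rewrite -[S k]setTI; exact: (mN measurableT _ (emeasurable_set1 _)).
have tS : trivIset setT S.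
  apply/trivIsetP => i j _ _ ij; apply/seteqP; split => w //= [].
  by rewrite /S/= => -> [] /eqP; rewrite eqr_nat (negbTE ij).
have mU : measurable (\bigcup_k S k) by exact: bigcup_measurable.
have PU : P (\bigcup_k S k) = 1%E.
  have h1 := @measure_semi_sigma_additive _ _ _ P S mS tS mU.
  have h2 : (\sum_(0 <= i < n) P (S i))%E @[n --> \oo] --> (1%:E : \bar R).
    apply: cvg_EFin.
      by apply: nearW => n; rewrite (eq_bigr _ (fun k _ => law k)) sumEFin.
    have -> : fine \o (fun n => (\sum_(0 <= i < n) P (S i))%E) =
        (fun n => series (exp_coeff a) n * expR (- a)).
      apply/funext => n /=; rewrite (eq_bigr _ (fun k _ => law k)) sumEFin /=.
      by rewrite -mulr_suml.
    rewrite -(@expRxMexpNx_1 R a); apply: cvgM; last exact: cvg_cst.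
    exact: (is_cvg_series_exp_coeff a).
  exact: (cvg_unique _ h1 h2).
exists (~` \bigcup_k S k); split; first exact: measurableC.
  by rewrite probability_setC// PU subee.
move=> w /= Nw; have [[k Nk]|Noo] := Nint w.
  by exfalso; apply: Nw; rewrite Nk ltry.
by move=> [k _]; rewrite /S/= Noo.
Qed.

End finite_jumps.

(** * Pathwise estimates of drift and jumps *)

Section path.
Context {R : realType}.
Notation leb := (@lebesgue_measure R).

(** [G t] is the integral of [|b|] up to [t]; its continuity is that of the indefinite integral. *)
Lemma integral_dominator (T : R) (b : R -> R) : 0 < T ->
  leb.-integrable `]0, T] (EFin \o b) ->
  exists G : R -> R, [/\ {within `[0, T], continuous G},
    {in `[0, T] &, {homo G : x y / x <= y}} &
    forall s t, s \in `[0, T] -> t \in `[0, T] -> s <= t ->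
      `|(\int[leb]_(x in `]s, t]) b x)%R| <= G t - G s].
Proof.
move=> T0 bi; pose f := (fun x => `|b x|) \_ `]0, T]%classic.
have fi : leb.-integrable setT (EFin \o f).
  have := integrable_norm bi; rewrite integrable_mkcond ?restrict_EFin//.
pose G t := (\int[leb]_(x in `[0, t]) f x)%R.
have fiS (A : set R) : measurable A -> leb.-integrable A (EFin \o f).
  by move=> mA; apply: (integrableS measurableT).
have GB s t : 0 <= s -> s <= t -> G t - G s = (\int[leb]_(x in `]s, t]) f x)%R.
  move=> s0 st; apply: (@Rintegral_itvB _ f (BLeft 0) (BRight t) s); rewrite ?bnd_simp//.
  exact: fiS.
exists G; split.
- apply: parameterized_integral_continuous; first exact: ltW.
  exact: fiS.
- move=> x y; rewrite !in_itv/= => /andP[x0 _] _ xy; rewrite -subr_ge0 GB//.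
  apply: Rintegral_ge0 => z _; rewrite /f patchE; by case: ifP.
- move=> s t; rewrite !in_itv/= => /andP[s0 _] /andP[_ tT] st; rewrite GB//.
  have st0 : `]s, t]%classic `<=` `]0, T]%classic.
    by apply: subset_itv; rewrite bnd_simp.
  have bst : leb.-integrable `]s, t] (EFin \o b) by apply: integrableS bi => //; exact: measurable_itv.
  apply: (le_trans (le_normr_Rintegral _ bst)) => //.
  rewrite le_eqVlt; apply/orP; left; apply/eqP; apply: eq_Rintegral => x.
  by rewrite inE => /st0 xT; rewrite /f patchE mem_set.
Qed.

(** The two integrals differ by one over a null set. Over a cell without points, the jump terms of
    the equation therefore cancel. *)
Lemma jump_integral_const n (m : {measure set (measurableTypeR R * 'cV[R]_n)%type -> \bar R})
    (g : measurableTypeR R * 'cV[R]_n -> R) (s t : R) : 0 <= s -> s <= t ->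
  m.-integrable (`]0, t] `*` nonzero) (EFin \o g) ->
  m (`]s, t] `*` nonzero) = 0%E ->
  (\int[m]_(x in `]0%R, t] `*` nonzero) g x)%R = (\int[m]_(x in `]0%R, s] `*` nonzero) g x)%R.
Proof.
move=> s0 st gi m0; have mz := @measurable_nonzero R n.
have E : `]0%R, t]%classic `*` @nonzero R n = (`]0%R, s] `*` nonzero) `|` (`]s, t] `*` nonzero).
  apply/seteqP; split => -[x z] /=; rewrite !in_itv/=.
    by move=> [/andP[x0 xt] zn]; have [xs|sx] := leP x s; [left|right]; rewrite ?x0 ?xt.
  move=> [[/andP[x0 xs] zn]|[/andP[sx xt] zn]]; split => //.
    by rewrite x0 (le_trans xs).
  by rewrite xt (le_lt_trans s0 sx).
rewrite E in gi *; rewrite Rintegral_setU//; last 3 first.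
- exact: measurableX.
- exact: measurableX.
- apply/disj_setPS => -[x z] /= [[+ _] [+ _]]; rewrite !in_itv/=.
  by move=> /andP[_ xs] /andP[sx _]; move: (lt_le_trans sx xs); rewrite ltxx.
suff -> : (\int[m]_(x in `]s, t] `*` nonzero) g x)%R = 0 by rewrite addr0.
have mS : measurable (`]s, t]%classic `*` @nonzero R n) by exact: measurableX.
have giS : m.-integrable (`]s, t] `*` nonzero) (EFin \o g).
  apply: integrableS gi => //.
  by apply: measurableU => //; exact: measurableX.
by rewrite /Rintegral null_set_integral//; exact: measurable_int giS.
Qed.

Lemma sum_jumps_le n (m : {measure set (measurableTypeR R * 'cV[R]_n)%type -> \bar R})
    (t : nat -> R) (N : nat) :
  (forall i, 0 <= t i) -> (forall i, t i <= t i.+1) ->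
  (\sum_(i < N) m (`]t i, t i.+1] `*` nonzero) <= m (`]0%R, t N] `*` nonzero))%E.
Proof.
move=> t0 tS; have mz := @measurable_nonzero R n.
elim: N => [|N IH]; first by rewrite big_ord0.
rewrite big_ord_recr/=; apply: (le_trans (leeD2r _ IH)).
rewrite -measureU//; last 3 first.
- exact: measurableX.
- exact: measurableX.
- apply/seteqP; split => -[x z] //= [[+ _] [+ _]]; rewrite !in_itv/=.
  by move=> /andP[_ xs] /andP[sx _]; move: (lt_le_trans sx xs); rewrite ltxx.
apply: le_measure; rewrite ?inE.
- by apply: measurableU; exact: measurableX.
- exact: measurableX.
- move=> [x z] /=; rewrite !in_itv/= => -[[/andP[h1 h2] h3]|[/andP[h1 h2] h3]]; split => //.
    by rewrite h1 (le_trans h2).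
  by rewrite h2 (le_lt_trans _ h1).
Qed.

End path.

(** * Truncated increments *)

Section truncation.
Context {R : realType} {p : nat}.
Implicit Types x a b : 'cV[R]_p.

Definition sqn x : R := \sum_u x u ord0 ^+ 2.

Lemma sqn_ge0 x : 0 <= sqn x.
Proof. by apply: sumr_ge0 => u _; exact: sqr_ge0. Qed.

Lemma sqn0 : sqn 0 = 0.
Proof. by rewrite /sqn big1// => u _; rewrite mxE expr0n. Qed.

Lemma sqr_entry_le x u : x u ord0 ^+ 2 <= sqn x.
Proof.
by rewrite /sqn (bigD1 u)//= lerDl; apply: sumr_ge0 => v _; exact: sqr_ge0.
Qed.

Lemma frob_le x (c : R) : 0 <= c -> (frob x <= c) = (sqn x <= c ^+ 2).
Proof.
move=> c0; have -> : frob x = Num.sqrt (sqn x).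
  rewrite /frob mxtrace_mulT; congr Num.sqrt; apply: eq_bigr => i _.
  by rewrite big_ord1.
by rewrite -[X in _ <= X](ger0_norm c0) -sqrtr_sqr ler_sqrt// sqr_ge0.
Qed.

Lemma normr_entryM_le x u v : `|x u ord0 * x v ord0| <= sqn x.
Proof.
rewrite normrM; apply: (le_trans (normrM_le_half_sqr _ _)).
by have := sqr_entry_le x u; have := sqr_entry_le x v; lra.
Qed.

Lemma sqnD_le a b : sqn (a + b) <= 2 * (sqn a + sqn b).
Proof.
rewrite /sqn -big_split mulr_sumr; apply: ler_sum => u _; rewrite mxE/=.
by have := sqr_ge0 (a u ord0 - b u ord0); lra.
Qed.

Section one_increment.
Variables (x a : 'cV[R]_p) (jump : bool) (c eta : R).
Hypotheses (c0 : 0 < c) (eta0 : 0 < eta).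
Let keep := sqn x <= c.
Let b : 'cV[R]_p := if jump then 0 else x - a.

(** An increment truncated without a jump has [c < sqn x <= 2 (sqn a + sqn b)]. Either
    [sqn a >= c / 4], and then [c <= 16 (sqn a)^2 / c], or [sqn b > c / 4]. *)
Lemma bad_increment_le : c * (jump || ~~ keep)%:R <=
  c * jump%:R + 16 * (sqn a ^+ 2 / c) + 4 * sqn b.
Proof.
have q0 : 0 <= sqn a ^+ 2 / c by rewrite divr_ge0 ?sqr_ge0// ltW.
have b0 := sqn_ge0 b; rewrite /b in b0 *; case: (jump) b0 => /= b0; first by lra.
rewrite /keep; have [xc|xc] := leP (sqn x) c; first by rewrite mulr0; lra.
rewrite mulr1 mulr0 add0r; have := sqnD_le a (x - a); rewrite addrC subrK => h.
have [ha|ha] := leP (c / 4) (sqn a); last by lra.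
have : c <= 16 * (sqn a ^+ 2 / c).
  have c40 : 0 <= c / 4 by rewrite divr_ge0// ltW.
  have := ler_pM c40 c40 ha ha.
  by rewrite mulrA ler_pdivlMr// expr2; lra.
lra.
Qed.

(** In a cell with a jump or a truncation, the kept product is at most [c] and occurs only with a
    jump, while [2 sqn a <= c + (sqn a)^2 / c] and [bad_increment_le] bounds [c]. In the other cells
    Young's inequality splits the cross terms: [eta] weighs [sqn a], whose sum stays bounded, and
    [eta^-1] weighs [sqn b], whose sum tends to 0. *)
Lemma truncated_entry_le u v :
  `|keep%:R * (x u ord0 * x v ord0) - a u ord0 * a v ord0| <=
  2 * c * jump%:R + 9 * (sqn a ^+ 2 / c) + (3 + eta^-1) * sqn b + eta * sqn a.
Proof.
have bad := bad_increment_le.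
have q0 : 0 <= sqn a ^+ 2 / c by rewrite divr_ge0 ?sqr_ge0// ltW.
have a0 := sqn_ge0 a; have au := normr_entryM_le a u v.
have ea : 0 <= eta * sqn a by rewrite mulr_ge0// ltW.
have e10 : 0 < eta^-1 by rewrite invr_gt0.
have b0 := sqn_ge0 b.
have eb : 0 <= eta^-1 * sqn b by rewrite mulr_ge0// ltW.
have aq : 2 * sqn a <= c + sqn a ^+ 2 / c.
  rewrite -subr_ge0 (_ : _ - _ = (sqn a - c) ^+ 2 / c); last by field; rewrite gt_eqF.
  by rewrite divr_ge0 ?sqr_ge0// ltW.
have cJ : 0 <= c * jump%:R by rewrite mulr_ge0// ltW.
case E : (jump || ~~ keep).
  have h1 : `|keep%:R * (x u ord0 * x v ord0)| <= c * jump%:R.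
    move: E; rewrite /keep; have [xc|xc] := leP (sqn x) c.
      by rewrite orbF => ->; rewrite mul1r mulr1 (le_trans (normr_entryM_le x u v)).
    by move=> _; rewrite mul0r normr0 mulr_ge0// ltW.
  have := ler_normB (keep%:R * (x u ord0 * x v ord0)) (a u ord0 * a v ord0).
  by move: bad; rewrite E mulr1; lra.
move/negbT: E; rewrite negb_or negbK => /andP[nj ->].
rewrite mul1r; rewrite /b (negbTE nj) in b0 eb bad *.
have -> : x u ord0 * x v ord0 - a u ord0 * a v ord0 = a u ord0 * (x - a) v ord0 +
  (x - a) u ord0 * a v ord0 + (x - a) u ord0 * (x - a) v ord0 by rewrite !mxE; ring.
set e := x - a in b0 eb *.
have cross s t : `|a s ord0 * e t ord0| <= 2^-1 * (eta * sqn a + eta^-1 * sqn e).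
  rewrite normrM; apply: (@le_trans _ _ (2^-1 * (eta * a s ord0 ^+ 2 + eta^-1 * e t ord0 ^+ 2))).
    have := sqr_ge0 (eta * `|a s ord0| - `|e t ord0|).
    rewrite -(real_normK (num_real (a s ord0))) -(real_normK (num_real (e t ord0))).
    set A := `|a s ord0|; set B := `|e t ord0| => h.
    rewrite -subr_ge0 (_ : _ - _ = (eta * A - B) ^+ 2 * (2^-1 * eta^-1)); last first.
      by field; rewrite gt_eqF.
    by rewrite mulr_ge0// mulr_ge0// ltW.
  by rewrite ler_wpM2l// lerD// ler_wpM2l ?sqr_entry_le// ltW.
have c1 := cross u v; have c2 := cross v u; rewrite (mulrC (a v ord0)) in c2.
have c3 := normr_entryM_le e u v.
have n1 := ler_normD (a u ord0 * e v ord0 + e u ord0 * a v ord0) (e u ord0 * e v ord0).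
have n2 := ler_normD (a u ord0 * e v ord0) (e u ord0 * a v ord0).
have j0 : 0 <= 2 * c * jump%:R by rewrite (negbTE nj) mulr0.
rewrite [(3 + _) * _]mulrDl /= mulr0; clear cross; lra.
Qed.

End one_increment.
End truncation.

(** * Realised covariance of the Gaussian part *)

Section noise.
Context {R : realType} {d : measure_display} {Omega : measurableType d}.
Variables (P : probability Omega R) (Ft : R -> set (set Omega)).
Local Notation L1 f := (P.-integrable setT (EFin \o f)).
Local Notation E f := (\int[P]_w f w)%R.
Hypothesis hF : filtration Ft.
Variables (r : 'I_4 -> nat) (W : forall k, R -> Omega -> 'cV[R]_(r k)).
Hypothesis hW : forall k, wiener P Ft (W k).
Local Notation increments V :=
  <<s \bigcup_(u in [set u : R | 0 <= u]) sigma_of (fun w => V u w - V 0 w) >>.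
Hypothesis WW : forall k l, k != l -> forall A B,
  increments (W k) A -> increments (W l) B -> P (A `&` B) = (P A * P B)%E.
Variables (T : R) (T0 : 0 < T).

Let I : finType := {k : 'I_4 & 'I_(r k)}.
(** Dependent pairs of a process and a coordinate concatenate the four Wiener processes into a
    single noise vector. *)
Definition gnoise (n i : nat) (c : {k : 'I_4 & 'I_(r k)}) : Omega -> R :=
  ginc (W (tag c)) (T / n%:R) i (tagged c).

Let h0 n : (0 < n)%N -> 0 < T / n%:R.
Proof. by move=> n0; rewrite divr_gt0// ltr0n. Qed.

Let cvg_invn : (n%:R^-1 : R) @[n --> \oo] --> (0 : R).
Proof.
apply/cvgrPdist_lt => e e0; near=> n.
have ne : e^-1 < n%:R by near: n; exact: nbhs_infty_gtr.
have n0 : 0 < n%:R :> R by rewrite (lt_trans _ ne)// invr_gt0.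
by rewrite sub0r normrN gtr0_norm ?invr_gt0// -(invrK e) ltf_pV2 ?posrE ?invr_gt0.
Unshelve. all: by end_near. Qed.

Lemma gnoise_second_moment n c c' : (0 < n)%N ->
  let U (i : 'I_n) w := gnoise n i c w * gnoise n i c' w - (c == c')%:R * (T / n%:R) in
  L1 (fun w => (\sum_i U i w) ^+ 2) /\
  E (fun w => (\sum_i U i w) ^+ 2) <= n%:R * (64 * (T / n%:R) ^+ 2).
Proof.
case: c c' => k a [l b] /h0 hn.
have [kl|kl] := eqVneq k l.
  case: l / kl b => b U; rewrite /U eq_Tagged /=.
  exact: (sum_ginc_same hF (hW k) hn).
move=> U; suff -> : U = fun (i : 'I_n) w => ginc (W k) (T / n%:R) i a w * ginc (W l) (T / n%:R) i b w.
  exact: (sum_ginc_diff hF (hW k) (hW l) hn (WW kl)).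
apply/funext => i; apply/funext => w; rewrite /U.
have -> : (existT (fun k => 'I_(r k)) k a == existT (fun k => 'I_(r k)) l b) = false.
  by apply/negbTE; apply: contra_neq kl => /(congr1 tag).
by rewrite mul0r subr0.
Qed.

(** Chebyshev's inequality: the centred sum has second moment at most
    [n * 64 (T / n)^2 = 64 T^2 / n]. *)
Lemma gnoise_pair_whp c c' (e : R) : 0 < e ->
  whp P (fun n => [set w | `|\sum_(i < n) (gnoise n i c w * gnoise n i c' w) -
    (c == c')%:R * T| < e]).
Proof.
move=> e0; have e20 : 0 < e ^+ 2 by rewrite exprn_gt0.
have b0 : (64 * T ^+ 2 * n%:R^-1) @[n --> \oo] --> (0 : R).
  by rewrite -[X in _ --> X](mulr0 (64 * T ^+ 2)); apply: cvgM => //; exact: cvg_cst.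
have := @whp_L1 _ _ _ P (fun n w => (\sum_(i < n) (gnoise n i c w * gnoise n i c' w -
  (c == c')%:R * (T / n%:R))) ^+ 2) _ _ (fun n w => sqr_ge0 _) _ b0 e20.
move=> H; apply: (whp_sub (H _)).
  near=> n; have n0 : (0 < n)%N by near: n; exact: nbhs_infty_gt.
  have nr : n%:R != 0 :> R by rewrite pnatr_eq0 -lt0n.
  have [h1 h2] := gnoise_second_moment c c' n0; split => //.
  by apply: (le_trans h2); rewrite le_eqVlt; apply/orP; left; apply/eqP; field.
near=> n => w /=; have n0 : (0 < n)%N by near: n; exact: nbhs_infty_gt.
have nr : n%:R != 0 :> R by rewrite pnatr_eq0 -lt0n.
rewrite sumrB sumr_const card_ord -[(_ * _) *+ n]mulr_natl.
rewrite (_ : n%:R * _ = (c == c')%:R * T); last by field.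
rewrite -[X in X < _](real_normK (num_real _)).
by rewrite ltr_pXn2r ?nnegrE ?(ltW e0).
Unshelve. all: by end_near. Qed.

Variables (p : nat) (beta : 'I_p -> {k : 'I_4 & 'I_(r k)} -> R).

Definition noise (n i : nat) (w : Omega) : 'cV[R]_p :=
  \col_u \sum_c beta u c * gnoise n i c w.

Lemma gram_whp (e : R) : 0 < e ->
  whp P (fun n => [set w | forall uv : 'I_p * 'I_p,
    `|\sum_(i < n) (noise n i w uv.1 ord0 * noise n i w uv.2 ord0) -
      T * \sum_c beta uv.1 c * beta uv.2 c| < e]).
Proof.
move=> e0; apply: whp_all => -[u v] /=.
pose L := \sum_c \sum_c' `|beta u c * beta v c'|.
have L0 : 0 <= L by apply: sumr_ge0 => c _; exact: sumr_ge0.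
(* [L + 1], because [L] may vanish. *)
have L10 : 0 < L + 1 by rewrite ltr_wpDl.
have eL : 0 < e / (L + 1) by rewrite divr_gt0.
have := whp_all (fun cc : I * I => gnoise_pair_whp cc.1 cc.2 eL).
move=> H; apply: (whp_sub H); apply: nearW => n w /= Hw.
have -> : \sum_(i < n) (noise n i w u ord0 * noise n i w v ord0) -
    T * \sum_c beta u c * beta v c =
  \sum_c \sum_c' beta u c * beta v c' *
    (\sum_(i < n) (gnoise n i c w * gnoise n i c' w) - (c == c')%:R * T).
  have key (c : I) : \sum_c' beta u c * beta v c' * ((c == c')%:R * T) = beta u c * beta v c * T.
    rewrite (bigD1 c)//= eqxx mul1r big1 ?addr0// => c' c'c.
    by rewrite eq_sym (negbTE c'c) mul0r mulr0.
  under [RHS]eq_bigr => c _.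
    under eq_bigr do rewrite mulrBr.
    rewrite sumrB key.
    over.
  rewrite sumrB -mulr_suml (mulrC T); congr (_ - _).
  under eq_bigr => i _.
    rewrite !mxE mulr_suml.
    under eq_bigr do rewrite mulr_sumr.
    over.
  rewrite exchange_big/=; apply: eq_bigr => c _.
  rewrite exchange_big/=; apply: eq_bigr => c' _.
  by rewrite mulr_sumr; apply: eq_bigr => i _; ring.
apply: (@le_lt_trans _ _ (L * (e / (L + 1)))); last first.
  by rewrite mulrA ltr_pdivrMr// mulrC ltr_pM2l// ltrDl.
rewrite /L mulr_suml; apply: (le_trans (ler_norm_sum _ _ _)); apply: ler_sum => c _.
rewrite mulr_suml; apply: (le_trans (ler_norm_sum _ _ _)); apply: ler_sum => c' _.
by rewrite normrM ler_wpM2l// ltW//; exact: (Hw (c, c')).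
Qed.

Lemma sqr_sum_le (J : finType) (y : J -> R) :
  (\sum_j y j) ^+ 2 <= #|J|%:R * \sum_j y j ^+ 2.
Proof.
rewrite expr2 mulr_suml.
apply: (@le_trans _ _ (\sum_i \sum_j 2^-1 * (y i ^+ 2 + y j ^+ 2))).
  apply: ler_sum => i _; rewrite mulr_sumr; apply: ler_sum => j _.
  by have := sqr_ge0 (y i - y j); lra.
rewrite le_eqVlt; apply/orP; left; apply/eqP.
set S := \sum_j y j ^+ 2.
have inner i : \sum_j 2^-1 * (y i ^+ 2 + y j ^+ 2) = 2^-1 * (#|J|%:R * y i ^+ 2 + S).
  by rewrite -mulr_sumr big_split/= sumr_const mulr_natl.
rewrite (eq_bigr _ (fun i _ => inner i)) -mulr_sumr big_split/= sumr_const -mulr_sumr.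
by rewrite -/S -[S *+ _]mulr_natl; field.
Qed.

Lemma sqn_noise_sqr_le : exists2 kap : R, 0 <= kap & forall n i w,
  sqn (noise n i w) ^+ 2 <= kap * \sum_c gnoise n i c w ^+ 4.
Proof.
pose b := \sum_u \sum_c beta u c ^+ 4.
have b4 u c : beta u c ^+ 4 <= b.
  rewrite /b (bigD1 u)//= (bigD1 c)//= -addrA lerDl addr_ge0//.
    by apply: sumr_ge0 => ? _; rewrite exprn_even_ge0.
  by apply: sumr_ge0 => ? _; apply: sumr_ge0 => ? _; rewrite exprn_even_ge0.
have b0 : 0 <= b by apply: sumr_ge0 => ? _; apply: sumr_ge0 => ? _; rewrite exprn_even_ge0.
pose N := (#|I|%:R : R).
(* Cauchy-Schwarz over the [p] coordinates, whose sum gives a second [p], and twice over the [N]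
   noises, which gives [N^2] and [N]; [b] bounds the fourth powers of the coefficients. *)
exists (p%:R * (p%:R * (N ^+ 3 * b))); first by rewrite mulr_ge0// mulr_ge0// mulr_ge0// exprn_ge0.
move=> n i w; have E4 (y : R) : y ^+ 4 = (y ^+ 2) ^+ 2 by rewrite -exprM.
set S4 := \sum_c gnoise n i c w ^+ 4.
have -> : p%:R * (p%:R * (N ^+ 3 * b)) * S4 = p%:R * (p%:R * (N ^+ 3 * b * S4)) by ring.
apply: (le_trans (sqr_sum_le _)); rewrite card_ord ler_wpM2l//.
apply: (@le_trans _ _ (\sum_(u < p) N ^+ 3 * b * S4)); last first.
  by rewrite sumr_const card_ord mulr_natl.
apply: ler_sum => u _; rewrite mxE.
apply: (@le_trans _ _ ((N * \sum_c (beta u c * gnoise n i c w) ^+ 2) ^+ 2)).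
  have h1 := sqr_ge0 (\sum_c beta u c * gnoise n i c w).
  have h2 := sqr_sum_le (fun c => beta u c * gnoise n i c w).
  by apply: lerXn2r => //; rewrite nnegrE// (le_trans h1).
have -> : N ^+ 3 * b * S4 = N ^+ 2 * (N * (b * S4)) by ring.
rewrite exprMn ler_wpM2l ?sqr_ge0//.
apply: (le_trans (sqr_sum_le _)); rewrite ler_wpM2l// mulr_sumr.
by apply: ler_sum => c _; rewrite -E4 exprMn ler_wpM2r// exprn_even_ge0.
Qed.

(** Markov's inequality with fourth moments of order [(T / n)^2]: the expectation of the sum is of
    order [T (T / n) / th n]. *)
Lemma quartic_whp (th : nat -> R) (e : R) : (forall n, (0 < n)%N -> 0 < th n) ->
  (T / n%:R / th n @[n --> \oo] --> (0 : R)) -> 0 < e ->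
  whp P (fun n => [set w | \sum_(i < n) sqn (noise n i w) ^+ 2 / th n < e]).
Proof.
move=> th0 hth e0; have [kap kap0 kapE] := sqn_noise_sqr_le.
(* The absolute value makes [Z] nonnegative at [n = 0] too, where nothing is known of [th]. *)
pose Z n w : R := \sum_(i < n) `|th n|^-1 * (kap * \sum_c gnoise n i c w ^+ 4).
pose N := (#|I|%:R : R).
have b0 : (kap * N * 64 * T * (T / n%:R / th n)) @[n --> \oo] --> (0 : R).
  by rewrite -[X in _ --> X](mulr0 (kap * N * 64 * T)); apply: cvgM => //; exact: cvg_cst.
have Z0 n w : 0 <= Z n w.
  apply: sumr_ge0 => i _; rewrite mulr_ge0 ?invr_ge0// mulr_ge0// sumr_ge0// => c _.
  by rewrite exprn_even_ge0.
apply: (@whp_sub _ _ _ P (fun n => [set w | Z n w < e])).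
  apply: (whp_L1 Z0 _ b0 e0).
  near=> n; have n0 : (0 < n)%N by near: n; exact: nbhs_infty_gt.
  have nr : n%:R != 0 :> R by rewrite pnatr_eq0 -lt0n.
  have g4 i c : L1 (fun w => gnoise n i c w ^+ 4).
    by apply: (ginc_expr_L1 hF (hW _)) => //; exact: h0.
  have s4 i : L1 (fun w => \sum_c gnoise n i c w ^+ 4) by apply: L1_sum.
  have k4 i : L1 (fun w => kap * \sum_c gnoise n i c w ^+ 4) by apply: L1Z.
  have t4 i : L1 (fun w => `|th n|^-1 * (kap * \sum_c gnoise n i c w ^+ 4)) by apply: L1Z.
  split; first by apply: L1_sum.
  rewrite /Z ev_sum//.
  apply: (@le_trans _ _ (\sum_(i < n) (th n)^-1 * (kap * (N * (64 * (T / n%:R) ^+ 2))))).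
    apply: ler_sum => i _; rewrite RintegralZl// RintegralZl// (gtr0_norm (th0 n n0)).
    rewrite ler_wpM2l ?invr_ge0 ?(ltW (th0 n n0))// ler_wpM2l// ev_sum//.
    rewrite /N mulr_natl -sumr_const; apply: ler_sum => c _.
    by apply: (ginc_expr4 hF (hW _)); exact: h0.
  rewrite sumr_const card_ord -mulr_natl le_eqVlt; apply/orP; left; apply/eqP.
  by field; rewrite nr gt_eqF// th0.
near=> n => w /=; have n0 : (0 < n)%N by near: n; exact: nbhs_infty_gt.
apply: le_lt_trans; apply: ler_sum => i _.
rewrite mulrC gtr0_norm ?th0// ler_wpM2l ?kapE// invr_ge0 ltW// th0//.
Unshelve. all: by end_near. Qed.

End noise.

(** * Realised covariance of the observation *)

Section system.
Context {R : realType} {d : measure_display} {Omega : measurableType d}.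
Variables (P : probability Omega R) (Ft : R -> set (set Omega)).
Hypothesis hF : filtration Ft.
Variables (p : nat) (dim r : 'I_4 -> nat).
Variables (W : forall k, R -> Omega -> 'cV[R]_(r k))
  (mu : forall k, Omega ->
     {measure set (measurableTypeR R * 'cV[R]_(dim k))%type -> \bar R})
  (Y : forall k, R -> Omega -> 'cV[R]_(dim k))
  (a : forall k, 'cV[R]_(dim k) -> 'cV[R]_(dim k))
  (c : forall k, 'cV[R]_(dim k) -> 'cV[R]_(dim k) -> 'cV[R]_(dim k))
  (x0 : forall k, 'cV[R]_(dim k))
  (f : forall k, 'cV[R]_(dim k) -> R)
  (S : forall k, 'M[R]_(dim k, r k)) (C : forall k, 'M[R]_(p, dim k)).
Hypothesis hW : forall k, wiener P Ft (W k).
Hypothesis hmu : forall k, poisson_random_measure P Ft (@f k) (mu k).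
Hypothesis hf : forall k, [/\ measurable_fun nonzero (@f k),
  forall z, z != 0 -> 0 <= @f k z &
  (\int[@lebesgue_vec R (dim k)]_(z in nonzero) (@f k z)%:E < +oo)%E].
Hypothesis hY : forall k, jump_sde P (@a k) (S k) (@c k) (x0 k) (W k) (mu k) (Y k).
Variables (T : R) (T0 : 0 < T).
Variable X : R -> Omega -> 'cV[R]_p.
Hypothesis hX : forall t w, 0 <= t -> X t w = \sum_k C k *m Y k t w.

Definition volatility (u : 'I_p) (e : {k : 'I_4 & 'I_(r k)}) : R :=
  (C (tag e) *m S (tag e)) u (tagged e).

Local Notation t n i := (i%:R * (T / n%:R)).
Local Notation eps := (noise W T volatility).

Definition jumped (n i : nat) (w : Omega) : bool :=
  [exists k, mu k w (`]t n i, t n i.+1] `*` nonzero) != 0%E].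

(** Set to 0 in cells with a jump, where only the truncation controls the increment; in the others
    it is the contribution of the drift. *)
Definition resid (n i : nat) (w : Omega) : 'cV[R]_p :=
  if jumped n i w then 0 else incr (X ^~ w) (T / n%:R) i - eps n i w.

Let t_ge0 n i : 0 <= t n i.
Proof. by rewrite mulr_ge0// divr_ge0// ltW. Qed.

Let t_le n i : t n i <= t n i.+1.
Proof. by rewrite ler_wpM2r ?ler_nat// divr_ge0// ltW. Qed.

Lemma noiseE n i w :
  eps n i w = \sum_k C k *m (S k *m (W k (t n i.+1) w - W k (t n i) w)).
Proof.
apply/matrixP => u j; rewrite (ord1 j) mxE summxE.
rewrite -(sig_big_dep xpredT (fun=> xpredT) (fun k b => (C k *m S k) u b *
  (W k (t n i.+1) w - W k (t n i) w) b ord0)) /=.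
by apply: eq_bigr => k _; rewrite mulmxA mxE.
Qed.

(** The measures are integer valued, so a cell with a jump has mass at least 1 for one of them, and
    the masses of the cells add up to at most that of []0, T]]. The bound [K] depends on the path
    and not on [n]. *)
Lemma jump_count_ae_fin : {ae P, forall w, exists K : R, forall n, (0 < n)%N ->
  \sum_(i < n) (jumped n i w)%:R <= K}.
Proof.
have mA k : measurable (`]0%R, T]%classic `*` @nonzero R (dim k)).
  by apply: measurableX => //; exact: measurable_nonzero.
have fin k : {ae P, forall w, (mu k w (`]0%R, T] `*` nonzero) < +oo)%E}.
  have [_ mint mmeas law _] := hmu k; have [mf f0 fi] := hf k.
  have lt := jump_intensity_lty T mf f0 fi.
  apply: (integer_valued_ae_lty (a := fine (jump_intensity (@f k) (`]0%R, T] `*` nonzero)))).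
  - by move=> w; exact: (mint w _ (mA k)).
  - exact: (mmeas _ (mA k)).1.
  - by move=> m; exact: ((law _ (mA k)).1 lt m).
have finA : {ae P, forall w k, (mu k w (`]0%R, T] `*` nonzero) < +oo)%E}.
  by apply: filter_forall => k; exact: fin.
apply: filterS finA => w finw.
exists (\sum_k fine (mu k w (`]0%R, T] `*` nonzero))) => n n0.
have nr : n%:R != 0 :> R by rewrite pnatr_eq0 -lt0n.
have tn : t n n = T by field.
have sub k (i : nat) : (i < n)%N ->
    (mu k w (`]t n i, t n i.+1] `*` nonzero) <= mu k w (`]0%R, T] `*` nonzero))%E.
  have mAi : measurable (`]t n i, t n i.+1]%classic `*` @nonzero R (dim k)).
    by apply: measurableX => //; exact: measurable_nonzero.
  move=> iN; apply: le_measure; rewrite ?inE//; first exact: mA.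
  move=> [s z] /=; rewrite !in_itv/= => -[/andP[s1 s2] zn]; split => //.
  rewrite (le_lt_trans (t_ge0 n i) s1) (le_trans s2)// -[leRHS]tn.
  by rewrite ler_wpM2r ?ler_nat// divr_ge0// ltW.
have fin_i k (i : nat) : (i < n)%N ->
    mu k w (`]t n i, t n i.+1] `*` nonzero) \is a fin_num.
  by move=> iN; rewrite ge0_fin_numE// (le_lt_trans (sub k i iN) (finw k)).
apply: (@le_trans _ _ (\sum_(i < n) \sum_k fine (mu k w (`]t n i, t n i.+1] `*` nonzero)))).
  apply: ler_sum => i _; rewrite /jumped; case: existsP => [[k hk]|_]; last first.
    by apply: sumr_ge0 => k _; rewrite fine_ge0.
  rewrite (bigD1 k)//= -[leLHS]addr0 lerD//; last by apply: sumr_ge0 => l _; rewrite fine_ge0.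
  have [_ mint _ _ _] := hmu k.
  have mAi : measurable (`]t n i, t n i.+1]%classic `*` @nonzero R (dim k)).
    by apply: measurableX => //; exact: measurable_nonzero.
  have [[m hm]|hoo] := mint w _ mAi; last by have := fin_i k i (ltn_ord i); rewrite hoo.
  by move: hk; rewrite hm/= eqe pnatr_eq0 -lt0n ler1n.
rewrite exchange_big/=; apply: ler_sum => k _.
rewrite -lee_fin -sumEFin fineK ?ge0_fin_numE//.
rewrite (eq_bigr (fun i : 'I_n => mu k w (`]t n i, t n i.+1] `*` nonzero))); last first.
  by move=> i _; rewrite fineK// fin_i.
by have := sum_jumps_le (mu k w) n (t_ge0 n) (t_le n); rewrite tn.
Qed.

(** The difference of the integral equations at [v] and [s]: without points in between the jump
    integrals agree, and the drift integral is left. *)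
Lemma path_increment : {ae P, forall w, exists G : {k : 'I_4 & 'I_(dim k)} -> R -> R,
  forall e, [/\ {within `[0, T], continuous (G e)},
    {in `[0, T] &, {homo G e : x y / x <= y}} &
    forall s v, 0 <= s -> s <= v -> v <= T ->
      mu (tag e) w (`]s, v] `*` nonzero) = 0%E ->
      `|(Y (tag e) v w - Y (tag e) s w
        - S (tag e) *m (W (tag e) v w - W (tag e) s w)) (tagged e) ord0| <= G e v - G e s]}.
Proof.
have Fae : Filter (nbhs (almost_everywhere P)) by exact: ae_filter_ringOfSetsType.
apply: filterS (filter_forall Fae hY) => w hw.
suff /choice[G GP] : forall e : {k : 'I_4 & 'I_(dim k)}, exists G : R -> R,
   [/\ {within `[0, T], continuous G},
    {in `[0, T] &, {homo G : x y / x <= y}} &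
    forall s v, 0 <= s -> s <= v -> v <= T ->
      mu (tag e) w (`]s, v] `*` nonzero) = 0%E ->
      `|(Y (tag e) v w - Y (tag e) s w
        - S (tag e) *m (W (tag e) v w - W (tag e) s w)) (tagged e) ord0| <= G v - G s].
  by exists G.
move=> [k j] /=; have [_ /(_ _) sde] := hw k.
have [bi _ _] := sde T (ltW T0) j.
have [G [cG mG dG]] := integral_dominator T0 bi.
exists G; split => // s v s0 sv vT m0.
have v0 := le_trans s0 sv.
have [bv jv Yv] := sde v v0 j; have [_ _ Ys] := sde s s0 j.
have Is : s \in `[0, T] by rewrite in_itv/= s0 (le_trans sv).
have Iv : v \in `[0, T] by rewrite in_itv/= v0.
apply: le_trans (dG s v Is Iv sv).
rewrite le_eqVlt; apply/orP; left; apply/eqP; congr (`|_|).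
have B := @Rintegral_itvB R _ (BRight 0) (BRight v) s bv.
rewrite -B ?bnd_simp//.
have J := jump_integral_const s0 sv jv m0.
have entryB (A B' : 'cV[R]_(dim k)) : (A - B') j ord0 = A j ord0 - B' j ord0 by rewrite !mxE.
rewrite mulmxBr !entryB Yv Ys J; ring.
Qed.

Lemma resid_ae : {ae P, forall w,
  \sum_(i < n) sqn (resid n i w) @[n --> \oo] --> (0 : R)}.
Proof.
apply: filterS path_increment => w [G GP].
pose Cs := \sum_u \sum_(e : {k : 'I_4 & 'I_(dim k)}) `|C (tag e) u (tagged e)|.
(* A single nondecreasing function whose increments dominate those of all coordinates. *)
pose G' s := \sum_e G e s.
have cG' : {within `[0, T], continuous G'}.
  apply/subspace_continuousP => x Tx; apply: cvg_big => [|e _]; first exact: add_continuous.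
  by have [/subspace_continuousP/(_ x Tx)] := GP e.
have mG' : {in `[0, T] &, {homo G' : x y / x <= y}}.
  by move=> x y xT yT xy; apply: ler_sum => e _; have [_ mG _] := GP e; exact: mG.
have lim0 := sum_sqr_mesh_cvg0 T0 cG' mG'.
have bound n i : (i < n)%N ->
    sqn (resid n i w) <= p%:R * Cs ^+ 2 * (G' (t n i.+1) - G' (t n i)) ^+ 2.
  move=> iN; have n0 : (0 < n)%N by exact: leq_ltn_trans iN.
  have Ti := grid_itv T0 (ltnW iN) n0; have TS := grid_itv T0 iN n0.
  have [D DE] : exists D, D = G' (t n i.+1) - G' (t n i) by eexists.
  have D0 : 0 <= D by rewrite DE subr_ge0 mG'.
  rewrite -DE.
  have Cs0 : 0 <= Cs by apply: sumr_ge0 => u _; apply: sumr_ge0.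
  rewrite /resid; case E : (jumped n i w).
    by rewrite sqn0 mulr_ge0 ?mulr_ge0 ?sqr_ge0.
  have entry u : (incr (X ^~ w) (T / n%:R) i - eps n i w) u ord0 ^+ 2 <=
      (Cs * D) ^+ 2.
    rewrite -[leLHS](real_normK (num_real _)) lerXn2r ?nnegrE ?mulr_ge0//.
    rewrite /incr !hX// noiseE -!sumrB.
    under eq_bigr do rewrite -!mulmxBr.
    rewrite summxE.
    under eq_bigr do rewrite mxE.
    rewrite (sig_big_dep xpredT (fun=> xpredT) (fun k j => C k u j *
      (Y k (t n i.+1) w - Y k (t n i) w -
        S k *m (W k (t n i.+1) w - W k (t n i) w)) j ord0)) /=.
    apply: (le_trans (ler_norm_sum _ _ _)).
    rewrite /Cs (bigD1 u)//= mulrDl -[leLHS]addr0 lerD//; last first.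
      by apply: mulr_ge0 => //; apply: sumr_ge0 => v _; apply: sumr_ge0.
    rewrite mulr_suml; apply: ler_sum => e _; rewrite normrM ler_wpM2l//.
    have [_ mG dG] := GP e.
    have m0 : mu (tag e) w (`]t n i, t n i.+1] `*` nonzero) = 0%E.
      by move/negbT: E; rewrite negb_exists => /forallP/(_ (tag e)); rewrite negbK => /eqP.
    have TT : t n i.+1 <= T by move: TS; rewrite in_itv/= => /andP[].
    apply: (le_trans (dG _ _ (t_ge0 n i) (t_le n i) TT m0)).
    rewrite DE /G' -sumrB (bigD1 e)//= lerDl sumr_ge0// => e' _.
    by have [_ mG2 _] := GP e'; rewrite subr_ge0 mG2.
  apply: (le_trans (ler_sum _ (fun u _ => entry u))).
  by rewrite sumr_const card_ord exprMn -mulrA mulr_natl.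
have up : p%:R * Cs ^+ 2 * \sum_(i < n) (G' (t n i.+1) - G' (t n i)) ^+ 2
    @[n --> \oo] --> (0 : R).
  by rewrite -[X in _ --> X](mulr0 (p%:R * Cs ^+ 2)); apply: cvgM => //; exact: cvg_cst.
suff sq : \forall n \near \oo, 0 <= \sum_(i < n) sqn (resid n i w) <=
    p%:R * Cs ^+ 2 * \sum_(i < n) (G' (t n i.+1) - G' (t n i)) ^+ 2.
  exact: (squeeze_cvgr sq (cvg_cst _) up).
apply: nearW => n; apply/andP; split; first by apply: sumr_ge0 => i _; exact: sqn_ge0.
by rewrite mulr_sumr; apply: ler_sum => i _; exact: bound.
Qed.

Hypothesis hYad : forall k, adapted Ft (Y k).
Local Notation increments V :=
  <<s \bigcup_(u in [set u : R | 0 <= u]) sigma_of (fun w => V u w - V 0 w) >>.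
Hypothesis WW : forall k l, k != l -> forall A B,
  increments (W k) A -> increments (W l) B -> P (A `&` B) = (P A * P B)%E.
Variables (D rho : R).
Hypotheses (D0 : 0 < D) (rho0 : 0 < rho) (rho_lt : rho < 1 / 2).

Lemma observation_measurable v : 0 <= v -> measurable_fun setT (X v).
Proof.
move=> v0; apply/measurable_mxP => i j; rewrite (ord1 j).
rewrite (_ : (fun w => _) = (fun w => \sum_k (C k *m Y k v w) i ord0)); last first.
  by apply/funext => w; rewrite hX// summxE.
apply: measurable_sum => k; apply: measurable_fun_mx_entry.
apply: measurable_mulmx => // _ B mB; apply: ((hF.1 v v0).2).
by apply: (hYad v0); exists B.
Qed.

Lemma noise_measurable n i : measurable_fun setT (eps n i).
Proof.
apply/measurable_mxP => u j; under eq_fun do rewrite mxE.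
apply: measurable_sum => e; apply: measurable_funM => //.
by apply: (winc_measurable hF (hW _)).
Qed.

Lemma jumped_measurable n i : measurable_fun setT (fun w => (jumped n i w)%:R : R).
Proof.
pose A k := [set w | mu k w (`]t n i, t n i.+1] `*` nonzero) != 0%E].
have mA k : measurable (A k).
  have [_ _ mmu _ _] := hmu k.
  have mI : measurable (`]t n i, t n i.+1]%classic `*` @nonzero R (dim k)).
    by apply: measurableX => //; exact: measurable_nonzero.
  rewrite (_ : A k = ~` [set w | mu k w (`]t n i, t n i.+1] `*` nonzero) = 0%E]).
    apply: measurableC; rewrite -[X in measurable X]setTI.
    exact: ((mmu _ mI).1 measurableT _ (emeasurable_set1 _)).
  by apply/seteqP; split => w /= /eqP.
have mU : measurable (\bigcup_(k in setT) A k) by apply: fin_bigcup_measurable.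
rewrite (_ : (fun w => _) = \1_(\bigcup_(k in setT) A k)); first exact: measurable_indic.
apply/funext => w; rewrite indicE; congr (nat_of_bool _)%:R.
apply/idP/idP => [/existsP[k hk]|]; first by apply/mem_set; exists k.
by rewrite inE => -[k _ hk]; apply/existsP; exists k.
Qed.

Definition thr2 (n : nat) : R := (D * (T / n%:R) `^ rho) ^+ 2.

Let mesh_gt0 n : (0 < n)%N -> 0 < T / n%:R.
Proof. by move=> n0; rewrite divr_gt0// ltr0n. Qed.

Lemma thr2_gt0 n : (0 < n)%N -> 0 < thr2 n.
Proof. by move=> n0; rewrite exprn_gt0// mulr_gt0// powR_gt0// mesh_gt0. Qed.

Lemma powR_mesh_cvg0 (x : R) : 0 < x -> (T / n%:R) `^ x @[n --> \oo] --> (0 : R).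
Proof.
move=> xgt0; apply: (@cvg_comp _ _ _ (fun n : nat => T / n%:R) (fun y => y `^ x) _ _ _ _ (powR_cvg0 xgt0)).
move=> A; rewrite /at_right /within /= => /nbhs_ballP[e /= e0 eA].
suff : \forall n \near \oo, A (T / n%:R) by [].
near=> n; have n0 : (0 < n)%N by near: n; exact: nbhs_infty_gt.
have nr : 0 < n%:R :> R by rewrite ltr0n.
apply: eA; last exact: mesh_gt0.
rewrite /ball/= sub0r normrN gtr0_norm ?mesh_gt0// ltr_pdivrMr// mulrC -ltr_pdivrMr//.
by near: n; exact: nbhs_infty_gtr.
Unshelve. all: by end_near. Qed.

Lemma thr2E n : (0 < n)%N -> thr2 n = D ^+ 2 * (T / n%:R) `^ (rho + rho).
Proof.
move=> n0; rewrite /thr2 exprMn expr2 [_ `^ _ ^+ 2]expr2 powRD//.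
by apply/implyP => _; rewrite gt_eqF// mesh_gt0.
Qed.

Lemma thr2_cvg0 : thr2 n @[n --> \oo] --> (0 : R).
Proof.
have h : D ^+ 2 * (T / n%:R) `^ (rho + rho) @[n --> \oo] --> (0 : R).
  rewrite -[X in _ --> X](mulr0 (D ^+ 2)); apply: cvgM; first exact: cvg_cst.
  by apply: powR_mesh_cvg0; rewrite addr_gt0.
apply: cvg_trans h; apply: near_eq_cvg; near=> n; rewrite thr2E//.
by near: n; exact: nbhs_infty_gt.
Unshelve. all: by end_near. Qed.

Lemma mesh_thr2_cvg0 : T / n%:R / thr2 n @[n --> \oo] --> (0 : R).
Proof.
have h : D ^- 2 * (T / n%:R) `^ (1 - (rho + rho)) @[n --> \oo] --> (0 : R).
  rewrite -[X in _ --> X](mulr0 (D ^- 2)); apply: cvgM; first exact: cvg_cst.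
  by apply: powR_mesh_cvg0; have := rho_lt; lra.
apply: cvg_trans h; apply: near_eq_cvg; near=> n.
have n0 : (0 < n)%N by near: n; exact: nbhs_infty_gt.
have m0 := mesh_gt0 n0; have p0 : 0 < (T / n%:R) `^ (rho + rho) by exact: powR_gt0.
rewrite thr2E// powRB; last by apply/implyP => _; rewrite gt_eqF.
rewrite powRr1 ?ltW//; set b := _ `^ _ in p0 *; set m := T / n%:R.
by field; rewrite !gt_eqF.
Unshelve. all: by end_near. Qed.

Lemma keptE n i w : kept D rho (T / n%:R) (X ^~ w) i =
  (sqn (incr (X ^~ w) (T / n%:R) i) <= thr2 n).
Proof. by rewrite /kept frob_le// mulr_ge0 ?powR_ge0// ltW. Qed.

(** The bound on the number of jumps depends on the path, so convergence is first obtained almost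
    surely. *)
Lemma jumps_whp (e : R) : 0 < e ->
  whp P (fun n => [set w | thr2 n * \sum_(i < n) (jumped n i w)%:R < e]).
Proof.
move=> e0; pose Z n w : R := thr2 n * \sum_(i < n) (jumped n i w)%:R.
have mZ n : measurable_fun setT (Z n).
  by apply: measurable_funM => //; apply: measurable_sum => i; exact: jumped_measurable.
apply: (whp_sub (whp_ae mZ _ e0)); last first.
  by apply: nearW => n w /=; apply: le_lt_trans; exact: ler_norm.
apply: filterS jump_count_ae_fin => w [K hK].
have up : thr2 n * K @[n --> \oo] --> (0 : R).
  by rewrite -(mul0r K); apply: cvgM; [exact: thr2_cvg0|exact: cvg_cst].
suff sq : \forall n \near \oo, 0 <= Z n w <= thr2 n * K.
  exact: (squeeze_cvgr sq (cvg_cst _) up).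
near=> n; have n0 : (0 < n)%N by near: n; exact: nbhs_infty_gt.
rewrite mulr_ge0 ?(ltW (thr2_gt0 n0))//=; last by apply: sumr_ge0 => i _.
by rewrite ler_wpM2l ?(ltW (thr2_gt0 n0))// hK.
Unshelve. all: by end_near. Qed.

Lemma resid_whp (e : R) : 0 < e ->
  whp P (fun n => [set w | \sum_(i < n) sqn (resid n i w) < e]).
Proof.
move=> e0.
have mZ n : measurable_fun setT (fun w => \sum_(i < n) sqn (resid n i w)).
  apply: measurable_sum => i.
  rewrite (_ : (fun w => _) = (fun w => (1 - (jumped n i w)%:R) *
      sqn (incr (X ^~ w) (T / n%:R) i - eps n i w))); last first.
    apply/funext => w; rewrite /resid; case: (jumped n i w).
      by rewrite sqn0 subrr mul0r.
    by rewrite subr0 mul1r.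
  apply: measurable_funM; first by apply: measurable_funB => //; exact: jumped_measurable.
  apply: measurable_sum => u.
  under eq_fun do rewrite expr2.
  have mE : measurable_fun setT (fun w => (incr (X ^~ w) (T / n%:R) i - eps n i w) u ord0).
    apply: measurable_fun_mx_entry; apply: measurable_addmx.
      apply: (@measurable_incr _ _ _ _ (fun w v => X v w)).
        exact: observation_measurable.
      by rewrite divr_ge0// ltW.
    by apply: measurable_oppmx; exact: noise_measurable.
  exact: measurable_funM.
apply: (whp_sub (whp_ae mZ resid_ae e0)).
by apply: nearW => n w /=; apply: le_lt_trans; exact: ler_norm.
Qed.

Lemma outer_mxE (v : 'cV[R]_p) i j : (v *m v^T) i j = v i ord0 * v j ord0.
Proof. by rewrite mxE big_ord1; congr (_ * _); rewrite mxE. Qed.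

Lemma mx_entryB (A B : 'M[R]_p) i j : (A - B) i j = A i j - B i j.
Proof. by rewrite !mxE. Qed.

Definition realized_cov (n : nat) (w : Omega) : 'M[R]_p :=
  (n%:R * (T / n%:R))^-1 *: \sum_(i < n) (kept D rho (T / n%:R) (X ^~ w) i)%:R *:
    (incr (X ^~ w) (T / n%:R) i *m (incr (X ^~ w) (T / n%:R) i)^T).

Definition kept_ratio (n : nat) (w : Omega) : R :=
  n%:R^-1 * \sum_(i < n) (kept D rho (T / n%:R) (X ^~ w) i)%:R.

(** Kept products differ from the Gaussian ones by the errors of [truncated_entry_le], summed over
    the cells, and the Gaussian ones add up to nearly [T] times the limit by [gram_whp]. For the
    ratio, [bad_increment_le] charges [thr2 n] for every dropped cell. *)
Lemma realized_cov_whp (e : R) : 0 < e ->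
  whp P (fun n => [set w |
    (forall u v, `|(realized_cov n w
       - \sum_k (C k *m S k) *m (C k *m S k)^T) u v| <= e) /\
    1 - e <= kept_ratio n w <= 1]).
Proof.
move=> e0.
pose S0 := \sum_k (C k *m S k) *m (C k *m S k)^T.
have S0E u v : S0 u v = \sum_b volatility u b * volatility v b.
  rewrite /S0 summxE -(sig_big_dep xpredT (fun=> xpredT)
    (fun k b => (C k *m S k) u b * (C k *m S k) v b)) /=.
  by apply: eq_bigr => k _; rewrite mxE; apply: eq_bigr => b _; rewrite [in X in _ * X]mxE.
(* Bounds the sum of the squared Gaussian parts once each diagonal entry of their Gram matrix is
   within 1 of its limit. *)
pose Q := T * \sum_u S0 u u + p%:R.
have Q0 : 0 <= Q.
  rewrite addr_ge0// mulr_ge0 ?(ltW T0)// sumr_ge0// => u _; rewrite S0E.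
  by apply: sumr_ge0 => b _; rewrite -expr2 sqr_ge0.
pose Te := T * e; have Te0 : 0 < Te by rewrite mulr_gt0.
pose eta := Te / (4 * (Q + 1)).
have Q10 : 0 < Q + 1 by rewrite ltr_wpDl.
have eta0 : 0 < eta by rewrite divr_gt0// mulr_gt0.
(* [14 = 2 + 9 + 3] collects coefficients of [truncated_entry_le]; in [d1], [21 = 1 + 16 + 4]
   collects those of [bad_increment_le]. Three errors of at most [T e / 4] then fit into [T e]. *)
pose K := 14 + eta^-1.
have K0 : 0 < K by rewrite ltr_wpDr// invr_ge0 ltW.
pose d1 := Num.min (Te / (4 * K)) (e / 21).
have d10 : 0 < d1 by rewrite lt_min !divr_gt0// mulr_gt0.
pose d2 := Num.min 1 (Te / 4).
have d20 : 0 < d2 by rewrite lt_min ltr01 divr_gt0.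
have H1 := jumps_whp d10.
have H2 := quartic_whp hF hW T0 volatility thr2_gt0 mesh_thr2_cvg0 d10.
have H3 := resid_whp d10.
have H4 := gram_whp hF hW WW T0 volatility d20.
apply: (whp_sub (whpI (whpI H1 H2) (whpI H3 H4))).
near=> n => w /= [[h1 h2] [h3 h4]].
have n0 : (0 < n)%N by near: n; exact: nbhs_infty_gt.
have nr : 0 < n%:R :> R by rewrite ltr0n.
have th0 := thr2_gt0 n0.
(* This amounts to [1 <= n * thr2 n], so that the proportion of dropped increments is at most
   [thr2 n] times their number. *)
have nth : T / n%:R / thr2 n <= T.
  have h : `|T / n%:R / thr2 n| < T.
    by near: n; exact: (cvgr0_norm_lt _ mesh_thr2_cvg0).
  by apply: ltW; exact: le_lt_trans (ler_norm _) h.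
have {}nth : 1 <= n%:R * thr2 n.
  have nt0 : 0 < n%:R * thr2 n by rewrite mulr_gt0.
  have E : T / n%:R / thr2 n = T / (n%:R * thr2 n) by field; rewrite !gt_eqF.
  by rewrite E (ler_pdivrMr _ _ nt0) (ler_pMr _ T0) in nth.
pose x i := incr (X ^~ w) (T / n%:R) i.
pose kp i : bool := sqn (x i) <= thr2 n.
pose J := \sum_(i < n) (jumped n i w)%:R : R.
pose Q4 := \sum_(i < n) sqn (eps n i w) ^+ 2 / thr2 n.
pose S2 := \sum_(i < n) sqn (resid n i w).
pose Q2 := \sum_(i < n) sqn (eps n i w).
rewrite -/J in h1; rewrite -/Q4 in h2; rewrite -/S2 in h3.
have hQ2 : Q2 <= Q.
  rewrite /Q2 /sqn exchange_big /= /Q mulr_sumr.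
  have -> : p%:R = \sum_(u < p) (1 : R) by rewrite sumr_const card_ord.
  rewrite -big_split/=; apply: ler_sum => u _; have := h4 (u, u) => /=.
  under eq_bigr do rewrite -expr2.
  rewrite -S0E; have : d2 <= 1 by rewrite ge_min lexx.
  by move=> a1 /(le_lt_trans (ler_norm _)); lra.
have keepE i : kept D rho (T / n%:R) (X ^~ w) i = kp i by exact: keptE.
split.
  move=> u v; rewrite -/S0.
  have VE : realized_cov n w u v =
      T^-1 * \sum_(i < n) (kp i)%:R * (x i u ord0 * x i v ord0).
    rewrite /realized_cov !mxE summxE; congr (_ * _).
      by congr (_^-1); field; rewrite gt_eqF.
    by apply: eq_bigr => i _; rewrite mxE keepE outer_mxE.
  set V := \sum_(i < n) _ in VE.
  have bound : `|V - \sum_(i < n) (eps n i w u ord0 * eps n i w v ord0)| <=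
      2 * (thr2 n * J) + 9 * Q4 + (3 + eta^-1) * S2 + eta * Q2.
    rewrite /V -sumrB; apply: (le_trans (ler_norm_sum _ _ _)).
    rewrite /J /Q4 /S2 /Q2 !mulr_sumr -!big_split/=; apply: ler_sum => i _.
    have := truncated_entry_le (x i) (eps n i w) (jumped n i w) th0 eta0 u v.
    by rewrite -(mulrA 2 (thr2 n)).
  have gram : `|\sum_(i < n) (eps n i w u ord0 * eps n i w v ord0) - T * S0 u v| < Te / 4.
    rewrite S0E; apply: lt_le_trans (h4 (u, v)) _.
    by rewrite ge_min lexx orbT.
  have d1K : d1 * K <= Te / 4.
    have : d1 <= Te / (4 * K) by rewrite ge_min lexx.
    by rewrite ler_pdivlMr ?mulr_gt0//; lra.
  have etaQ : eta * Q2 <= Te / 4.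
    apply: (@le_trans _ _ (eta * (Q + 1))).
      by rewrite ler_wpM2l ?(ltW eta0)// (le_trans hQ2)// lerDl.
    by rewrite /eta le_eqVlt; apply/orP; left; apply/eqP; field; rewrite gt_eqF.
  have S2K : (3 + eta^-1) * S2 <= (3 + eta^-1) * d1.
    by rewrite ler_wpM2l ?(ltW h3)// addr_ge0// invr_ge0 ltW.
  have -> : (realized_cov n w - S0) u v = T^-1 * (V - T * S0 u v).
    by rewrite mx_entryB VE; field; rewrite gt_eqF.
  rewrite normrM gtr0_norm ?invr_gt0// mulrC ler_pdivrMr// (mulrC e) -/Te.
  have tri := ler_distD (\sum_(i < n) (eps n i w u ord0 * eps n i w v ord0)) V (T * S0 u v).
  rewrite /K in d1K; lra.
have bad : thr2 n * \sum_(i < n) (~~ kp i)%:R <= 21 * d1.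
  apply: (@le_trans _ _ (thr2 n * J + 16 * Q4 + 4 * S2)); last by lra.
  rewrite /J /Q4 /S2 !mulr_sumr -!big_split/=; apply: ler_sum => i _.
  apply: le_trans (bad_increment_le (x i) (eps n i w) (jumped n i w) th0).
  rewrite ler_wpM2l ?(ltW th0)// ler_nat.
  by rewrite /kp; case: (jumped n i w); case: (_ <= _).
have keepS : \sum_(i < n) (kept D rho (T / n%:R) (X ^~ w) i)%:R =
    n%:R - \sum_(i < n) (~~ kp i)%:R :> R.
  rewrite -[X in X%:R - _](card_ord n) -sumr_const -sumrB; apply: eq_bigr => i _.
  by rewrite keepE; case: (kp i); rewrite ?subr0 ?subrr.
set B := \sum_(i < n) (~~ _)%:R in bad keepS.
have B0 : 0 <= B by apply: sumr_ge0.
have d1e : 21 * d1 <= e.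
  have : d1 <= e / 21 by rewrite ge_min lexx orbT.
  by rewrite ler_pdivlMr//; lra.
rewrite /kept_ratio keepS mulrBr mulVf ?gt_eqF//.
have nB0 : 0 <= n%:R^-1 * B by rewrite mulr_ge0// invr_ge0 ltW.
have nB : n%:R^-1 * B <= thr2 n * B.
  by rewrite ler_wpM2r// -[leLHS]mul1r ler_pdivrMr// mulrC.
by apply/andP; split; lra.
Unshelve. all: by end_near. Qed.

End system.

(** * The selection theorem *)

Lemma big_latent (V : nmodType) (G : 'I_4 -> V) :
  \sum_k G k = G i_xi + G i_delta + G i_eps + G i_zeta.
Proof.
rewrite !big_ord_recl big_ord0 addr0 !addrA.
by congr (G _ + G _ + G _ + G _); exact: val_inj.
Qed.

Lemma col_mx_congr (K : pzRingType) m1 m2 n (A : 'M[K]_(m1, n)) (B : 'M[K]_(m2, n))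
    (S : 'M[K]_n) :
  col_mx A B *m S *m (col_mx A B)^T =
  block_mx (A *m S *m A^T) (A *m S *m B^T) (B *m S *m A^T) (B *m S *m B^T).
Proof. by rewrite tr_col_mx mul_col_mx mul_col_row. Qed.

(** * Reduced form of the structural model *)

Section observation.
Context {R : realType} {p1 p2 k1 k2 : nat} {r : 'I_4 -> nat}.
Variable M : sem R p1 p2 k1 k2 r.
Hypothesis uM : psi M \in unitmx.
Local Notation dim := (latent_dim p1 p2 k1 k2).
Local Notation Pi := (invmx (psi M)).

(* The reduced form [X = sum_k loading k *m Y_k] of the model, where
   [Y_0, ..., Y_3] are [xi, delta, epsilon, zeta]. *)
Definition loading (k : 'I_4) : 'M[R]_(p1 + p2, dim k) :=
  match nat_of_ord k as m return 'M[R]_(p1 + p2, nth 0%N [:: k1; p1; p2; k2] m) with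
  | 0 => col_mx (load1 M) (load2 M *m Pi *m gam M)
  | 1 => col_mx 1%:M 0
  | 2 => col_mx 0 1%:M
  | 3 => col_mx 0 (load2 M *m Pi)
  | _ => 0
  end.

(** [eta] is eliminated by inverting [psi M] in the structural equation. *)
Lemma observedE (y : forall k, 'cV[R]_(dim k)) (eta : 'cV[R]_k2) :
  eta = beta M *m eta + gam M *m y i_xi + y i_zeta ->
  observed M (y i_xi) (y i_delta) (y i_eps) eta = \sum_k loading k *m y k.
Proof.
move=> etaE; have -> : eta = Pi *m (gam M *m y i_xi + y i_zeta).
  rewrite -(mulKmx uM eta); congr (_ *m _); rewrite /psi mulmxBl mul1mx.
  by apply/eqP; rewrite subr_eq {1}etaE -addrA addrC.
rewrite big_latent /observed /loading /=.
rewrite !mul_col_mx !mul1mx !mul0mx !add_col_mx !addr0.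
by rewrite !mulmxDr !mulmxA addrAC.
Qed.

(** One term per latent noise: the shape in which the limit of the realised covariance arises. *)
Lemma sem_covE : sem_cov M = \sum_k (loading k *m vol M k) *m (loading k *m vol M k)^T.
Proof.
have E k : (loading k *m vol M k) *m (loading k *m vol M k)^T =
    loading k *m cov M k *m (loading k)^T.
  by rewrite trmx_mul /cov !mulmxA.
rewrite (eq_bigr _ (fun k _ => E k)) big_latent /loading /=.
rewrite !col_mx_congr !trmx0 !trmx1 !mul1mx !mulmx1 !mul0mx !mulmx0.
rewrite !add_block_mx !addr0.
rewrite /sem_cov; congr block_mx.
- by rewrite !trmx_mul !mulmxA.
- by rewrite !trmx_mul !trmxK !mulmxA.
- rewrite !trmx_mul mulmxDr !mulmxDl !mulmxA.
  by rewrite addrAC.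
Qed.

End observation.
Theorem theorem2
  (R : realType) (d : measure_display) (Omega : measurableType d)
  (P : probability Omega R) (Ft : R -> set (set Omega))
  (p1 p2 k1 k2 : nat) (r : 'I_4 -> nat)
  (dim := latent_dim p1 p2 k1 k2)
  (* true model *)
  (lam : 'I_4 -> R)
  (F : forall i, 'cV[R]_(dim i) -> R)
  (f := fun i (z : 'cV[R]_(dim i)) => lam i * F i z)
  (a : forall i, 'cV[R]_(dim i) -> 'cV[R]_(dim i))
  (c : forall i, 'cV[R]_(dim i) -> 'cV[R]_(dim i) -> 'cV[R]_(dim i))
  (x0 : forall i, 'cV[R]_(dim i))
  (W : forall i, R -> Omega -> 'cV[R]_(r i))
  (mu : forall i, Omega ->
     {measure set (measurableTypeR R * 'cV[R]_(dim i))%type -> \bar R})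
  (Y : forall i, R -> Omega -> 'cV[R]_(dim i))
  (eta : R -> Omega -> 'cV[R]_k2)
  (M0 : sem R p1 p2 k1 k2 r)
  (X := fun t w => observed M0 (Y i_xi t w) (Y i_delta t w) (Y i_eps t w)
                     (eta t w))
  (Sigma0 := sem_cov M0)
  (* sampling scheme *)
  (T D rho : R) (h := fun n : nat => T / n%:R)
  (* parametric models *)
  (M : nat) (q : 'I_M -> nat)
  (Theta : forall m, set 'cV[R]_(q m))
  (model : forall m, 'cV[R]_(q m) -> sem R p1 p2 k1 k2 r)
  (Sigma := fun m (theta : 'cV[R]_(q m)) => sem_cov (model m theta))
  (H := fun m n (w : Omega) (theta : 'cV[R]_(q m)) =>
          quasi_loglik D rho (h n) n (X ^~ w) (Sigma m theta))
  (Hlim := fun m (theta : 'cV[R]_(q m)) => limit_loglik Sigma0 (Sigma m theta))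
  (thetahat : forall m, nat -> Omega -> 'cV[R]_(q m))
  (thetabar : forall m, 'cV[R]_(q m))
  (prior : forall m, 'cV[R]_(q m) -> R)
  (mstar : 'I_M) :
  (* dimensions *)
  (0 < k1 <= p1)%N -> (0 < k2 <= p2)%N -> (forall i, 0 < r i)%N ->
  (* noise: Wiener processes and Poisson random measures *)
  filtration Ft ->
  (forall i, 0 < lam i) ->
  (forall i, measurable_fun nonzero (F i) /\
     (forall z, z != 0 -> 0 <= F i z) /\
     (\int[@lebesgue_vec R (dim i)]_(z in nonzero) (F i z)%:E = 1)%E) ->
  (forall i, wiener P Ft (W i)) ->
  (forall i, poisson_random_measure P Ft (f i) (mu i)) ->
  (forall t, 0 <= t -> independent_sigma P (innovation_sigma Ft W mu t)) ->
  (* latent processes *)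
  (forall i, measurable_fun setT (a i)) ->
  (forall i, measurable_fun (setT `*` nonzero)
     (fun xz : 'cV[R]_(dim i) * 'cV[R]_(dim i) => c i xz.1 xz.2)) ->
  (forall i, adapted Ft (Y i)) ->
  (forall i, {ae P, forall w, cadlag (Y i ^~ w)}) ->
  (forall i, jump_sde P (a i) (vol M0 i) (c i) (x0 i) (W i) (mu i) (Y i)) ->
  (forall t w, 0 <= t ->
     eta t w = beta M0 *m eta t w + gam M0 *m Y i_xi t w + Y i_zeta t w) ->
  sem_wf M0 -> posdefmx Sigma0 ->
  0 < T -> 0 < D -> 1 / 3 <= rho < 1 / 2 ->
  (* parametric models and estimators *)
  (forall m, [/\ open (Theta m), bounded_set (Theta m) &
     convex_set (Theta m : set (convex_lmodType 'cV[R]_(q m)))]) ->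
  (forall m theta, Theta m theta -> sem_wf (model m theta)) ->
  (forall m theta, closure (Theta m) theta ->
     psi (model m theta) \in unitmx /\ posdefmx (Sigma m theta)) ->
  (forall m n w, (0 < n)%N -> Ck_closure 3 (Theta m) (H m n w)) ->
  (forall m n w, (0 < n)%N ->
     closure (Theta m) (thetahat m n w) /\
     H m n w (thetahat m n w) =
       sup [set H m n w theta | theta in closure (Theta m)]) ->
  optimal_model Theta Sigma Sigma0 mstar ->
  (forall m, optimal_model Theta Sigma Sigma0 m -> m = mstar) ->
  (forall m, Theta m (thetabar m) /\
     Hlim m (thetabar m) = sup [set Hlim m theta | theta in Theta m]) ->
  (* (a) *)
  (forall i, exists (L : R) (kappa : 'cV[R]_(dim i) -> R),
     [/\ 0 < L,
         (forall z, z != 0 -> 0 < kappa z) /\ poly_growth nonzero kappa,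
         forall x y, frob (a i x - a i y) <= L * frob (x - y),
         forall x y z, z != 0 ->
           frob (c i x z - c i y z) <= kappa z * frob (x - y) &
         forall x z, z != 0 -> frob (c i x z) <= kappa z * (1 + frob x)]) ->
  (* (b) *)
  (forall i j, Ck_poly 4 (fun x => a i x j ord0)) ->
  (* (c) *)
  (forall i,
     (exists rbar K : R, [/\ 0 < rbar, 0 < K &
        forall z, z != 0 ->
          f i z * (frob z <= rbar)%R%:R <= K * frob z `^ (1 - (dim i)%:R)]) /\
     (forall L : R, 1 <= L ->
        (\int[@lebesgue_vec R (dim i)]_(z in nonzero)
          (frob z `^ L * f i z)%:E < +oo)%E)) ->
  (* (d) *)
  (forall i, exists c0 eps : R, [/\ 0 < c0, 0 < eps &
     forall z, z != 0 -> frob z < eps ->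
       c0 * frob z <= inf [set frob (c i x z) | x in setT]]) ->
  (* priors *)
  (forall m, [/\ forall theta, Theta m theta -> 0 <= prior m theta,
      (\int[@lebesgue_vec R (q m)]_(theta in Theta m) (prior m theta)%:E = 1)%E,
      {within closure (Theta m), continuous (prior m)},
      (exists K : R, forall theta, closure (Theta m) theta ->
         `|prior m theta| <= K) &
      0 < prior m (thetabar m)]) ->
  (* identifiability *)
  (forall m theta, Theta m theta ->
     Hlim m theta = Hlim m (thetabar m) -> theta = thetabar m) ->
  forall m, ~ correctly_specified Theta Sigma Sigma0 m ->
    (fun n => P [set w |
       QBIC (q mstar) n (H mstar n w (thetahat mstar n w)) <
       QBIC (q m) n (H m n w (thetahat m n w))]) @ \oo --> 1%E.

Proof.
move=> hk1 hk2 hr hF hlam hFd hW hmu hind ma mc hYad hYc hsde heta wf0 pS0 T0 D0 hrho.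
move=> hTh hwf hclos hCk hhat hopt huniq hbar _ _ _ _ _ _ m mis.
have [rho1 rho2] := andP hrho.
have rho0 : 0 < rho by lra.
have uM0 : psi M0 \in unitmx by case: wf0.
have hX t w : 0 <= t -> X t w = \sum_k loading M0 k *m Y k t w.
  by move=> t0; rewrite -(observedE uM0 (heta t w t0)).
have hf k : [/\ measurable_fun nonzero (f k), forall z, z != 0 -> 0 <= f k z &
    (\int[@lebesgue_vec R (dim k)]_(z in nonzero) (f k z)%:E < +oo)%E].
  have [mF [F0 F1]] := hFd k; split.
  - exact: measurable_funM.
  - by move=> z z0; rewrite mulr_ge0 ?F0// ltW.
  - under eq_integral do rewrite EFinM.
    have mz := @measurable_nonzero R (dim k).
    rewrite ge0_integralZl//; last 2 first.
    + exact/measurable_EFinP.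
    + by rewrite lee_fin ltW.
    by rewrite F1 mule1 ltry.
(* Independence of two members of the family at time 0, from which all increments are future
   ones. *)
have WW k l : k != l -> forall A B,
    <<s \bigcup_(u in [set u : R | 0 <= u]) sigma_of (fun w => W k u w - W k 0 w) >> A ->
    <<s \bigcup_(u in [set u : R | 0 <= u]) sigma_of (fun w => W l u w - W l 0 w) >> B ->
    P (A `&` B) = (P A * P B)%E.
  move=> kl A B GA GB; have ne : Some (false, k) != Some (false, l).
    by apply: contra_neq kl => -[].
  pose AB (o : option (bool * 'I_4)) := if o == Some (false, k) then A else B.
  have := hind 0 (lexx 0) [set Some (false, k); Some (false, l)]%SET AB.
  rewrite (_ : \bigcap_(i in _) AB i = A `&` B); last first.
    apply/seteqP; split => w.
      move=> hw; split.
        by have := hw (Some (false, k)); rewrite /AB eqxx; apply; rewrite /= !inE eqxx.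
      have := hw (Some (false, l)); rewrite /AB eq_sym (negbTE ne); apply.
      by rewrite /= !inE eqxx orbT.
    by move=> [hA hB] o _; rewrite /AB; case: ifP.
  rewrite big_setU1/= ?inE// big_set1 /AB eqxx eq_sym (negbTE ne); apply.
  move=> o; rewrite !inE => /orP[] /eqP ->; first by rewrite eqxx.
  by rewrite eq_sym (negbTE ne).
have SigmaE : Sigma0 = \sum_k (loading M0 k *m vol M0 k) *m (loading M0 k *m vol M0 k)^T.
  exact: sem_covE.
have mX t : 0 <= t -> measurable_fun setT (X t).
  exact: (observation_measurable hF hX hYad).
have pm m' th : closure (Theta m') th -> posdefmx (Sigma m' th) by move=> /hclos[].
have [e e0 select] := QBIC_select pS0 (pm m) (pm mstar) hopt.1 mis (hbar m).1 (hbar m).2.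
apply: whp_cvg1.
  near=> n; have n0 : (0 < n)%N by near: n; exact: nbhs_infty_gt.
  have h0 : 0 <= h n by rewrite divr_ge0// ltW.
  (* The value at the estimator is the supremum of the quasi-likelihood, which is measurable by
     reduction to countably many parameters. *)
  have mH m' : measurable_fun setT (fun w => H m' n w (thetahat m' n w)).
    rewrite (_ : (fun w => _) = (fun w => sup [set H m' n w th | th in closure (Theta m')])).
      apply: measurable_sup_closure.
      - by have [] := hTh m'.
      - by exists (thetabar m'); exact: (hbar m').1.
      - move=> th; apply: (measurable_quasi_loglik (X := fun w t => X t w)) => //.
      - by move=> w; have [] := hCk m' n w n0.
    by apply/funext => w; exact: (hhat m' n w n0).2.
  have mQ m' : measurable_fun setT (fun w => QBIC (q m') n (H m' n w (thetahat m' n w))).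
    by apply: measurable_funD => //; exact: measurable_funM.
  have := measurable_fun_ltr (mQ mstar) (mQ m).
  move=> /(_ measurableT [set true]) mlt; have {}mlt := mlt I.
  by rewrite setTI in mlt.
have := realized_cov_whp hF hW hmu hf hsde T0 hX hYad WW D0 rho0 rho2 e0.
move=> /whp_sub; apply; near=> n => w /= [Vn cn].
have n0 : (0 < n)%N by near: n; exact: nbhs_infty_gt.
(* Stated without [w], so that the threshold in [n] is the same for all paths. *)
have sel : forall V c, (forall i j, `|(V - Sigma0) i j| <= e) -> 1 - e <= c <= 1 ->
    forall l : 'M[R]_(p1 + p2) -> R,
    (forall S, l S = - (n%:R / 2 * gauss_loss S V c)) ->
    {within closure (Theta m), continuous (l \o Sigma m)} ->
    forall th ths, closure (Theta m) th ->
      l (Sigma mstar ths) = sup [set l (Sigma mstar t) | t in closure (Theta mstar)] ->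
      QBIC (q mstar) n (l (Sigma mstar ths)) < QBIC (q m) n (l (Sigma m th)).
  by near: n.
have h0 : 0 < h n by rewrite divr_gt0// ltr0n.
apply: (sel (realized_cov T X D rho n w) (kept_ratio T X D rho n w) _ cn
  (fun S => quasi_loglik D rho (h n) n (X ^~ w) S)).
- by move=> i j; rewrite SigmaE; exact: Vn.
- by move=> S; rewrite quasi_loglikE.
- by have [] := hCk m n w n0.
- exact: (hhat m n w n0).1.
- exact: (hhat mstar n w n0).2.
Unshelve. all: by end_near. Qed.
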